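(* For $n\ge 1$, let $V_n$ be the set of all vectors $v\in\mathbb{R}^n$ with all coordinates in $\{-1,0,1\}$ and $|v|=\sqrt{3}$, and let $G_n=(V_n,E_n)$ be the graph in which two vertices $u,v$ are adjacent if and only if $\langle u,v\rangle=1$. Define $c(n)=0$ if $n\equiv 0\pmod 4$, $c(n)=1$ if $n\equiv 1 \pmod 4$, and $c(n)=2$ if $n\equiv 2$ or $3 \pmod 4$. Then for all $n\ge 3$, \[ \chi(\mathbb{R}^n)\ \ge\ \chi(\mathbb{Q}^n)\ \ge\ \chi(G_n)\ \ge\ \frac{|V_n|}{\alpha(G_n)} = \frac{8\binom{n}{3}}{\max\{6n-28,\; 4n-4c(n)\}}. \]
   Context: $\chi(\mathbb{R}^n)$ (resp. $\chi(\mathbb{Q}^n)$) denotes the chromatic number of the space, i.e. the minimum number of colors needed to color all points of $\mathbb{R}^n$ (resp. all points of $\mathbb{R}^n$ with rational coordinates) so that any two points at Euclidean distance exactly $1$ receive different colors. $\chi(G)$ is the chromatic number of a graph $G$, $\alpha(G)$ its independence number, and $\binom{n}{3}$ the binomial coefficient. *)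

(* Defs.v *)
From HB Require Import structures.
From mathcomp Require Import all_boot all_order all_algebra finmap.
From mathcomp Require Import all_classical all_reals all_analysis.

Set Implicit Arguments.
Unset Strict Implicit.
Unset Printing Implicit Defensive.

Import Order.TTheory GRing.Theory Num.Theory.

Local Open Scope classical_set_scope.
Local Open Scope ring_scope.

(* A simple, possibly infinite, graph whose vertices form a subset of an
   ambient type [T]; [adjacent] is only meaningful between vertices. *)
Record graph (T : Type) := Graph {
  vertices : set T;
  adjacent : T -> T -> Prop;
  adjacent_sym : forall x y, adjacent x y -> adjacent y x;
  adjacent_irr : forall x, vertices x -> ~ adjacent x x
}.

Definition colorable (T : Type) (G : graph T) (k : nat) : Prop :=
  exists f : T -> nat,
    (forall x, vertices G x -> (f x < k)%N) /\
    (forall x y, vertices G x -> vertices G y -> adjacent G x y -> f x <> f y).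

(* Least number of colors, as an extended real: the infimum is a minimum when
   [G] is colorable with finitely many colors ([chromatic_numberE]), and is
   [+oo] otherwise. *)
Definition chromatic_number (R : realType) (T : Type) (G : graph T) : \bar R :=
  ereal_inf [set (k%:R)%:E | k in [set k | colorable G k]].

Lemma chromatic_numberE (R : realType) (T : Type) (G : graph T) (k : nat) :
  colorable G k -> (forall j, colorable G j -> (k <= j)%N) ->
  chromatic_number R G = (k%:R)%:E.
Proof.
move=> Gk kmin; apply/eqP; rewrite eq_le; apply/andP; split.
  by apply: ereal_inf_lbound; exists k.
by apply: le_ereal_inf_tmp => _ [j Gj <-]; rewrite lee_fin ler_nat; exact: kmin.
Qed.

Definition independent (T : choiceType) (G : graph T) (S : {fset T}) : Prop :=
  forall x y, x \in S -> y \in S -> ~ adjacent G x y.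

(* [fset_set A] is the finite set with the elements of [A] when [A] is finite
   and is empty otherwise, so the next two notions are meant for graphs with
   finitely many vertices. *)
Definition num_vertices (T : choiceType) (G : graph T) : nat :=
  #|` fset_set (vertices G)|.

Definition independence_number (T : choiceType) (G : graph T) : nat :=
  (\max_(S <- fpowerset (fset_set (vertices G)) | `[< independent G S >])
    #|` S|)%N.

(* The default norm of ['rV[R]_n] is the sup norm, hence the explicit Euclidean
   structure. *)
Definition dot (R : realType) (n : nat) (u v : 'rV[R]_n) : R :=
  \sum_(i < n) u 0 i * v 0 i.

Definition euclidean_norm (R : realType) (n : nat) (v : 'rV[R]_n) : R :=
  Num.sqrt (dot v v).

Lemma dotC (R : realType) (n : nat) (u v : 'rV[R]_n) : dot u v = dot v u.
Proof. by apply: eq_bigr => i _; rewrite mulrC. Qed.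

Lemma dotNN (R : realType) (n : nat) (u v : 'rV[R]_n) :
  dot (- u) (- v) = dot u v.
Proof. by apply: eq_bigr => i _; rewrite !mxE mulrNN. Qed.

Definition unit_distance (R : realType) (n : nat) (u v : 'rV[R]_n) : Prop :=
  euclidean_norm (u - v) = 1.

Lemma unit_distance_sym (R : realType) (n : nat) (u v : 'rV[R]_n) :
  unit_distance u v -> unit_distance v u.
Proof. by rewrite /unit_distance /euclidean_norm -dotNN opprB. Qed.

Lemma unit_distance_irr (R : realType) (n : nat) (A : set 'rV[R]_n) v :
  A v -> ~ unit_distance v v.
Proof.
move=> _; rewrite /unit_distance /euclidean_norm subrr /dot big1 => [|i _].
  by rewrite sqrtr0 => /eqP; rewrite eq_sym oner_eq0.
by rewrite !mxE mul0r.
Qed.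

Definition unit_distance_graph (R : realType) (n : nat) (A : set 'rV[R]_n) :
    graph 'rV[R]_n :=
  Graph (@unit_distance_sym R n) (@unit_distance_irr R n A).

Definition rational_points (R : realType) (n : nat) : set 'rV[R]_n :=
  [set v : 'rV[R]_n | forall i, rational (v 0 i)].

Arguments rational_points : clear implicits.

Definition Vn (R : realType) (n : nat) : set 'rV[R]_n :=
  [set v : 'rV[R]_n | (forall i, v 0 i \in [:: -1; 0; 1]) /\
                      euclidean_norm v = Num.sqrt 3].

Arguments Vn : clear implicits.

Lemma finite_Vn (R : realType) (n : nat) : finite_set (Vn R n).
Proof.
pose g (f : {ffun 'I_n -> 'I_3}) : 'rV[R]_n :=
  \row_i nth 0 [:: -1; 0; 1] (f i).
apply: (@sub_finite_set _ _ (g @` setT)); last exact/finite_image/finite_finset.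
move=> v [vV _]; have vi i : (index (v 0%R i) [:: -1; 0; 1]%R < 3)%N.
  by rewrite (index_mem _ [:: -1; 0; 1 : R]) vV.
exists [ffun i => Ordinal (vi i)] => //.
by apply/rowP => i; rewrite mxE ffunE nth_index.
Qed.

Definition Gn_adjacent (R : realType) (n : nat) (u v : 'rV[R]_n) : Prop :=
  dot u v = 1.

Lemma Gn_adjacent_sym (R : realType) (n : nat) (u v : 'rV[R]_n) :
  Gn_adjacent u v -> Gn_adjacent v u.
Proof. by rewrite /Gn_adjacent dotC. Qed.

Lemma Gn_adjacent_irr (R : realType) (n : nat) (v : 'rV[R]_n) :
  Vn R n v -> ~ Gn_adjacent v v.
Proof.
rewrite /Gn_adjacent => -[_ + v1]; rewrite /euclidean_norm v1 => /eqP.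
by rewrite eqr_sqrt // (eqr_nat _ 1 3).
Qed.

Definition Gn (R : realType) (n : nat) : graph 'rV[R]_n :=
  Graph (@Gn_adjacent_sym R n) (@Gn_adjacent_irr R n).

Definition cn (n : nat) : nat :=
  (match n %% 4 with 0 => 0 | 1 => 1 | _ => 2 end)%N.

(* Main.v *)
(** Halving maps [G_n] into the unit distance graph of the rational points, and a colour class
    of [G_n] is independent, so the point is the value of [alpha (G_n)].  A vector of [V_n] is a
    triple [e_p + e_q + e_r] of signed basis vectors.  In an independent set two triples with the
    common element [p] share the vertex of a further element, and two triples never share just two
    elements and have opposite third elements.

    Call a pair [p q] big if at least three triples (its pages) contain it; [p] and [q] are then
    centres.  Every triple through a centre [p] of the big pair [p q] uses the vertex of [q], so the
    links of centres and of pages have few possible shapes.  Charging the triples to their elements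
    shows that a family on a set of [s] signed elements has at most [2 s] triples, with corrections
    for the big pairs and for [s] modulo 8, unless there are big pairs [p q], [-p t], [-q -t] (the
    heavy case).  In the heavy case all but the triples inside the vertex set of [p], [q], [t] and
    the pages of these pairs avoid the three vertices, which allows an induction.

    The bounds on 6 and 7 vertices come from averaging over designs: copies of the 6-vertex
    projective plane and its complement, respectively copies of the Fano plane, cover all supports
    evenly, and the signs of triples that meet in one vertex must be opposite there.  Sharpness is
    given by disjoint copies of the 16 positive triples on 4 vertices, and by two triangles, one
    attached to every [e_x] and the other to every [- e_x]. *)
From HB Require Import structures.
From mathcomp Require Import all_boot zify.

Set Implicit Arguments.
Unset Strict Implicit.
Unset Printing Implicit Defensive.

(** Since [size3] counts every triple six times, two triples for each of the 2n signed elements mean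
    a [size3] of 24n, the value of the term 4n. Disjoint tetrahedra attain it, so the charging is
    tight: a centre, whose degree has no absolute bound, passes its excess on to its pages, whose
    degrees are small.

    For n = 1 modulo 4 the formula asks for a loss of 24, which the argument modulo 8 supplies. For
    n = 2, 3 modulo 4 it would ask for 48, but from 14 on 6n - 28 is at least 4n, so that only 3, 6,
    7, 10 and 11 need more than 24 and get arguments of their own.

    The term 6n - 28 comes from two heavy configurations on opposite signs of the same vertices. The
    first one costs 24, and 18 for each of k attached elements. A second one on the s remaining
    elements costs at most 18 s - 84, and s + k = 2 (n - 3) makes the total 36n - 168. Delicate are
    the first configurations on 10 to 12 vertices that take one sign of nearly every vertex: the
    remainder then has few vertices with both signs, and the designs must exploit this. *)

Ltac abstract_bools :=
  repeat match goal with |- context [nat_of_bool ?b] =>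
    lazymatch b with true => fail | false => fail | _ => generalize (nat_of_bool b); intro end
  end.

(* Linear arithmetic on the premises of the goal only: preprocessing the boolean hypotheses of the context is slow. *)
Ltac lia_goal :=
  repeat match goal with H : ?T |- _ => lazymatch type of T with Prop => clear H end end;
  abstract_bools; lia.

Definition anti (V : finType) (p : V * bool) : V * bool := (p.1, ~~ p.2).

(* [(v, b)] stands for plus or minus the basis vector [e_v]; [tri p q r] says that the sum of the three is in the set. Each vector gives six ordered triples. *)
Record fam (V : finType) := Fam {
  tri :> V * bool -> V * bool -> V * bool -> bool;
  triC : forall p q r, tri p q r = tri q p r;
  triA : forall p q r, tri p q r = tri p r q;
  tri_vx : forall p q r, tri p q r -> p.1 != q.1;
  tri_meet : forall p q r s t, tri p q r -> tri p s t ->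
    [|| s.1 == q.1, s.1 == r.1, t.1 == q.1 | t.1 == r.1];
  tri_opp : forall p q r, tri p q r -> ~~ tri p q (anti r) }.

(** * Codegrees, big pairs and links of centres *)

Section Fam.
Variable V : finType.
Implicit Types (F : fam V) (p q r s t x y : V * bool) (a b c : V).

Lemma antiK : involutive (@anti V).
Proof. by case=> v b; rewrite /anti negbK. Qed.

Lemma anti_neq p : anti p != p.
Proof. by case: p => v []; rewrite /anti xpair_eqE eqxx. Qed.

Lemma anti_inj : injective (@anti V).
Proof. exact: can_inj antiK. Qed.

Lemma eq_vx p q : (p.1 == q.1) = (p == q) || (p == anti q).
Proof.
by case: p q => [v b] [w c]; rewrite /anti !xpair_eqE /=; case: (v == w) b c => [] [] [].
Qed.

Lemma vxP p q : p.1 = q.1 -> p = q \/ p = anti q.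
Proof. by move/eqP; rewrite eq_vx => /orP[] /eqP; [left | right]. Qed.

Definition codeg F p q : nat := \sum_r F p q r.
(** Ordered counts: [deg2] is twice the number of triples through [p], and [size3] is six times the
    size of the family. *)
Definition deg2 F p : nat := \sum_q codeg F p q.
Definition size3 F : nat := \sum_p deg2 F p.
Definition big F p q := 2 < codeg F p q.

Lemma triCA F p q r : F p q r = F q r p.
Proof. by rewrite triC triA. Qed.

Lemma tri_vx3 F p q r : F p q r -> [/\ p.1 != q.1, p.1 != r.1 & q.1 != r.1].
Proof.
move=> Fpqr; split; first exact: tri_vx Fpqr.
  by rewrite triA in Fpqr; exact: tri_vx Fpqr.
by rewrite triCA in Fpqr; exact: tri_vx Fpqr.
Qed.

Lemma tri_inj F p q r s : F p q r -> F p q s -> r.1 = s.1 -> r = s.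
Proof.
move=> Fr Fs /vxP[//|rE].
by move: (tri_opp Fs); rewrite -rE Fr.
Qed.

Lemma codegC F p q : codeg F p q = codeg F q p.
Proof. by apply: eq_bigr => r _; rewrite triC. Qed.

Lemma bigC F p q : big F p q = big F q p.
Proof. by rewrite /big codegC. Qed.

Lemma codegE F p q : codeg F p q = #|[set r | F p q r]|.
Proof.
rewrite -sum1_card big_mkcond /=.
by apply: eq_bigr => r _; rewrite inE; case: (F p q r).
Qed.

Lemma codeg_gt0 F p q r : F p q r -> 0 < codeg F p q.
Proof. by move=> Fr; rewrite codegE card_gt0; apply/set0Pn; exists r; rewrite inE. Qed.

Lemma codeg_vx F p q : 0 < codeg F p q -> p.1 != q.1.
Proof. by rewrite codegE card_gt0 => /set0Pn[r]; rewrite inE => /tri_vx. Qed.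

Lemma big_vx F p q : big F p q -> p.1 != q.1.
Proof. by move=> B; apply: (@codeg_vx F); rewrite /big in B; lia. Qed.

(** By [tri_opp] the third elements lie over distinct vertices, so they can be counted by
    vertices. *)
Lemma codeg_le F p q (W : {set V}) :
  (forall r, F p q r -> r.1 \in W) -> codeg F p q <= #|W|.
Proof.
move=> FW; rewrite codegE -(@card_in_imset _ _ fst).
  by apply/subset_leq_card/subsetP => _ /imsetP[r + ->]; rewrite inE => /FW.
by move=> r s; rewrite !inE; exact: tri_inj.
Qed.

Lemma big_page F p q : big F p q ->
  forall a b, exists r, [/\ F p q r, r.1 != a & r.1 != b].
Proof.
move=> B a b; have [|none] := boolP [exists r, [&& F p q r, r.1 != a & r.1 != b]].
  by move/existsP=> [r /and3P[]]; exists r.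
move: B; rewrite /big ltnNge => /negP[].
apply: leq_trans (_ : #|[set a; b]| <= _); last by rewrite cards2; case: (_ == _).
apply: codeg_le => r Fr; move/existsPn: none => /(_ r).
by rewrite Fr !inE /= -negb_or negbK.
Qed.

(* [s] and [t] together meet at most two of the at least three pages of [p q] outside [q]. *)
Lemma center F p q s t : big F p q -> F p s t -> (s.1 == q.1) || (t.1 == q.1).
Proof.
move=> B Fst; have [r [Fr rs rt]] := big_page B s.1 t.1.
by have := tri_meet Fr Fst; rewrite (eq_sym s.1 r.1) (eq_sym t.1 r.1) (negPf rs) (negPf rt) /= orbF.
Qed.

Lemma big_center F p q s : big F p q -> big F p s -> s.1 = q.1.
Proof.
move=> B /big_page/(_ q.1 q.1)[t [Fst _ tq]].
by have := center B Fst; rewrite (negPf tq) orbF => /eqP.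
Qed.

Lemma codeg1 F p q r : (forall s, F p q s -> s.1 = r.1) -> F p q r -> codeg F p q = 1.
Proof.
move=> only Fr; rewrite codegE; apply/eqP/cards1P; exists r.
by apply/setP => s; rewrite !inE; apply/idP/eqP => [Fs | ->] //; exact: tri_inj Fs Fr (only _ Fs).
Qed.

Lemma deg2_pairs F p : deg2 F p = \sum_s \sum_t F p s t.
Proof. by []. Qed.

Lemma deg2E F p : deg2 F p = #|[set st : (V * bool) * (V * bool) | F p st.1 st.2]|.
Proof.
rewrite deg2_pairs pair_big -sum1_card [RHS]big_mkcond /=.
by apply: eq_bigr => -[s t] _; rewrite inE /=; case: (F p s t).
Qed.

(* Every pair of the link of [p] meeting [C] is counted once for each of its elements in [C]. *)
Lemma cover_deg F p (C : {set V * bool}) :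
  (forall s t, F p s t -> (s \in C) || (t \in C)) ->
  deg2 F p + \sum_(s in C) \sum_(t in C) F p s t = 2 * \sum_(s in C) codeg F p s.
Proof.
move=> cov; rewrite /deg2 (bigID (mem C)) /= mulSn mul1n -addnA; congr (_ + _).
rewrite (eq_bigr (fun s => \sum_(t in C) F p s t)) => [|s sC]; last first.
  rewrite /codeg (bigID (mem C)) /= [X in _ + X]big1 ?addn0 // => t tC.
  by case: (boolP (F p s t)) => // /cov; rewrite (negPf sC) (negPf tC).
rewrite exchange_big addnC /= -big_split /=.
apply: eq_bigr => s sC; rewrite /codeg [RHS](bigID (mem C)) /=.
by congr (_ + _); apply: eq_bigr => t _; rewrite triA.
Qed.

(** No triple has two elements over one vertex, so the correction term of [cover_deg] vanishes. *)
Lemma link_star F p q : (forall s t, F p s t -> (s.1 == q.1) || (t.1 == q.1)) ->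
  deg2 F p = 2 * (codeg F p q + codeg F p (anti q)).
Proof.
move=> st; pose C := [set q; anti q].
have CE s : (s \in C) = (s.1 == q.1) by rewrite !inE eq_vx.
have := @cover_deg F p C; rewrite big1 ?addn0 => [->|s]; last first.
- rewrite CE => /eqP sq; apply: big1 => t; rewrite CE => /eqP tq.
  by case: (boolP (F p s t)) => // /tri_vx3[_ _]; rewrite sq tq eqxx.
- by move=> s t; rewrite !CE; exact: st.
by rewrite big_setU1 ?inE ?big_set1 // eq_sym anti_neq.
Qed.

End Fam.

(** * Links of pages *)

Section Pages.
Variable V : finType.
Implicit Types (F : fam V) (p q r s t x y : V * bool) (a b c : V).

Definition nbig F p : nat := \sum_q big F p q.
Definition bk F p : nat := \sum_q big F p q * codeg F p q.
Definition bigpairs F x : nat := \sum_s \sum_t (F x s t && big F s t).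
Definition centre F p := [exists q, big F p q].
Definition heavy F := [exists p, exists q, exists t,
  [&& big F p q, big F (anti p) t & big F (anti q) (anti t)]].
(** The pages that break the budget of the charging. The triple of [x] with [anti q] and [anti t]
    would make [x] a page of all three pairs of a heavy configuration, if [anti q] and [anti t]
    formed a big pair. *)
Definition T0 F p x := [exists q, exists t, [&& big F p q, big F (anti p) t,
  F x p q, F x (anti p) t & F x (anti q) (anti t)]].

(** [center] puts [t] over the vertex of [q], and [tri_opp] fixes its sign. *)
Lemma page_excl F p q x t : big F p q -> F x p q -> F x p t -> t = q.
Proof.
move=> B Fx Ft; have [xp xq pq] := tri_vx3 Fx.
have Fp : F p x t by rewrite triC.
by apply: tri_inj Ft Fx _; have := center B Fp; rewrite (negPf xq) => /eqP.
Qed.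

Lemma page_codeg1 F p q x : big F p q -> F x p q -> codeg F x p = 1.
Proof. by move=> B Fx; apply: codeg1 (Fx) => s /(page_excl B Fx) ->. Qed.

(** By [tri_meet] the pair meets the vertices of [p] and [q]; if it contains [p] or [q] itself,
    [page_excl] makes it the pair [p q]. *)
Lemma page_link F p q x s t : big F p q -> F x p q -> F x s t ->
  [|| (s == p) && (t == q), (s == q) && (t == p),
      s == anti p, s == anti q, t == anti p | t == anti q].
Proof.
move=> B Fx Fst; have B' := B; rewrite bigC in B'; have Fx' := Fx; rewrite triA in Fx'.
have Fts := Fst; rewrite triA in Fts.
have := tri_meet Fx Fst; rewrite !eq_vx => /or4P[] /orP[] /eqP e; rewrite e ?eqxx ?orbT //.
- by rewrite e in Fst; rewrite (page_excl B Fx Fst) !eqxx.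
- by rewrite e in Fst; rewrite (page_excl B' Fx' Fst) !eqxx ?orbT.
- by rewrite e in Fts; rewrite (page_excl B Fx Fts) !eqxx ?orbT.
- by rewrite e in Fts; rewrite (page_excl B' Fx' Fts) !eqxx ?orbT.
Qed.

Lemma tri_same F p q r : p.1 = q.1 -> F r p q = false.
Proof. by move=> e; apply/negP => /tri_vx3[_ _]; rewrite e eqxx. Qed.

Lemma page_opp F p q x : F x p q -> F x p (anti q) = false.
Proof. by move=> Fx; apply/negP => /(tri_opp); rewrite antiK Fx. Qed.

(** The link of [x] is covered by [p], [anti p] and [anti q]. The only pair possible inside this
    cover is [anti p], [anti q], and [p] has codegree 1 by [page_excl]. *)
Lemma page_deg F p q x : big F p q -> F x p q ->
  deg2 F x + 2 * F x (anti p) (anti q) =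
  2 * (1 + codeg F x (anti p) + codeg F x (anti q)).
Proof.
move=> B Fx; have [xp xq pq] := tri_vx3 Fx.
pose C := [set p; anti p; anti q].
have sumC (f : V * bool -> nat) : \sum_(s in C) f s = f p + f (anti p) + f (anti q).
  have pp : p != anti p by rewrite eq_sym anti_neq.
  have pq' : p != anti q by apply: contra pq => /eqP/(congr1 fst)/= ->.
  have ppq : anti p != anti q by apply: contra pq => /eqP/(congr1 fst)/= ->.
  rewrite /C -setUA big_setU1 /=; last by rewrite !inE negb_or pp pq'.
  by rewrite big_setU1 ?big_set1 ?addnA ?inE.
have cov s t : F x s t -> (s \in C) || (t \in C).
  move=> /(page_link B Fx); rewrite !inE.
  by case/or4P=> [/andP[-> _]|/andP[_ ->]|->|/or3P[] ->]; rewrite ?orbT.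
have := cover_deg cov; rewrite !sumC.
have same s t : s.1 = t.1 -> F x s t = false by exact: tri_same.
rewrite !(same p p) // !(same p (anti p)) // !(same (anti p) p) // !(same (anti p) (anti p)) //.
rewrite !(same (anti q) (anti q)) //.
rewrite (page_opp Fx) [F x (anti q) p]triA (page_opp Fx) [F x (anti q) (anti p)]triA.
by rewrite (page_codeg1 B Fx); lia.
Qed.

(** Take [u] with [F x (anti p) u]. A partner [w] of [anti q] must lie over the vertex of [u],
    because the other ways for the two pairs to meet lead to [p], [q] or the excluded triple. *)
Lemma page_cross F p q x : big F p q -> F x p q -> F x (anti p) (anti q) = false ->
  0 < codeg F x (anti p) -> codeg F x (anti q) <= 1.
Proof.
move=> B Fx nF; rewrite codegE card_gt0 => /set0Pn[u]; rewrite inE => Fu.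
have [xp xq pq] := tri_vx3 Fx; have B' := B; rewrite bigC in B'.
have Fx' := Fx; rewrite triA in Fx'.
rewrite -(cards1 u.1); apply: codeg_le => w Fw; rewrite inE.
have := tri_meet Fu Fw; rewrite /= [q.1 == p.1]eq_sym (negPf pq) /=.
case/or3P=> // /eqP/vxP[] e.
- by move: Fu; rewrite -e triA => /(page_excl B' Fx') /eqP; rewrite (negPf (anti_neq p)).
- by move: nF; rewrite e antiK Fu.
- by move: Fw; rewrite e triA => /(page_excl B Fx) /eqP; rewrite (negPf (anti_neq q)).
- by move: nF; rewrite triA -e Fw.
Qed.

(** A non-centre has codegrees at most 2 in [page_deg]. More than 6 needs both of them to be 2,
    which [page_cross] allows only with the opposite triple. *)
Lemma page_deg8 F p q x : ~~ centre F x -> big F p q -> F x p q ->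
  deg2 F x <= 6 \/ [/\ deg2 F x = 8, F x (anti p) (anti q),
                       codeg F x (anti p) = 2 & codeg F x (anti q) = 2].
Proof.
move=> /existsPn nB B Fx.
have cp := nB (anti p); have cq := nB (anti q); rewrite /big -leqNgt in cp cq.
have := page_deg B Fx; case E: (F x (anti p) (anti q)) => dE.
  case: (ltngtP (codeg F x (anti p)) 2) => [c||c]; [by left; lia|by lia|].
  case: (ltngtP (codeg F x (anti q)) 2) => [d||d]; [by left; lia|by lia|].
  by right; split => //; lia.
left; have [c0|] := posnP (codeg F x (anti p)); first by lia.
move/(page_cross B Fx E) => c1; have [d0|] := posnP (codeg F x (anti q)); first by lia.
have B' := B; rewrite bigC in B'; have Fx' := Fx; rewrite triA in Fx'.
by rewrite triA in E => /(page_cross B' Fx' E); lia.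
Qed.

(** Both codegrees of [page_deg] are forced: [anti p] has the single partner [t], and the partners
    of [anti q] can only be [anti t] and, when [t] is [anti q], also [anti p]. *)
Lemma page2_deg F p q t x : big F p q -> big F (anti p) t -> F x p q -> F x (anti p) t ->
  deg2 F x = 4 + 2 * F x (anti q) (anti t).
Proof.
move=> B B2 Fx Ft; have := page_deg B Fx; rewrite (page_codeg1 B2 Ft).
have [_ _ pq] := tri_vx3 Fx; have [_ _ pt] := tri_vx3 Ft.
have tq : t != q by apply: contraTneq Fx => <-; rewrite triA -[p]antiK page_opp // triA.
have only s : F x (anti q) s -> s = anti p /\ t = anti q \/ s = anti t.
  move=> Fs; have := page_link B2 Ft Fs; rewrite antiK => /or4P[].
  - by case/andP=> /eqP/(congr1 fst)/= e; move: pq; rewrite e eqxx.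
  - by case/andP=> /eqP <- /eqP ->; left.
  - by move/eqP/(congr1 fst)=> /= e; move: pq; rewrite e eqxx.
  case/or3P=> [/eqP/anti_inj e|/eqP e|/eqP]; [by move: tq; rewrite e eqxx| |by right].
  by move: Fs; rewrite e triA page_opp.
have [tE|tNq] := eqVneq t (anti q).
  rewrite -tE Ft tE antiK (@tri_same F (anti q) q) //.
  rewrite (@codeg1 _ _ _ _ (anti p)); [by lia| |by rewrite triA -tE].
  move=> s Fs; have [[-> _] //|sE] := only s Fs.
  by move: Fs; rewrite sE tE antiK (@tri_same F (anti q) q).
have -> : F x (anti p) (anti q) = false.
  by apply: contraNF tNq => /(page_excl B2 Ft) ->.
case E: (F x (anti q) (anti t)).
  rewrite (@codeg1 _ _ _ _ (anti t)) // => [|s Fs]; first by lia.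
  by have [[_ e]|-> //] := only s Fs; rewrite e eqxx in tNq.
rewrite [codeg F x (anti q)]big1 => [|s _]; first by lia.
apply/eqP; rewrite eqb0; apply/negP => Fs; have [[_ e]|e] := only s Fs.
  by rewrite e eqxx in tNq.
by rewrite -e Fs in E.
Qed.

End Pages.

(** * Degrees of pages and centres *)

Section Values.
Variable V : finType.
Implicit Types (F : fam V) (p q r s t x y : V * bool) (a b c : V).

Definition T02 F x := [exists p, T0 F p x].

Lemma bigpairsE F x :
  bigpairs F x = #|[set st : (V * bool) * (V * bool) | F x st.1 st.2 && big F st.1 st.2]|.
Proof.
rewrite /bigpairs pair_big -sum1_card [RHS]big_mkcond /=.
by apply: eq_bigr => -[s t] _; rewrite inE /=; case: (_ && _).
Qed.

Lemma bigpairs0 F x p q : bigpairs F x = 0 -> F x p q -> big F p q = false.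
Proof.
rewrite bigpairsE => /eqP; rewrite cards_eq0 => /eqP/setP/(_ (p, q)).
by rewrite !inE /= => e Fx; move: e; rewrite Fx.
Qed.

Lemma pair_neq F x p q : F x p q -> (p, q) != (q, p).
Proof. by case/tri_vx3=> _ _; apply: contra => /eqP[-> _]. Qed.

Lemma bigpairs_nonbig F x p q : F x p q -> ~~ big F p q -> bigpairs F x + 2 <= deg2 F x.
Proof.
move=> Fx nB; rewrite bigpairsE deg2E -(cardsID [set (p, q); (q, p)] [set st | F x st.1 st.2]).
rewrite addnC leq_add //.
  rewrite (setIidPr _) ?cards2 ?(pair_neq Fx) //.
  by apply/subsetP => _ /set2P[] ->; rewrite inE //= triA.
apply/subset_leq_card/subsetP => -[s t]; rewrite !inE !xpair_eqE /= => /andP[Fst Bst].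
rewrite Fst andbT; apply: contra nB => /orP[] /andP[/eqP<- /eqP<-] //.
by rewrite bigC.
Qed.

Lemma bigpairs_only F x p q : F x p q -> big F p q ->
  (forall s t, F x s t -> big F s t -> s = p /\ t = q \/ s = q /\ t = p) -> bigpairs F x = 2.
Proof.
move=> Fx B only; rewrite bigpairsE.
suff -> : [set st | F x st.1 st.2 && big F st.1 st.2] = [set (p, q); (q, p)].
  by rewrite cards2 (pair_neq Fx).
apply/setP => -[s t]; rewrite !inE !xpair_eqE /=; apply/idP/idP.
  by case/andP=> Fs Bs; have [[-> ->]|[-> ->]] := only s t Fs Bs; rewrite !eqxx ?orbT.
by case/orP=> /andP[/eqP-> /eqP->]; rewrite ?Fx ?B // triA Fx bigC.
Qed.

Lemma page_cases F x : 0 < bigpairs F x ->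
  (exists p q, [/\ big F p q, F x p q & bigpairs F x = 2]) \/
  (exists p q t, [/\ big F p q, big F (anti p) t, F x p q & F x (anti p) t]).
Proof.
rewrite {1}bigpairsE card_gt0 => /set0Pn[[p q]]; rewrite inE /= => /andP[Fx B].
have [/existsP[[s t] /and3P[/= Fs Bs]]|none] := boolP [exists st,
  [&& F x st.1 st.2, big F st.1 st.2 & st \notin [set (p, q); (q, p)]]]; last first.
  left; exists p, q; split=> //; apply: bigpairs_only (Fx) (B) _ => s t Fs Bs.
  move/existsPn: none => /(_ (s, t)); rewrite /= Fs Bs /= negbK => /set2P[] [-> ->]; by [left|right].
rewrite !inE !xpair_eqE negb_or => /andP[n1 n2]; right.
have := page_link B Fx Fs; rewrite (negPf n1) (negPf n2) /=.
case/or4P=> /eqP e; rewrite e in Fs Bs.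
all: have B' := B; rewrite bigC in B'; have Fx' := Fx; rewrite triA in Fx'.
all: have Bs' := Bs; rewrite bigC in Bs'; have Fs' := Fs; rewrite triA in Fs'.
- by exists p, q, t.
- by exists q, p, t.
- by exists p, q, s.
- by exists q, p, s.
Qed.

(** With a single big pair in the link [page_deg8] applies, with a second one [page2_deg]. There,
    degree 6 means that [anti q], [anti t] lies in the link; it is not a big pair unless the family
    is heavy. *)
Lemma noncentre_page F x : ~~ heavy F -> ~~ centre F x -> 0 < bigpairs F x ->
  [\/ bigpairs F x = 2 /\ (deg2 F x <= 6 \/ deg2 F x = 8), bigpairs F x <= 4 /\ deg2 F x = 4 |
      [/\ bigpairs F x <= 4, deg2 F x = 6 & T02 F x]].
Proof.
move=> nH nB /page_cases[[p [q [B Fx ->]]]|[p [q [t [B Bt Fx Ft]]]]].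
  by have [d|[d _ _ _]] := page_deg8 nB B Fx; constructor 1; split=> //; [left|right].
have := page2_deg B Bt Fx Ft; case E: (F x (anti q) (anti t)) => d.
  have nBq : ~~ big F (anti q) (anti t).
    apply: contra nH => Bq; apply/existsP; exists p; apply/existsP; exists q.
    by apply/existsP; exists t; rewrite B Bt Bq.
  have := bigpairs_nonbig E nBq; constructor 3; split; [by lia|by lia|].
  by apply/existsP; exists p; apply/existsP; exists q; apply/existsP; exists t; rewrite B Bt Fx Ft E.
constructor 2; split=> //; rewrite addn0 in d; rewrite -d bigpairsE deg2E.
by apply/subset_leq_card/subsetP => st; rewrite !inE => /andP[].
Qed.

Lemma nbigE F p q : big F p q -> nbig F p = 1 + big F p (anti q).
Proof.
move=> B; rewrite /nbig (bigD1 q) //= B (bigD1 (anti q)) ?anti_neq //= big1 ?addn0 // => s.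
move=> /andP[sq so]; apply/eqP; rewrite eqb0; apply/negP => Bs.
by have /vxP[e|e] := big_center B Bs; rewrite e eqxx in sq so.
Qed.

Lemma bkE F p q : big F p q -> bk F p = codeg F p q + big F p (anti q) * codeg F p (anti q).
Proof.
move=> B; rewrite /bk (bigD1 q) //= B mul1n (bigD1 (anti q)) ?anti_neq //= big1 ?addn0 // => s.
move=> /andP[sq so]; apply/eqP; rewrite muln_eq0 eqb0; apply/orP; left; apply/negP => Bs.
by have /vxP[e|e] := big_center B Bs; rewrite e eqxx in sq so.
Qed.

Lemma centre_deg F p q : big F p q -> deg2 F p = 2 * (codeg F p q + codeg F p (anti q)).
Proof. by move=> B; apply: link_star => s t; exact: center. Qed.

(** If [y] were [p], then [p] would have the big partners [x] and [q] over different vertices. So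
    [y] is [anti p], and [p] has codegree 1 in the link of its page [x]. *)
Lemma centre_page F x y p q : big F x y -> big F p q -> F x p q -> p.1 = y.1 ->
  [/\ y = anti p, nbig F x = 1, bigpairs F x = 2 & deg2 F x = 2 * bk F x + 2].
Proof.
move=> Bx B Fx py; have [xp xq pq] := tri_vx3 Fx.
have yE : y = anti p.
  move: py => /vxP[e|->]; last by rewrite antiK.
  have Bp : big F p x by rewrite bigC e.
  by have := big_center B Bp => /eqP; rewrite (negPf xq).
subst y; have c1 := page_codeg1 B Fx.
have nB : big F x (anti (anti p)) = false by rewrite antiK /big c1.
split=> //; first by rewrite (nbigE Bx) nB.
  apply: bigpairs_only (Fx) (B) _.
  have aux s t : F x s t -> big F s t -> s.1 = p.1 -> s = p /\ t = q.
    move=> Fs Bs /vxP[e|e]; rewrite e in Fs Bs *; first by split=> //; exact: page_excl Fs.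
    have Bpx : big F (anti p) x by rewrite bigC.
    have /eqP := big_center Bpx Bs; have [_ xt _] := tri_vx3 Fs.
    by rewrite eq_sym (negPf xt).
  move=> s t Fs Bs; have := center Bx Fs => /orP[] /eqP e; first by left; exact: aux Fs Bs _.
  right; rewrite triA in Fs; rewrite bigC in Bs.
  by have [-> ->] := aux _ _ Fs Bs e.
by rewrite (centre_deg Bx) (bkE Bx) nB antiK c1; lia.
Qed.

(** By [center] only [y] and [anti y] contribute to the degree. When [anti y] is not a big partner
    it adds at most 4, and exactly 2 when [x] is also a page. *)
Lemma centre_val F x : centre F x ->
  [\/ [/\ bigpairs F x = 0, nbig F x = 1 & deg2 F x <= 2 * bk F x + 4],
      [/\ bigpairs F x = 2, nbig F x = 1 & deg2 F x = 2 * bk F x + 2] |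
      [/\ bigpairs F x = 0, nbig F x = 2 & deg2 F x = 2 * bk F x]].
Proof.
case/existsP=> y Bx; have [P0|] := posnP (bigpairs F x).
  have dE := centre_deg Bx; have nE := nbigE Bx; have bE := bkE Bx.
  have [B'|] := boolP (big F x (anti y)); rewrite ?B' in nE bE.
    by constructor 3; split=> //; lia.
  move=> nB; rewrite (negPf nB) in nE bE; constructor 1; split=> //.
  by move: nB; rewrite /big -leqNgt; lia.
rewrite {1}bigpairsE card_gt0 => /set0Pn[[p q]]; rewrite inE /= => /andP[Fx B].
have := center Bx Fx => /orP[] /eqP e; constructor 2.
  by have [_ ? ? ?] := centre_page Bx B Fx e.
rewrite bigC in B; rewrite triA in Fx.
by have [_ ? ? ?] := centre_page Bx B Fx e.
Qed.

(** Double counting of pages in big pairs. It moves the excess of the centres, measured by [bk], to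
    the pages. *)
Lemma sum_bigpairs F : \sum_x bigpairs F x = \sum_p bk F p.
Proof.
rewrite /bigpairs exchange_big; apply: eq_bigr => s _; rewrite exchange_big /bk.
apply: eq_bigr => t _; rewrite /codeg big_distrr /=; apply: eq_bigr => x _.
by rewrite triCA; case: (big F s t); rewrite ?andbT ?andbF ?mul1n.
Qed.

End Values.

(** * Links as graphs without disjoint edges *)

Section Links.
Variable V : finType.
Implicit Types (F : fam V) (p q r s t x y : V * bool) (a b c : V).

(** On vertices the link is a graph whose edges pairwise meet, hence a star or a triangle. Edges
    that miss the candidate centres one after the other build the triangle. *)
Lemma link_cases F p :
  (exists q, forall s t, F p s t -> (s.1 == q.1) || (t.1 == q.1)) \/
  (exists W : {set V}, [/\ #|W| = 3, p.1 \notin W &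
     forall s t, F p s t -> (s.1 \in W) && (t.1 \in W)]).
Proof.
pose star q := [forall s, forall t, F p s t ==> (s.1 == q.1) || (t.1 == q.1)].
have starP q : star q -> forall s t, F p s t -> (s.1 == q.1) || (t.1 == q.1).
  by move=> /forallP H s t; apply/implyP; have /forallP := H s; exact.
have starN q : ~~ star q -> exists s t, [/\ F p s t, s.1 != q.1 & t.1 != q.1].
  case/forallPn=> s /forallPn[t]; rewrite negb_imply negb_or => /and3P[*].
  by exists s, t.
(* No pair of the link uses the vertex of [p], so [star p] means an empty link and its failure
   supplies a first edge. *)
have [/starP|/starN[b [c [Fbc _ _]]]] := boolP (star p); first by left; exists p.
have [/starP|/starN[c' [d [Fcd cb db]]]] := boolP (star b); first by left; exists b.
have [/starP|/starN[b' [e [Fbe bc ec]]]] := boolP (star c); first by left; exists c.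
right; have [_ _ nbc] := tri_vx3 Fbc.
without loss cE : c' d Fcd cb db / c'.1 = c.1.
  move=> W; have := tri_meet Fbc Fcd; rewrite (negPf cb) (negPf db) /= => /orP[] /eqP E.
    exact: W Fcd cb db E.
  by apply: (W d c'); rewrite // triA.
without loss bE : b' e Fbe bc ec / b'.1 = b.1.
  move=> W; have := tri_meet Fbc Fbe; rewrite (negPf bc) (negPf ec) /= orbF => /orP[] /eqP E.
    exact: W Fbe bc ec E.
  by apply: (W e b'); rewrite // triA.
have [_ _] := tri_vx3 Fcd; have [_ _] := tri_vx3 Fbe; rewrite cE bE => nbe ncd.
have eE : e.1 = d.1.
  have := tri_meet Fcd Fbe; rewrite cE bE (negPf nbc) (negPf ec) eq_sym (negPf db) /=.
  by move/eqP.
exists [set b.1; c.1; d.1]; split.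
- by rewrite -setUA cardsU1 cards2 !inE negb_or nbc ncd eq_sym db.
- have [pb pc _] := tri_vx3 Fbc; have [_ pd _] := tri_vx3 Fcd.
  by rewrite !inE !negb_or pb pc pd.
move=> s t Fst; have [_ _ nst] := tri_vx3 Fst; rewrite !inE.
have := tri_meet Fbc Fst; have := tri_meet Fcd Fst; have := tri_meet Fbe Fst.
rewrite cE bE eE; case: (eqVneq s.1 b.1) nst => [->|_] nst.
  rewrite ![b.1 == t.1]eq_sym in nst; rewrite (negPf nst) (negPf nbc).
  rewrite ![b.1 == d.1]eq_sym (negPf db) /= => _.
  by case: (t.1 == c.1).
case: (eqVneq s.1 c.1) nst => [->|_] nst.
  rewrite ![c.1 == t.1]eq_sym in nst; rewrite (negPf nst) (negPf ncd) ?orbF /=.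
  by case: (t.1 == b.1) => //=; case: (t.1 == d.1).
case: (eqVneq s.1 d.1) nst => [->|_] nst /=.
  by case: (t.1 == b.1); case: (t.1 == c.1); case: (t.1 == d.1).
case: (eqVneq t.1 b.1) => [->|_] /=; first by rewrite (negPf nbc) eq_sym (negPf db).
case: (eqVneq t.1 c.1) => [->|_] //=; by rewrite (negPf ncd).
Qed.

Definition over (W : {set V}) : {set V * bool} := [set s | s.1 \in W].

Lemma card_over (W : {set V}) : #|over W| = 2 * #|W|.
Proof.
rewrite mulnC -card_bool -cardsT -cardsX; apply: eq_card => -[v b].
by rewrite !inE /= andbT.
Qed.

Lemma triangle_deg F p (W : {set V}) : ~~ centre F p ->
  (forall s t, F p s t -> (s.1 \in W) && (t.1 \in W)) -> deg2 F p <= 4 * #|W|.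
Proof.
move=> /existsPn nB FW.
rewrite /deg2 (bigID (fun s : V * bool => s.1 \in W)) /= [X in _ + X]big1 => [|s sW]; last first.
  rewrite /codeg big1 // => t _; apply/eqP; rewrite eqb0; apply: contra sW.
  by case/FW/andP.
rewrite addn0 (@leq_trans (\sum_(s : V * bool | s.1 \in W) 2)) //.
  by apply: leq_sum => s _; rewrite leqNgt nB.
rewrite sum_nat_const (eq_card (B := over W)) ?card_over; first by lia.
by move=> s; rewrite inE.
Qed.

Lemma noncentre_star F p q : ~~ centre F p ->
  (forall s t, F p s t -> (s.1 == q.1) || (t.1 == q.1)) -> deg2 F p <= 8.
Proof.
move=> /existsPn nB /link_star ->.
by have := nB q; have := nB (anti q); rewrite /big; lia.
Qed.

(** Codegrees are at most 2: a star gives at most 2 (2 + 2), and a triangle has six signed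
    elements. *)
Lemma noncentre_deg F p : ~~ centre F p -> deg2 F p <= 12.
Proof.
move=> nB; have [[q /(noncentre_star nB)]|[W [W3 _ /(triangle_deg nB)]]] := link_cases F p; lia.
Qed.

Lemma high_triangle F p : ~~ centre F p -> 8 < deg2 F p ->
  exists W : {set V}, [/\ #|W| = 3, p.1 \notin W &
    forall s t, F p s t -> (s.1 \in W) && (t.1 \in W)].
Proof.
move=> nB d; have [[q /(noncentre_star nB)]|//] := link_cases F p; lia.
Qed.

End Links.

(** * Exceptional pages of two opposite big pairs *)

Section Twice.
Variable V : finType.
Implicit Types (F : fam V) (p q r s t x y : V * bool) (a b c : V) (S : {set V * bool}).

Lemma T0P F p x : reflect (exists q t, [/\ big F p q, big F (anti p) t,
  F x p q, F x (anti p) t & F x (anti q) (anti t)]) (T0 F p x).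
Proof.
apply: (iffP existsP) => [[q /existsP[t /and5P[? ? ? ? ?]]]|[q [t [? ? ? ? ?]]]]; first by exists q, t.
by exists q; apply/existsP; exists t; apply/and5P.
Qed.

Lemma T0_opp F p x : T0 F p x -> T0 F (anti p) x.
Proof. by case/T0P=> q [t [? ? ? ? ?]]; apply/T0P; exists t, q; rewrite antiK; split=> //; rewrite triA. Qed.

Definition numT F p : nat := \sum_x T0 F p x.

Lemma numTE F p : numT F p = #|[set x | T0 F p x]|.
Proof.
rewrite -sum1_card big_mkcond /=.
by apply: eq_bigr => r _; rewrite inE; case: (T0 _ _ _).
Qed.

Lemma numT_opp F p : numT F (anti p) = numT F p.
Proof.
by apply: eq_bigr => x _; congr nat_of_bool; apply/idP/idP => /T0_opp //; rewrite antiK.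
Qed.

Lemma heavyI F p q t : big F p q -> big F (anti p) t -> big F (anti q) (anti t) -> heavy F.
Proof.
by move=> *; apply/existsP; exists p; apply/existsP; exists q; apply/existsP; exists t; apply/and3P.
Qed.

Section NoHeavy.
Variables (F : fam V).
Hypothesis nH : ~~ heavy F.

(** If [p] and [anti q] were also a big pair, then the triple of [anti q] with [x] and [anti t]
    would have to use the vertex of [p]. *)
Lemma T0_nbig p x : T0 F p x -> nbig F p = 1.
Proof.
case/T0P=> q [t [B Bt Fx Ft Fqt]]; rewrite (nbigE B).
case: (boolP (big F p (anti q))) => //; rewrite bigC => B'.
have Fqt' : F (anti q) x (anti t) by rewrite triC.
by have := center B' Fqt'; have [/negPf-> _ _] := tri_vx3 Fx; have [_ _ /= /negPf pt] := tri_vx3 Ft; rewrite eq_sym pt.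
Qed.

Lemma T0_unique p q t x : big F p q -> big F (anti p) t -> T0 F p x ->
  [/\ F x p q, F x (anti p) t & F x (anti q) (anti t)].
Proof.
move=> B Bt T; have n1 := T0_nbig T; have n2 := T0_nbig (T0_opp T).
rewrite (nbigE B) in n1; rewrite (nbigE Bt) in n2.
case/T0P: T => q' [t' [B' Bt' Fx Ft Fqt]].
have qE : q' = q by have /vxP[//|e] := big_center B B'; move: B'; rewrite e => b; rewrite b in n1.
have tE : t' = t by have /vxP[//|e] := big_center Bt Bt'; move: Bt'; rewrite e => b; rewrite b in n2.
by subst.
Qed.

Lemma T0_inj p x y z : T0 F p x -> T0 F p y -> x.1 = z -> y.1 = z -> x = y.
Proof.
move=> Tx Ty <-; have /T0P[q [t [B Bt _ _ _]]] := Tx.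
have [Fx _ _] := T0_unique B Bt Tx; have [Fy _ _] := T0_unique B Bt Ty.
by move=> e; rewrite triCA in Fx; rewrite triCA in Fy; apply: tri_inj Fx Fy _.
Qed.

(** All these pages are third elements for [anti q] and [anti t], a pair that is not big without a
    heavy configuration. *)
Lemma numT_le2 p : numT F p <= 2.
Proof.
have [|] := posnP (numT F p); first by move->.
rewrite {1}numTE card_gt0 => /set0Pn[x]; rewrite inE => /T0P[q [t [B Bt _ _ _]]].
apply: leq_trans (_ : codeg F (anti q) (anti t) <= _); last first.
  by rewrite leqNgt; apply: contra nH; exact: heavyI B Bt.
rewrite numTE codegE; apply/subset_leq_card/subsetP => y; rewrite !inE.
by case/(T0_unique B Bt) => _ _; rewrite triCA.
Qed.

(** [center] at [anti q] leaves [x] or [t] over the vertex of [z]. In the second case [z] is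
    [anti t], which is heavy, or [t], which then has big partners over the distinct vertices of [p]
    and [q]. *)
Lemma T0_side p q t z x : big F p q -> big F (anti p) t -> big F (anti q) z -> T0 F p x ->
  x.1 = z.1.
Proof.
move=> B Bt Bz T; have [Fx Ft Fqt] := T0_unique B Bt T.
have Fqt' : F (anti q) x (anti t) by rewrite triC.
have := center Bz Fqt' => /orP[/eqP //|/eqP /vxP[e|e]].
  by case/negP: nH; apply: heavyI B Bt _; rewrite e.
have Btp : big F t (anti p) by rewrite bigC.
have Btq : big F t (anti q) by rewrite -[t]antiK e antiK bigC.
by have := big_center Btp Btq; have [_ _ /= /eqP pq] := tri_vx3 Fx => /esym.
Qed.

Lemma numT_le1 p q t z : big F p q -> big F (anti p) t -> big F (anti q) z -> numT F p <= 1.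
Proof.
move=> B Bt Bz; rewrite numTE; apply/card_le1_eqP => x y; rewrite !inE => Tx Ty.
exact: T0_inj Ty Tx (T0_side B Bt Bz Ty) (T0_side B Bt Bz Tx).
Qed.

(** By [centre_page] a big pair in the link of [p] consists of [anti q] and some [z]; [T0_side] puts
    [z] over the vertex of [x], and the triple [x p q] excludes the sign of [x]. *)
Lemma T0_page p x q t : T0 F p x -> big F p q -> big F (anti p) t -> 0 < bigpairs F p ->
  big F (anti q) (anti x).
Proof.
move=> T B Bt; rewrite bigpairsE card_gt0 => /set0Pn[[y z]]; rewrite inE /= => /andP[Fp Byz].
have [Fx Ft Fqt] := T0_unique B Bt T.
without loss yq : y z Fp Byz / y.1 = q.1.
  move=> W; have := center B Fp => /orP[] /eqP e; first exact: W Fp Byz e.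
  by apply: (W z y); rewrite 1?bigC // triA.
have [qE _ _ _] := centre_page B Byz Fp yq.
have yE : y = anti q by rewrite qE antiK.
subst y; have := T0_side B Bt Byz T => /esym /vxP[e|<- //].
by move: Fp; rewrite e triA page_opp // triC.
Qed.

(** If one of [p], [anti p] has a big pair in its link, then [T0_page] makes [anti q] or [anti t] a
    centre and [numT_le1] applies. If both do, [anti x] has the big partners [anti q] and [anti t]
    over distinct vertices. *)
Lemma T0_bonus p x : T0 F p x -> numT F p <= (bigpairs F p == 0) + (bigpairs F (anti p) == 0).
Proof.
move=> T; have /T0P[q [t [B Bt Fx Ft Fqt]]] := T.
have B' : big F (anti (anti p)) q by rewrite antiK.
have := numT_le2 p; case: (posnP (bigpairs F p)) => [_|P1]; case: (posnP (bigpairs F (anti p))) => [_|P2] //= _.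
- have Bz := T0_page (T0_opp T) Bt B' P2.
  by have := numT_le1 Bt B' Bz; rewrite numT_opp.
- have Bz := T0_page T B Bt P1.
  exact: numT_le1 B Bt Bz.
have Bz := T0_page T B Bt P1; have Bz' := T0_page (T0_opp T) Bt B' P2.
rewrite bigC in Bz; rewrite bigC in Bz'.
by have := big_center Bz Bz'; have [_ _ /= /eqP] := tri_vx3 Fqt => + e; rewrite e.
Qed.

(** An exceptional page for [q] makes [anti q] a centre, and then [numT_le1] allows only one for
    [p]. *)
Lemma numT_pair p q : big F p q -> numT F p + numT F q <= 2.
Proof.
without loss le : p q / numT F q <= numT F p.
  move=> W B; have [le|/ltnW le] := leqP (numT F q) (numT F p); first exact: W.
  by rewrite addnC; apply: W; rewrite 1?bigC.
move=> B; have := numT_le2 p; rewrite leq_eqVlt ltnS => /orP[/eqP n2|]; last by lia.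
rewrite n2 -{2}[2]addn0 leq_add2l leqNgt; apply/negP; rewrite numTE card_gt0.
case/set0Pn=> y; rewrite inE => /T0_opp/T0P[z [_ [Bz _ _ _ _]]].
have : 0 < numT F p by rewrite n2.
rewrite numTE card_gt0 => /set0Pn[x]; rewrite inE => /T0P[q' [t [B' Bt Fx Ft Fqt]]].
have T : T0 F p x by apply/T0P; exists q', t.
have qE : q' = q.
  have /vxP[//|e] := big_center B B'; have := T0_nbig T; rewrite (nbigE B).
  by rewrite -e B'.
by subst q'; have := numT_le1 B Bt Bz; rewrite n2.
Qed.

Lemma sum_numT : \sum_p numT F p <= \sum_p nbig F p.
Proof.
have dom p : numT F p <= nbig F p * numT F p.
  have [->|] := posnP (numT F p); first by rewrite muln0.
  rewrite {1}numTE card_gt0 => /set0Pn[x]; rewrite inE => /T0_nbig ->.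
  by rewrite mul1n.
rewrite -(leq_pmul2l (isT : 0 < 2)) mulSn mul1n.
apply: leq_trans (_ : \sum_p \sum_q big F p q * (numT F p + numT F q) <= _).
  under [leqRHS]eq_bigr do (under eq_bigr do rewrite mulnDr; rewrite big_split /=).
  rewrite big_split /=; apply: leq_add; last rewrite [leqRHS]exchange_big /=.
    by apply: leq_sum => p _; apply: leq_trans (dom p) _; rewrite /nbig big_distrl.
  apply: leq_sum => p _; apply: leq_trans (dom p) _; rewrite /nbig big_distrl /=.
  by apply: leq_sum => q _; rewrite bigC.
rewrite big_distrr; apply: leq_sum => p _; rewrite big_distrr; apply: leq_sum => q _ /=.
by case B: (big F p q); rewrite // mul1n muln1 numT_pair.
Qed.

Lemma sum_T02 : 2 * \sum_x T02 F x <= \sum_p numT F p.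
Proof.
rewrite exchange_big big_distrr; apply: leq_sum => x _ /=.
case: (boolP (T02 F x)) => [/existsP[p T]|]; last by rewrite muln0.
rewrite (bigD1 p) //= T (bigD1 (anti p)) ?anti_neq //= T0_opp //.
Qed.

Definition bonus p : nat := (nbig F p == 1) && (bigpairs F p == 0).

Lemma sum_bonus : \sum_x T02 F x <= \sum_p bonus p.
Proof.
have := sum_T02; suff : \sum_p numT F p <= 2 * \sum_p bonus p by lia.
apply: leq_trans (_ : \sum_p (bonus p + bonus (anti p)) <= _).
  apply: leq_sum => p _; have [->//|] := posnP (numT F p).
  rewrite {1}numTE card_gt0 => /set0Pn[x]; rewrite inE => T.
  by rewrite /bonus (T0_nbig T) (T0_nbig (T0_opp T)) !eqxx /= (T0_bonus T).
rewrite big_split /= mulSn mul1n leq_add2l (reindex_inj (@anti_inj V)) /=.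
by under eq_bigr do rewrite antiK.
Qed.

End NoHeavy.
End Twice.

(** * Charging inequalities *)

Section Inequalities.
Variable V : finType.
Implicit Types (F : fam V) (p q r s t x y : V * bool) (a b c : V) (S : {set V * bool}).

Definition supported F S := forall p q r, F p q r -> p \in S.
Definition high F x := [&& ~~ centre F x, bigpairs F x == 0 & 8 < deg2 F x].
(** As [bigpairs] counts ordered pairs, the value 2 means one big pair. A leaf page lies in no
    triple other than the one with this pair. *)
Definition fullpage F x := [&& ~~ centre F x, bigpairs F x == 2 & deg2 F x == 8].
Definition lightpage F x := [&& ~~ centre F x, bigpairs F x == 2 & deg2 F x <= 6].
Definition leafpage F x := [&& ~~ centre F x, bigpairs F x == 2 & deg2 F x == 2].

Lemma supp_deg F S p : supported F S -> p \notin S -> deg2 F p = 0.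
Proof.
move=> sF pS; rewrite deg2_pairs big1 // => s _; apply: big1 => t _.
by apply/eqP; rewrite eqb0; apply: contra pS => /sF.
Qed.

Lemma supp_codeg F S p q : supported F S -> p \notin S -> codeg F p q = 0.
Proof.
move=> sF pS; apply: big1 => t _.
by apply/eqP; rewrite eqb0; apply: contra pS => /sF.
Qed.

Lemma supp_nbig F S p : supported F S -> p \notin S -> nbig F p = 0.
Proof. by move=> sF pS; apply: big1 => q _; rewrite /big (supp_codeg q sF pS). Qed.

Lemma supp_bigpairs F S x : supported F S -> x \notin S -> bigpairs F x = 0.
Proof.
move=> sF pS; apply: big1 => s _; apply: big1 => t _; apply/eqP; rewrite eqb0.
by apply: contra pS => /andP[/sF].
Qed.

Lemma centre_nbig F x : centre F x = (0 < nbig F x).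
Proof.
apply/existsP/idP => [[q B]|]; first by rewrite (nbigE B).
by rewrite lt0n sum_nat_eq0 negb_forall => /existsP[q]; rewrite eqb0 negbK; exists q.
Qed.

Lemma noncentre0 F x : ~~ centre F x -> nbig F x = 0 /\ bk F x = 0.
Proof.
move=> /existsPn nB; split; apply: big1 => q _; first by rewrite (negPf (nB q)).
by rewrite (negPf (nB q)).
Qed.

Lemma sum_supp S (f : V * bool -> nat) (m : nat) :
  (forall x, x \notin S -> f x = 0) -> (forall x, x \in S -> f x <= m) -> \sum_x f x <= m * #|S|.
Proof.
move=> f0 fm; rewrite (bigID (mem S)) /= [X in _ + X]big1 ?addn0; last exact: f0.
by rewrite mulnC -sum_nat_const; exact: leq_sum.
Qed.

Lemma sum_mull (c : nat) (f : V * bool -> nat) : \sum_x c * f x = c * \sum_x f x.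
Proof. by rewrite big_distrr. Qed.

Lemma leq_sums (c1 c2 c3 d1 d2 d3 d4 d5 : nat) (f f1 f2 f3 g1 g2 g3 g4 g5 : V * bool -> nat) :
  (forall x, f x + c1 * f1 x + c2 * f2 x + c3 * f3 x <=
             d1 * g1 x + d2 * g2 x + d3 * g3 x + d4 * g4 x + d5 * g5 x) ->
  \sum_x f x + c1 * (\sum_x f1 x) + c2 * (\sum_x f2 x) + c3 * (\sum_x f3 x) <=
  d1 * (\sum_x g1 x) + d2 * (\sum_x g2 x) + d3 * (\sum_x g3 x) + d4 * (\sum_x g4 x) +
  d5 * (\sum_x g5 x).
Proof.
move=> le; rewrite -!sum_mull -!big_split.
by apply: leq_sum => x _; exact: le.
Qed.

Lemma sum_mem S : \sum_x (x \in S) = #|S|.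
Proof.
by rewrite -sum1_card [RHS]big_mkcond; apply: eq_bigr => x _; case: (_ \in _).
Qed.

Lemma sum_opp (f : V * bool -> nat) : \sum_x f (anti x) = \sum_x f x.
Proof. by rewrite [RHS](reindex_inj (@anti_inj V)). Qed.

Section NoHeavy.
Variables (F : fam V) (S : {set V * bool}).
Hypotheses (nH : ~~ heavy F) (sF : supported F S).

(** The three kinds of centres in [centre_val] reach the budget 12, which explains the weight 6 of
    [nbig]. Among the non-centres only the [T02] pages, of degree 6 with up to four ordered big
    pairs, go beyond it, by 2. *)
Lemma value_ge x : deg2 F x + 2 * bigpairs F x + 6 * nbig F x +
    2 * (bonus F x + lightpage F x + 2 * leafpage F x) <=
  12 * (x \in S) + 2 * bk F x + 2 * T02 F x.
Proof.
rewrite /bonus /lightpage /leafpage; have [xS|xS] := boolP (x \in S); last first.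
  by rewrite (supp_deg sF xS) (supp_bigpairs sF xS) (supp_nbig sF xS) /= !andbF.
have [B|nB] /= := boolP (centre F x).
  by have [[-> -> d]|[-> -> ->]|[-> -> ->]] := centre_val B => /=; lia.
have [-> ->] := noncentre0 nB.
have [->|P] /= := posnP (bigpairs F x); first by have := noncentre_deg nB; lia.
have [[-> d]|[P4 ->]|[P4 -> ->]] := noncentre_page nH nB P => /=.
- case: d => [d|->] //=; case: (eqVneq (deg2 F x) 2) => [->|_] //=.
  by case: leqP => /=; lia.
- by rewrite !andbF; case: eqP => /=; lia.
- by rewrite !andbF; case: eqP => /=; lia.
Qed.

(* Every big pair is charged two units for each of its pages. *)
Lemma size_value : size3 F + 6 * \sum_p nbig F p +
    2 * \sum_x (bonus F x + lightpage F x + 2 * leafpage F x) <=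
  12 * #|S| + 2 * \sum_x T02 F x.
Proof.
have := sum_bigpairs F.
have := @leq_sums 2 6 2 12 2 2 0 0 (deg2 F) (bigpairs F) (nbig F)
  (fun x => bonus F x + lightpage F x + 2 * leafpage F x)
  (fun x => x \in S) (bk F) (fun x => T02 F x) (fun=> 0) (fun=> 0).
rewrite sum_mem -/(size3 F) => W; suff /W : forall x,
    deg2 F x + 2 * bigpairs F x + 6 * nbig F x +
    2 * (bonus F x + lightpage F x + 2 * leafpage F x) <=
    12 * (x \in S) + 2 * bk F x + 2 * T02 F x + 0 * 0 + 0 * 0 by lia.
by move=> x; rewrite !addn0; exact: value_ge.
Qed.

Lemma size_bigs : size3 F + 6 * \sum_p nbig F p <= 12 * #|S|.
Proof.
have := size_value; have := sum_bonus nH.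
suff : \sum_x bonus F x <= \sum_x (bonus F x + lightpage F x + 2 * leafpage F x) by lia.
by apply: leq_sum => x _; rewrite -addnA leq_addr.
Qed.

Lemma size_le : size3 F <= 12 * #|S|.
Proof. by have := size_bigs; lia. Qed.

(** A budget of 8 in place of 12, for families whose number of high elements is under control. A
    page gets weight 1 only, so that one [bk] stays on the right after summation; full pages then
    overdraw by 2. *)
Lemma value_high x :
  deg2 F x + 1 * bigpairs F x + 4 * nbig F x + 4 * leafpage F x <=
  8 * (x \in S) + 2 * bk F x + 2 * fullpage F x + 2 * T02 F x + 4 * high F x.
Proof.
rewrite mul1n; have [xS|xS] := boolP (x \in S); last first.
  rewrite /leafpage (supp_deg sF xS) (supp_bigpairs sF xS) (supp_nbig sF xS) andbF.
  by rewrite muln0.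
rewrite /leafpage /fullpage /high; have [B|nB] /= := boolP (centre F x).
  by have [[-> -> d]|[-> -> ->]|[-> -> ->]] := centre_val B => /=; lia.
have [-> ->] := noncentre0 nB.
have [->|P] := posnP (bigpairs F x).
  by have := noncentre_deg nB; case: ltnP => /=; lia.
have [[-> d]|[P4 ->]|[P4 -> ->]] := noncentre_page nH nB P => /=.
- case: d => [d|->] //=; case: (eqVneq (deg2 F x) 2) => [->|_] //=.
  by case: (eqVneq (deg2 F x) 8) => [->|_] /=; lia.
- by rewrite !andbF; lia.
- by rewrite !andbF; lia.
Qed.

(* With two full pages [x], [y] the link of [anti p] is contained in the triangle on [q], [x], [y]. *)
Lemma fullpages_leaf p q x y z : big F p q -> F p q x -> F p q y -> F p q z ->
  fullpage F x -> fullpage F y -> y != x -> z != x -> z != y -> codeg F z (anti p) = 0.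
Proof.
move=> B Fx Fy Fz /and3P[nBx _ /eqP dx] /and3P[nBy _ /eqP dy] yx zx zy.
have vx s t : F p q s -> F p q t -> s != t -> (s.1 == t.1) = false.
  by move=> Fs Ft; apply: contraNF => /eqP/(tri_inj Fs Ft) ->.
have xy : x != y by rewrite eq_sym.
have Fx' : F x p q by rewrite triCA.
have Fy' : F y p q by rewrite triCA.
have [|[_ Fxo kx _]] := page_deg8 nBx B Fx'; first by rewrite dx.
have [|[_ Fyo _ _]] := page_deg8 nBy B Fy'; first by rewrite dy.
(* Codegree 2 of the full page [x] gives [anti p] a partner [u] off the vertex of [q]. It lies over
   [y], which closes the triangle. *)
have [u [Fu uq]] : exists u, F x (anti p) u /\ u.1 != q.1.
  have [/existsP[u /andP[]]|/existsPn none] := boolP [exists u, F x (anti p) u && (u.1 != q.1)].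
    by exists u.
  suff : codeg F x (anti p) <= #|[set q.1]| by rewrite cards1 kx.
  by apply: codeg_le => u Fu; rewrite inE; have := none u; rewrite Fu negbK.
rewrite triC in Fu; rewrite triC in Fxo; rewrite triC in Fyo.
have /= [nxo _ nxq] := tri_vx3 Fxo; have /= [nyo _ nyq] := tri_vx3 Fyo.
have uy : u.1 = y.1.
  have := tri_meet Fyo Fu; rewrite /= (vx _ _ Fx Fy xy) (negPf nxq) (negPf uq) orbF.
  by move/eqP.
apply: big1 => w _; apply/eqP; rewrite eqb0; apply/negP; rewrite triC => Fw.
have [_ _ zw] := tri_vx3 Fw; have [_ _ zq] := tri_vx3 Fz.
have := tri_meet Fxo Fw; have := tri_meet Fyo Fw; have := tri_meet Fu Fw.
rewrite /= uy (vx _ _ Fz Fx zx) (vx _ _ Fz Fy zy) ![z.1 == q.1]eq_sym (negPf zq) /=.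
case: (eqVneq w.1 x.1) => [->|_] /=; first by rewrite (vx _ _ Fx Fy xy) (negPf nxq).
by case: (eqVneq w.1 y.1) => [->|_] //=; rewrite (negPf nyq).
Qed.

Lemma leafpageI p q z : big F p q -> F p q z -> codeg F z (anti p) = 0 -> codeg F z (anti q) = 0 ->
  leafpage F z.
Proof.
move=> B Fz c1 c2; have Fz' : F z p q by rewrite triCA.
have d := page_deg B Fz'; rewrite c1 c2 in d.
have nF : F z (anti p) (anti q) = false.
  by apply/negP => /codeg_gt0; rewrite c1.
have d2 : deg2 F z = 2 by rewrite nF in d; lia.
apply/and3P; split; last by rewrite d2.
  apply/existsP => -[y By]; have := centre_deg By; rewrite d2; move: By; rewrite /big; lia.
rewrite (@bigpairs_only _ F z p q) // => s t Fs Bs.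
have nil v u : codeg F z v = 0 -> F z v u = false by move=> c; apply/negP => /codeg_gt0; rewrite c.
have := page_link B Fz' Fs; case/or4P=> [/andP[/eqP -> /eqP ->]|/andP[/eqP -> /eqP ->]|/eqP e|]; [by left|by right| |].
  by move: Fs; rewrite e nil.
by case/or3P=> /eqP e; move: Fs; rewrite e; [|rewrite triA|rewrite triA]; rewrite nil.
Qed.

(** As soon as there are two full pages, every other page is a leaf page. So exactly two are full,
    and a third page of the big pair is a leaf. *)
Lemma fullpages_bound p q : big F p q ->
  \sum_x F p q x * fullpage F x <= 1 + 2 * \sum_x F p q x * leafpage F x.
Proof.
move=> B; pose A := [set x | F p q x && fullpage F x].
have -> : \sum_x F p q x * fullpage F x = #|A|.
  by rewrite -sum1_card [RHS]big_mkcond; apply: eq_bigr => x _; rewrite inE; case: (F _ _ _) (fullpage _ _) => [] [].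
have [|] := leqP #|A| 1; first by lia.
case/card_gt1P=> x [y []]; rewrite !inE => /andP[Fx fx] /andP[Fy fy] xy.
have yx : y != x by rewrite eq_sym.
have leaf z : F p q z -> z != x -> z != y -> leafpage F z.
  move=> Fz zx zy; have B' := B; rewrite bigC in B'.
  apply: (leafpageI B Fz); first exact: fullpages_leaf B Fx Fy Fz fx fy yx zx zy.
  rewrite triC in Fx; rewrite triC in Fy; rewrite triC in Fz.
  exact: fullpages_leaf B' Fx Fy Fz fx fy yx zx zy.
have -> : #|A| = 2.
  have -> : A = [set x; y]; last by rewrite cards2 xy.
  apply/eqP; rewrite eqEsubset; apply/andP; split; apply/subsetP => z; rewrite !inE.
    case/andP=> Fz fz; rewrite -[_ || _]negbK negb_or; apply/negP => /andP[zx zy].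
    have /and3P[_ _ /eqP l] := leaf z Fz zx zy; have /and3P[_ _ /eqP] := fz.
    by rewrite l.
  by case/orP=> /eqP ->; rewrite ?Fx ?Fy ?fx ?fy.
have [z [Fz zx zy]] := big_page B x.1 y.1.
have lz : leafpage F z.
  by apply: leaf => //; [apply: contra zx | apply: contra zy] => /eqP ->.
by rewrite (bigD1 z) //= Fz lz mul1n mulnDr addnA leq_addr.
Qed.

Lemma sum_pages (f : V * bool -> nat) :
  \sum_x bigpairs F x * f x = \sum_p \sum_q big F p q * \sum_x F p q x * f x.
Proof.
rewrite /bigpairs; under eq_bigr do rewrite big_distrl /=.
rewrite exchange_big; apply: eq_bigr => s _; under eq_bigr do rewrite big_distrl /=.
rewrite exchange_big; apply: eq_bigr => t _; rewrite big_distrr; apply: eq_bigr => x _ /=.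
by rewrite [F x s t]triCA; case: (big F s t); case: (F s t x); rewrite ?mul1n ?mul0n ?muln0.
Qed.

Lemma sum_fullpages : 2 * \sum_x fullpage F x <= \sum_p nbig F p + 4 * \sum_x leafpage F x.
Proof.
have E (f : pred (V * bool)) : (forall x, f x -> bigpairs F x = 2) ->
    2 * \sum_x f x = \sum_x bigpairs F x * f x.
  move=> f2; rewrite big_distrr; apply: eq_bigr => x _ /=.
  by case: (boolP (f x)) => [/f2->|] //; rewrite !muln0.
have Ef := E (fullpage F); rewrite Ef => [|x /and3P[_ /eqP]//].
have El := E (leafpage F); rewrite -[4]/(2 * 2) -mulnA El => [|x /and3P[_ /eqP]//].
rewrite !sum_pages big_distrr -big_split; apply: leq_sum => p _ /=.
rewrite big_distrr -big_split; apply: leq_sum => q _ /=.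
by case B: (big F p q); rewrite ?mul1n //; exact: fullpages_bound.
Qed.

(* The full pages beyond the first of a big pair are paid for by its leaf pages. *)
Lemma size_highs : size3 F + 3 * \sum_p nbig F p <=
  8 * #|S| + \sum_p bk F p + 2 * \sum_x T02 F x + 4 * \sum_x high F x.
Proof.
have := sum_fullpages; have := sum_bigpairs F.
have := @leq_sums 1 4 4 8 2 2 2 4 (deg2 F) (bigpairs F) (nbig F) (fun x => leafpage F x)
  (fun x => x \in S) (bk F) (fun x => fullpage F x) (fun x => T02 F x) (fun x => high F x).
by rewrite sum_mem -/(size3 F) => W; have := W value_high; lia.
Qed.

End NoHeavy.
End Inequalities.

(** * Restriction to signed elements and covering *)

Section Restriction.
Variable V : finType.
Implicit Types (F : fam V) (p q r s t x y : V * bool) (a b c : V) (S D : {set V * bool}).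

Definition restrict_tri F D p q r := [&& F p q r, p \in D, q \in D & r \in D].

Lemma restrict_subproof F D :
  [/\ forall p q r, restrict_tri F D p q r = restrict_tri F D q p r,
      forall p q r, restrict_tri F D p q r = restrict_tri F D p r q,
      forall p q r, restrict_tri F D p q r -> p.1 != q.1,
      forall p q r s t, restrict_tri F D p q r -> restrict_tri F D p s t ->
        [|| s.1 == q.1, s.1 == r.1, t.1 == q.1 | t.1 == r.1] &
      forall p q r, restrict_tri F D p q r -> ~~ restrict_tri F D p q (anti r)].
Proof.
split=> p q r.
- by rewrite /restrict_tri [F p q r]triC; congr (_ && _); rewrite andbCA.
- by rewrite /restrict_tri [F p q r]triA; do 2![congr (_ && _)]; rewrite andbC.
- by case/andP=> /tri_vx pq _.
- by move=> s t /andP[Fq _] /andP[Fs _]; exact: tri_meet Fq Fs.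
- by case/andP=> /tri_opp nF _; apply: contra nF => /andP[].
Qed.

Definition restrict F D : fam V :=
  let: And5 h1 h2 h3 h4 h5 := restrict_subproof F D in Fam h1 h2 h3 h4 h5.

Lemma restrictE F D p q r :
  restrict F D p q r = [&& F p q r, p \in D, q \in D & r \in D].
Proof. by rewrite /restrict; case: restrict_subproof. Qed.

Lemma restrict_codeg F D p q : codeg (restrict F D) p q <= codeg F p q.
Proof. by apply: leq_sum => r _; rewrite restrictE; case: (F p q r); rewrite ?leq_b1. Qed.

Lemma restrict_big F D p q : big (restrict F D) p q -> big F p q.
Proof. by move=> B; apply: leq_trans B _; exact: restrict_codeg. Qed.

Lemma restrict_centre F D p : centre (restrict F D) p -> centre F p.
Proof. by case/existsP=> q /restrict_big B; apply/existsP; exists q. Qed.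

Lemma restrict_supp F S D : supported F S -> supported (restrict F D) (S :&: D).
Proof. by move=> sF p q r; rewrite restrictE inE => /and4P[/sF -> ->]. Qed.

Lemma size3E F : size3 F = \sum_p \sum_q \sum_r F p q r.
Proof. by []. Qed.

(** An element of [C] may stand in any of the three positions of an ordered triple, hence the factor
    3. *)
Lemma size3_cover F D D' (C : {set V * bool}) :
  (forall p q r, F p q r -> [|| [&& p \in D, q \in D & r \in D],
     [&& p \in D', q \in D' & r \in D'], p \in C, q \in C | r \in C]) ->
  size3 F <= size3 (restrict F D) + size3 (restrict F D') + 3 * \sum_(s in C) deg2 F s.
Proof.
move=> cov.
have E : \sum_(s in C) deg2 F s = \sum_p \sum_q \sum_r (p \in C) * F p q r.
  rewrite big_mkcond; apply: eq_bigr => p _; rewrite deg2_pairs.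
  case: (p \in C); first by do 2![apply: eq_bigr => ? _]; rewrite mul1n.
  by rewrite big1 // => q _; rewrite big1.
have E2 : \sum_(s in C) deg2 F s = \sum_p \sum_q \sum_r (q \in C) * F p q r.
  rewrite E exchange_big; apply: eq_bigr => p _; apply: eq_bigr => q _; apply: eq_bigr => r _.
  by rewrite triC.
have E3 : \sum_(s in C) deg2 F s = \sum_p \sum_q \sum_r (r \in C) * F p q r.
  rewrite E2; apply: eq_bigr => p _; rewrite exchange_big.
  by apply: eq_bigr => q _; apply: eq_bigr => r _; rewrite triA.
rewrite !mulSn mul0n addn0 {1}E {1}E2 E3 !size3E -!big_split; apply: leq_sum => p _ /=.
rewrite -!big_split; apply: leq_sum => q _ /=; rewrite -!big_split; apply: leq_sum => r _ /=.
have := cov p q r; rewrite !restrictE; case: (F p q r) => //= /(_ isT).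
by case/or3P=> [->|->|/or3P[]->] /=; abstract_bools; lia.
Qed.

(** For given [p] there are four choices of [q] over the two other vertices; then the vertex of the
    third element is fixed and at most one sign is allowed. *)
Lemma size3_vertices F (W : {set V}) : #|W| = 3 -> size3 (restrict F (over W)) <= 24.
Proof.
move=> W3; set G := restrict _ _.
have GW p q r : G p q r -> [/\ p.1 \in W, q.1 \in W & r.1 \in W].
  by rewrite restrictE !inE => /and4P[].
have sG : supported G (over W) by move=> p q r /GW[pW _ _]; rewrite inE.
have degG p : p \in over W -> deg2 G p <= 4.
  rewrite inE => pW; have c2 : #|W :\ p.1| = 2 by have := cardsD1 p.1 W; rewrite pW W3 => -[].
  rewrite (_ : 4 = \sum_(q in over (W :\ p.1)) 1); last by rewrite sum1_card card_over c2.
  rewrite /deg2 [leqRHS]big_mkcond; apply: leq_sum => q _; rewrite !inE.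
  case: (boolP (_ && _)) => [/andP[qp qW]|qW].
    have : #|W :\ p.1 :\ q.1| = 1 by have := cardsD1 q.1 (W :\ p.1); rewrite !inE qp qW c2 => -[].
    move=> <-; apply: codeg_le => r Gr; have [_ _ rW] := GW _ _ _ Gr.
    have [_ pr qr] := tri_vx3 Gr.
    by rewrite !inE rW andbT ![r.1 == _]eq_sym pr qr.
  rewrite leqn0; apply: contraR qW; rewrite -lt0n => c0; rewrite eq_sym (codeg_vx c0) /=.
  move: c0; rewrite codegE card_gt0 => /set0Pn[r]; rewrite inE.
  by case/GW.
rewrite (_ : 24 = 4 * #|over W|); last by rewrite card_over W3.
by apply: sum_supp => p; [exact: supp_deg sG | exact: degG].
Qed.

Definition rk (p : V * bool) : nat := enum_rank p.

Lemma rk_inj : injective rk.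
Proof. by move=> p q /val_inj/enum_rank_inj. Qed.

(** Exactly one of the six orders of a triple increases in rank. The divisibility serves to round
    later bounds. *)
Lemma size3_dvd F : 6 %| size3 F.
Proof.
pose g p q r : nat := [&& F p q r, rk p < rk q & rk q < rk r].
have sumC (h : V * bool -> V * bool -> V * bool -> nat) :
  (\sum_p \sum_q \sum_r h p q r = \sum_p \sum_q \sum_r h q p r) *
  (\sum_p \sum_q \sum_r h p q r = \sum_p \sum_q \sum_r h p r q).
  split; first by rewrite exchange_big.
  by apply: eq_bigr => p _; rewrite exchange_big.
pose T := \sum_p \sum_q \sum_r g p q r.
suff -> : size3 F = T + T + T + T + T + T by apply/dvdnP; exists T; lia.
have E1 : T = \sum_p \sum_q \sum_r g q p r by rewrite /T (sumC g).1.
have E2 : T = \sum_p \sum_q \sum_r g p r q by rewrite /T (sumC g).2.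
have E3 : T = \sum_p \sum_q \sum_r g q r p by rewrite E2 (sumC (fun p q r => g p r q)).1.
have E4 : T = \sum_p \sum_q \sum_r g r p q by rewrite E1 (sumC (fun p q r => g q p r)).2.
have E5 : T = \sum_p \sum_q \sum_r g r q p by rewrite E3 (sumC (fun p q r => g q r p)).2.
rewrite {1}/T {1}E1 {1}E2 {1}E3 {1}E4 {1}E5 size3E -!big_split; apply: eq_bigr => p _ /=.
rewrite -!big_split; apply: eq_bigr => q _ /=; rewrite -!big_split; apply: eq_bigr => r _ /=.
rewrite /g ![F q p r]triC ![F p r q]triA.
have -> : F q r p = F p q r by rewrite -triCA.
have -> : F r p q = F p q r by rewrite triCA.
have -> : F r q p = F p q r by rewrite triC -triCA.
case: (boolP (F p q r)) => //= /tri_vx3[pq pr qr].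
have ne s t : s.1 != t.1 -> rk s != rk t by apply: contra => /eqP/rk_inj ->.
move: (ne _ _ pq) (ne _ _ pr) (ne _ _ qr).
by case: ltngtP => //; case: ltngtP => //; case: ltngtP => //=; lia.
Qed.

End Restriction.

(** * Elements of degree above 8 *)

Section High.
Variable V : finType.
Implicit Types (p q r s t x y : V * bool) (S D : {set V * bool}).

Section Apex.
Variables (F : fam V) (a : V * bool) (W : {set V}).
Hypotheses (nBa : ~~ centre F a) (W3 : #|W| = 3) (aW : a.1 \notin W).
Hypothesis linkW : forall s t, F a s t -> (s.1 \in W) && (t.1 \in W).

(** For [p] and [c] over different vertices of [W], the partner in question lies over the third
    vertex and is therefore unique. *)
Let away p (c : V * bool) : bool := [exists s, F a c s && (s.1 != p.1)].

Lemma third_vertex b c d v : b \in W -> c \in W -> d \in W -> v \in W ->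
  b != c -> d != b -> d != c -> v != b -> v != c -> v = d.
Proof.
move=> bW cW dW vW bc db dc vb vc; apply/eqP; apply: contraT => vd.
have : #|[set b; c; d; v]| <= #|W|.
  by apply/subset_leq_card/subsetP => u; rewrite !inE -!orbA => /or4P[] /eqP->.
by rewrite W3 -!setUA !cardsU1 cards1 !inE !negb_or bc [b == d]eq_sym db [c == d]eq_sym dc
  [b == v]eq_sym vb [c == v]eq_sym vc [d == v]eq_sym vd.
Qed.

Lemma away_codeg p c : p.1 \in W -> c.1 \in W -> c.1 != p.1 ->
  codeg F a c <= F a c p + F a c (anti p) + away p c.
Proof.
move=> pW cW cp; rewrite /codeg (bigD1 p) //= (bigD1 (anti p)) ?anti_neq //= addnA leq_add2l.
have [/existsP[s /andP[Fs sp]]|none] := boolP (away p c).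
  rewrite (bigD1 s) /=; last first.
    by rewrite -negb_or -eq_vx.
  rewrite Fs big1 // => t /andP[/andP[tp to] ts]; apply/eqP; rewrite eqb0.
  apply: contra ts => Ft; apply/eqP; apply: (tri_inj Ft Fs).
  have /andP[_ sW] := linkW Fs; have /andP[_ tW] := linkW Ft.
  have [_ _ cs] := tri_vx3 Fs; have [_ _ ct] := tri_vx3 Ft.
  have tp' : t.1 != p.1 by rewrite eq_vx negb_or tp to.
  by apply: (third_vertex cW pW sW tW); rewrite // eq_sym.
rewrite big1 // => t /andP[tp to]; apply/eqP; rewrite eqb0; apply/negP => Ft.
by move/existsPn: none => /(_ t); rewrite Ft eq_vx negb_or tp to.
Qed.

(** A pair of the link uses the vertex of [p], or it joins the vertex of [c] to the third vertex of
    [W], where [away] sees it. *)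
Lemma side_bound p c : p.1 \in W -> c.1 \in W -> c.1 != p.1 ->
  deg2 F a <= 2 * (codeg F a p + codeg F a (anti p)) + 2 * (away p c + away p (anti c)).
Proof.
move=> pW cW cp; pose C := [set p; anti p; c; anti c].
have sumC (f : V * bool -> nat) : \sum_(s in C) f s = f p + f (anti p) + f c + f (anti c).
  have pp : p != anti p by rewrite eq_sym anti_neq.
  have cc : c != anti c by rewrite eq_sym anti_neq.
  have ne s t : s.1 = p.1 -> t.1 = c.1 -> s != t.
    by move=> sp tc; apply: contraNneq cp => e; rewrite -sp -tc e.
  rewrite /C -!setUA big_setU1 /=; last by rewrite !inE !negb_or pp !ne.
  rewrite big_setU1 /=; last by rewrite !inE !negb_or !ne.
  by rewrite big_setU1 ?inE //= big_set1 !addnA.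
have inC s : (s \in C) = (s.1 == p.1) || (s.1 == c.1) by rewrite !inE !eq_vx -!orbA.
have cov s t : F a s t -> (s \in C) || (t \in C).
  move=> Fst; have /andP[sW tW] := linkW Fst; have [_ _ st] := tri_vx3 Fst.
  rewrite !inC; apply: contraT; rewrite !negb_or => /andP[/andP[sp sc] /andP[tp tc]].
  have e : t.1 = s.1 by apply: (third_vertex pW cW sW tW); rewrite // eq_sym.
  by rewrite e eqxx in st.
have := cover_deg cov; rewrite !sumC.
have sym s t : F a s t = F a t s by rewrite triA.
have := away_codeg pW cW cp; have := @away_codeg p (anti c) pW cW cp.
rewrite (sym c p) (sym c (anti p)) (sym (anti c) p) (sym (anti c) (anti p)).
by lia_goal.
Qed.

Hypothesis da : 8 < deg2 F a.

Lemma away_le p c : away p c <= 1. Proof. by case: away. Qed.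

Lemma codeg_le2 p : codeg F a p <= 2.
Proof. by have /existsPn/(_ p) := nBa; rewrite /big -leqNgt. Qed.

Lemma other_vertex b : b \in W -> exists2 c, c \in W & c != b.
Proof.
move=> bW; have : 0 < #|W :\ b| by have := cardsD1 b W; rewrite W3 bW; lia.
by rewrite card_gt0 => /set0Pn[c]; rewrite !inE => /andP[cb cW]; exists c.
Qed.

(** Otherwise [side_bound] gives at most 2 (0 + 2) + 2 (1 + 1) = 8. *)
Lemma high_codeg p : p.1 \in W -> 0 < codeg F a p.
Proof.
move=> pW; have [c cW cp] := other_vertex pW; rewrite lt0n; apply/eqP => c0.
have := @side_bound p (c, true) pW cW cp; have := away_le p (c, true).
have := away_le p (anti (c, true)); have := codeg_le2 (anti p); move: c0 da; lia_goal.
Qed.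

(** If [q] were off [W], every partner of [p] in the link of [a] would lie over the vertex of [r],
    and [side_bound] would give 2 (1 + 2) + 2 (0 + 1) = 8. *)
Lemma high_touch p q r : F p q r -> p.1 \in W -> a.1 != q.1 -> a.1 != r.1 ->
  (q.1 \in W) && (r.1 \in W).
Proof.
without loss qW : q r / q.1 \notin W.
  move=> H Fp pW aq ar; apply: contraT; rewrite negb_and => nW.
  suff : (q.1 \in W) && (r.1 \in W) by case/andP=> qW rW; rewrite qW rW in nW.
  case/orP: nW => nW; first exact: H.
  by rewrite andbC; apply: H; rewrite // triA.
move=> Fp pW aq ar; exfalso.
have pa : p.1 != a.1 by apply: contraNneq aW => <-.
have only s : F a p s -> s.1 = r.1.
  rewrite triC => Fs; have := tri_meet Fp Fs; rewrite (negPf aq) (negPf ar) /= => /orP[] /eqP // e.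
  by move: Fs; rewrite triC => /linkW; rewrite e (negPf qW) andbF.
have [rW|rW] := boolP (r.1 \in W); last first.
  have := high_codeg pW; rewrite codegE card_gt0 => /set0Pn[s]; rewrite inE => Fs.
  by move: (linkW Fs); rewrite (only s Fs) (negPf rW) andbF.
have [_ pr _] := tri_vx3 Fp; have rp : r.1 != p.1 by rewrite eq_sym.
have c1 : codeg F a p <= 1.
  by rewrite -(cards1 r.1); apply: codeg_le => s /only ->; rewrite inE.
have a0 : away p r = false.
  apply/existsP => -[s /andP[Fs sp]]; have Frp : F r p q by rewrite triCA.
  rewrite triC in Fs; have := tri_meet Frp Fs; rewrite [a.1 == p.1]eq_sym (negPf pa) (negPf aq) (negPf sp) /=.
  by move/eqP => e; rewrite triC in Fs; move: (linkW Fs); rewrite e (negPf qW) andbF.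
have := @side_bound p r pW rW rp; rewrite a0; have := codeg_le2 (anti p).
by have := away_le p (anti r); move: c1 da; lia_goal.
Qed.

(** By [high_touch] a triple avoiding the vertex of [a] lies inside [W] or misses [W]. If neither
    sign of [a] is a centre, the four vertices cost at most 24 + 72 = 96, which is 12 for each of
    their eight elements. *)
Lemma high_cover : size3 F <= size3 (restrict F (~: over (a.1 |: W))) + 24 +
  3 * (deg2 F a + deg2 F (anti a)).
Proof.
apply: leq_trans (@size3_cover _ F (~: over (a.1 |: W)) (over W) [set a; anti a] _) _.
  have inC s : (s \in [set a; anti a]) = (s.1 == a.1) by rewrite !inE eq_vx.
  move=> p q r Fp; rewrite !inC !inE.
  case: (eqVneq p.1 a.1) => [_|pa]; first by rewrite !orbT.
  case: (eqVneq q.1 a.1) => [_|qa]; first by rewrite !orbT.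
  case: (eqVneq r.1 a.1) => [_|ra]; rewrite ?orbT ?orbF //=.
  have Fq : F q p r by rewrite triC.
  have Fr : F r p q by rewrite triCA.
  rewrite eq_sym in pa; rewrite eq_sym in qa; rewrite eq_sym in ra.
  have tp : (p.1 \in W) ==> (q.1 \in W) && (r.1 \in W).
    by apply/implyP => pW; exact: high_touch Fp pW qa ra.
  have tq : (q.1 \in W) ==> (p.1 \in W) && (r.1 \in W).
    by apply/implyP => qW; exact: high_touch Fq qW pa ra.
  have tr : (r.1 \in W) ==> (p.1 \in W) && (q.1 \in W).
    by apply/implyP => rW; exact: high_touch Fr rW pa qa.
  by move: tp tq tr; case: (p.1 \in W); case: (q.1 \in W); case: (r.1 \in W).
rewrite big_setU1 ?big_set1; last by rewrite inE eq_sym anti_neq.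
by rewrite leq_add2r leq_add2l size3_vertices.
Qed.

End Apex.
End High.

(** * The loss modulo 8 *)

Section Slack.
Variable V : finType.
Implicit Types (F : fam V) (p q r s t x y : V * bool) (S D : {set V * bool}).

Lemma supp_card F S p : supported F S -> deg2 F p <= (#|S| - 1) * (#|S| - 2).
Proof.
move=> sF; have [pS|/(supp_deg sF)->//] := boolP (p \in S).
have s1 : #|S| = (#|S :\ p|).+1 by have := cardsD1 p S; rewrite pS.
have cle q : codeg F p q <= (#|S| - 2) * (q \in S :\ p).
  rewrite !inE; case: (boolP (_ && _)) => [/andP[qp qS]|nq].
    have s2 : #|S :\ p| = (#|S :\ p :\ q|).+1 by have := cardsD1 q (S :\ p); rewrite !inE qp qS.
    rewrite muln1 s1 s2 !subSS subn0 codegE; apply/subset_leq_card/subsetP => r; rewrite !inE => Fr.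
    have [_ pr qr] := tri_vx3 Fr; have Fr' : F r p q by rewrite triCA.
    by rewrite (sF _ _ _ Fr') andbT; apply/andP; split;
       [apply: contraNneq qr => -> | apply: contraNneq pr => ->].
  rewrite muln0 leqn0; apply: contraR nq; rewrite -lt0n => c0.
  have pq := codeg_vx c0; move: c0; rewrite codegE card_gt0 => /set0Pn[r]; rewrite inE => Fr.
  have Fq : F q p r by rewrite triC.
  by rewrite (sF _ _ _ Fq) andbT; apply: contraNneq pq => ->.
have := @leq_sum _ (index_enum _) predT _ _ (fun q _ => cle q); rewrite -/(deg2 F p).
by rewrite sum_mull sum_mem s1 subn1 [leqRHS]mulnC.
Qed.

Lemma high_link F S a : supported F S -> high F a ->
  exists W : {set V}, [/\ #|W| = 3, a.1 \notin W, over W \subset S &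
    (forall p q r, F p q r -> p.1 \in W -> a.1 != q.1 -> a.1 != r.1 -> (q.1 \in W) && (r.1 \in W)) /\
    size3 F <= size3 (restrict F (~: over (a.1 |: W))) + 24 + 3 * (deg2 F a + deg2 F (anti a))].
Proof.
move=> sF /and3P[nBa _ da]; have [W [W3 aW linkW]] := high_triangle nBa da.
exists W; split=> //; last first.
  by split; [exact: high_touch nBa W3 aW linkW da | exact: high_cover nBa W3 aW linkW da].
apply/subsetP => p; rewrite inE => pW.
have := high_codeg nBa W3 aW linkW da pW; rewrite codegE card_gt0 => /set0Pn[r]; rewrite inE triC.
exact: sF.
Qed.

Lemma setD_apex S a (W : {set V}) : #|W| = 3 -> a.1 \notin W -> over W \subset S -> a \in S ->
  #|S :&: ~: over (a.1 |: W)| + 7 + (anti a \in S) = #|S|.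
Proof.
move=> W3 aW WS aS; have := cardsID (over (a.1 |: W)) S; rewrite setDE => <-.
suff -> : #|S :&: over (a.1 |: W)| = 7 + (anti a \in S) by lia.
have -> : S :&: over (a.1 |: W) = over W :|: (S :&: [set a; anti a]).
  apply/setP => s; rewrite !inE eq_vx andb_orr orbC; congr (_ || _).
  by rewrite andbC; apply: andb_idr => sW; apply: (subsetP WS); rewrite inE.
rewrite cardsU (_ : over W :&: _ = set0) ?cards0 ?subn0; last first.
  apply/setP => s; rewrite !inE -eq_vx; apply/negP => /and3P[sW _ /eqP e].
  by rewrite -e sW in aW.
rewrite card_over W3 -[7]/(6 + 1) -addnA; congr (_ + _).
case: (boolP (anti a \in S)) => oS.
  rewrite (setIidPr _) ?cards2 ?[a == _]eq_sym ?anti_neq //.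
  by apply/subsetP => s /set2P[] ->.
rewrite (_ : S :&: _ = [set a]) ?cards1 //; apply/setP => s; rewrite !inE.
apply/andP/eqP => [[sS /orP[/eqP//|/eqP e]]|->]; last by rewrite eqxx.
by rewrite -e sS in oS.
Qed.

(** A high element [a] splits off four vertices. If [anti a] is in [S], eight elements leave at a
    cost of at most 96 and the residue modulo 8 is kept; if not, seven elements leave at a cost of
    at most 24 + 36 = 84 - 24. Without high elements all degrees are at most 8. *)
Lemma noncentre_slack F S : (forall p, ~~ centre F p) -> supported F S ->
  2 <= #|S| %% 8 -> size3 F + 24 <= 12 * #|S|.
Proof.
elim: {S}_.+1 {-2}S (ltnSn #|S|) F => // m IH S; rewrite ltnS => Sm F nB sF S8.
have nH G : (forall p, ~~ centre G p) -> ~~ heavy G.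
  move=> nBG; apply/existsP => -[p /existsP[q /existsP[t /and3P[B _ _]]]].
  by have /existsPn/(_ q) := nBG p; rewrite B.
have [/existsP[a ha]|/existsPn nhigh] := boolP [exists a, high F a].
  have [W [W3 aW WS [_ cov]]] := high_link sF ha.
  have aS : a \in S.
    apply: contraT => /(supp_deg sF) d0; move: ha; rewrite /high d0.
    by rewrite !andbF.
  have cS := setD_apex W3 aW WS aS.
  set G := restrict F _ in cov.
  have nBG p : ~~ centre G p by apply: contra (nB p); exact: restrict_centre.
  have sG := restrict_supp (D := ~: over (a.1 |: W)) sF.
  have da := noncentre_deg (nB a); have doa := noncentre_deg (nB (anti a)).
  have [oS|oS] := boolP (anti a \in S); rewrite ?oS in cS.
    have := IH (S :&: ~: over (a.1 |: W)) _ G nBG sG.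
    by move: Sm S8 cS cov da doa; lia_goal.
  have := size_le (nH _ nBG) sG; move: cS cov da; rewrite (supp_deg sF oS) (negPf oS).
  by lia_goal.
have deg8 p : deg2 F p <= 8.
  rewrite leqNgt; apply: contra (nhigh p) => d; rewrite /high nB d andbT /=.
  apply/eqP; rewrite /bigpairs big1 // => s _; apply: big1 => t _.
  have /existsPn/(_ t) := nB s; rewrite /big => /negPf ->; by rewrite andbF.
have le8 : size3 F <= 8 * #|S| by apply: sum_supp => p *; rewrite ?deg8 // (supp_deg sF).
(* From six elements on, 8 per element saves the 24. For two to five elements the trivial bound and
   divisibility by 6 do. *)
have [S6|S5] := leqP 6 #|S|; first by move: S6 le8; lia_goal.
have leS : size3 F <= (#|S| - 1) * (#|S| - 2) * #|S|.
  by apply: sum_supp => p *; rewrite ?supp_card // (supp_deg sF).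
have /dvdnP[k kE] := size3_dvd F; rewrite kE in le8 leS *.
move: S5 S8 le8 leS; case: #|S| => [|[|[|[|[|[|c]]]]]] //=; lia.
Qed.

Section FewBigs.
Variables (F : fam V) (S : {set V * bool}).
Hypotheses (nH : ~~ heavy F) (sF : supported F S) (J4 : \sum_p nbig F p < 4).

(** Each centre contributes to the sum of [nbig]; four distinct centres are the contradiction used
    in this section. *)
Lemma few_centres (A : {set V * bool}) : (forall p, p \in A -> centre F p) -> #|A| < 4.
Proof.
move=> cA; apply: leq_ltn_trans J4; rewrite -sum1_card big_mkcond; apply: leq_sum => p _.
by case: (boolP (p \in A)) => // /cA; rewrite centre_nbig.
Qed.

Lemma bigI p q : big F p q -> centre F p.
Proof. by move=> B; apply/existsP; exists q. Qed.

Lemma bigI' p q : big F p q -> centre F q.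
Proof. by rewrite bigC; exact: bigI. Qed.

Lemma four_centres p q r s : uniq [:: p; q; r; s] -> centre F p -> centre F q -> centre F r ->
  centre F s -> False.
Proof.
move=> u cp cq cr cs; have := @few_centres [set x in [:: p; q; r; s]].
rewrite cardsE (card_uniqP u) /= => /(_ _)/negP[] // x; rewrite !inE.
by case/or4P=> /eqP->.
Qed.

Lemma few_page2 p q t x : big F p q -> big F (anti p) t -> F x p q -> F x (anti p) t -> False.
Proof.
move=> B Bt Fx Ft; apply: (@four_centres p (anti p) q t _ (bigI B) (bigI Bt) (bigI' B) (bigI' Bt)).
have [_ _ pq] := tri_vx3 Fx; have [_ _ pt] := tri_vx3 Ft.
have ne s u : s.1 != u.1 -> s != u by apply: contraNneq => ->.
rewrite /= !inE !negb_or [p == _]eq_sym anti_neq (ne p q) // (ne p t) // (ne (anti p) q) // (ne (anti p) t) //= andbT.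
apply: contraTneq Fx => ->; apply/negP => Fx.
have Fx' : F x t p by rewrite triA.
have Ft' : F x t (anti p) by rewrite triA.
by have := tri_opp Fx'; rewrite Ft'.
Qed.

Lemma few_T02 x : T02 F x = false.
Proof.
apply/existsP => -[p /T0P[q [t [B Bt Fx Ft _]]]].
exact: few_page2 B Bt Fx Ft.
Qed.

Lemma few_bonus p q : big F p q -> bonus F p = 1.
Proof.
move=> B; have pq := big_vx B.
have ne s u : s.1 != u.1 -> s != u by apply: contraNneq => ->.
have nB : big F p (anti q) = false.
  apply/negP => B'; move: J4; rewrite ltnNge => /negP[].
  have n1 := nbigE B; rewrite B' in n1.
  rewrite (bigD1 p) //= (bigD1 q) /= ?[q == p]eq_sym ?ne // (bigD1 (anti q)) /=; last first.
    by rewrite anti_neq [_ == p]eq_sym ne.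
  have := bigI' B; have := bigI' B'; rewrite !centre_nbig n1; lia_goal.
rewrite /bonus (nbigE B) nB /=; case: eqP => // /eqP; rewrite -lt0n bigpairsE card_gt0.
case/set0Pn=> -[y z]; rewrite inE /= => /andP[Fp Byz]; exfalso.
have [py pz yz] := tri_vx3 Fp.
apply: (@four_centres p q y z _ (bigI B) (bigI' B) (bigI Byz) (bigI' Byz)).
rewrite /= !inE !negb_or (ne p q) // (ne p y) // (ne p z) // (ne y z) //= andbT.
apply/andP; split; apply/eqP => e.
  have [qE _ _ _] := centre_page B Byz Fp (congr1 fst (esym e)).
  by have := anti_neq y; rewrite -qE e eqxx.
rewrite bigC in Byz; rewrite triA in Fp.
have [qE _ _ _] := centre_page B Byz Fp (congr1 fst (esym e)).
by have := anti_neq z; rewrite -qE e eqxx.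
Qed.

Lemma few_page p q x : big F p q -> F p q x -> lightpage F x || fullpage F x.
Proof.
move=> B Fx; have Fx' : F x p q by rewrite triCA.
have nB : ~~ centre F x.
  apply/existsP => -[y By].
  have ne s u : s.1 != u.1 -> s != u by apply: contraNneq => ->.
  have [xp xq pq] := tri_vx3 Fx'.
  have key p' q' : big F p' q' -> F x p' q' -> p'.1 = y.1 -> False.
    move=> B' Fx2 e; have [yE _ _ _] := centre_page By B' Fx2 e; subst y.
    have [xp' xq' pq'] := tri_vx3 Fx2.
    apply: (@four_centres x p' (anti p') q' _ (bigI By) (bigI B') (bigI' By) (bigI' B')).
    by rewrite /= !inE !negb_or (ne x p') // (ne x (anti p')) // (ne x q') // (ne p' q') //
      (ne (anti p') q') // [p' == _]eq_sym anti_neq.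
  have := center By Fx' => /orP[] /eqP; first exact: (key p q B Fx').
  by apply: (key q p); rewrite 1?bigC // triA.
have P : 0 < bigpairs F x.
  rewrite bigpairsE card_gt0; apply/set0Pn; exists (p, q); by rewrite inE /= Fx' B.
have [[p' [q' [B' Fx2 P2]]]|[p' [q' [t [B' Bt Fx2 Ft]]]]] := page_cases P; last first.
  by case: (few_page2 B' Bt Fx2 Ft).
rewrite /lightpage /fullpage nB P2 /=.
by have [->//|[-> _ _ _]] := page_deg8 nB B' Fx2; rewrite orbT.
Qed.

(** In [size_value] the big pair saves 12 and its two bonuses 4. Its pages, at least three, are
    light or full with at most 1 + 2 (leaf pages) full ones, so they save 4. Divisibility by 6 turns
    20 into 24. *)
Lemma few_slack p q : big F p q -> size3 F + 24 <= 12 * #|S|.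
Proof.
move=> B; have := size_value nH sF.
have -> : \sum_x T02 F x = 0 by apply: big1 => x _; rewrite few_T02.
have J2 : 2 <= \sum_p nbig F p.
  have qp : q != p by apply: contraTneq (big_vx B) => ->; rewrite eqxx.
  rewrite (bigD1 p) //= (bigD1 q) //=.
  by have := bigI B; have := bigI' B; rewrite !centre_nbig; lia_goal.
have b2 : 2 <= \sum_x bonus F x.
  have qp : q != p by apply: contraTneq (big_vx B) => ->; rewrite eqxx.
  have B' := B; rewrite bigC in B'.
  by rewrite (bigD1 p) //= (bigD1 q) //= (few_bonus B) (few_bonus B').
have : 3 <= \sum_x F p q x * lightpage F x + \sum_x F p q x * fullpage F x.
  apply: (leq_trans B); rewrite -big_split; apply: leq_sum => x _ /=.
  case: (boolP (F p q x)) => // /(few_page B).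
  by case: (lightpage F x); case: (fullpage F x).
have := fullpages_bound nH B.
have le (f : V * bool -> bool) : \sum_x F p q x * f x <= \sum_x f x.
  by apply: leq_sum => x _; case: (F p q x); rewrite ?mul1n.
have := le (lightpage F); have := le (leafpage F).
have -> : \sum_x (bonus F x + lightpage F x + 2 * leafpage F x) =
  \sum_x bonus F x + \sum_x lightpage F x + 2 * \sum_x leafpage F x.
  by rewrite -sum_mull -!big_split.
by have /dvdnP[k ->] := size3_dvd F; move: J2 b2; lia_goal.
Qed.

End FewBigs.

Lemma slack F S : ~~ heavy F -> supported F S -> 2 <= #|S| %% 8 -> size3 F + 24 <= 12 * #|S|.
Proof.
move=> nH sF S8; have [J4|] := ltnP (\sum_p nbig F p) 4; last first.
  by have := size_bigs nH sF; lia_goal.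
have [/existsP[p /existsP[q B]]|/existsPn nB] := boolP [exists p, centre F p].
  exact: (few_slack nH sF J4 B).
exact: noncentre_slack nB sF S8.
Qed.

End Slack.

(** * Ten and eleven vertices without a heavy triple *)

Definition size_bound (n m : nat) := forall (V : finType) (F : fam V) (U : {set V}),
  supported F (over U) -> #|U| = n -> size3 F <= 6 * m.

Section TenEleven.
Variables (V : finType) (F : fam V) (U : {set V}).
Implicit Types (p q r s t x y a : V * bool).
Hypotheses (nH : ~~ heavy F) (sF : supported F (over U)).

Lemma supp_over p q r : F p q r -> [/\ p.1 \in U, q.1 \in U & r.1 \in U].
Proof.
move=> Fp; have Fq : F q p r by rewrite triC.
have Fr : F r p q by rewrite triCA.
by move: (sF Fp) (sF Fq) (sF Fr); rewrite !inE.
Qed.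

(** Otherwise both signs of [a] have degree at most 12, and [high_cover] removes four vertices at a
    cost of 24 + 72. *)
Lemma high_centre m a : size_bound (#|U| - 4) m -> 6 * m + 96 < size3 F -> high F a ->
  centre F (anti a).
Proof.
move=> bd; rewrite ltnNge => lb ha; apply: contraR lb => nBo.
have [W [W3 aW WU [_ cov]]] := high_link sF ha.
have [d1 d2] : deg2 F a <= 12 /\ deg2 F (anti a) <= 12.
  by split; apply: noncentre_deg => //; case/and3P: ha.
have aU : a.1 \in U.
  have aS : a \in over U; last by rewrite inE in aS.
  by apply: contraT => /(supp_deg sF) d0; move: ha; rewrite /high d0 !andbF.
set G := restrict F _ in cov.
have sG : supported G (over (U :\: (a.1 |: W))).
  by move=> p q r /(restrict_supp sF); rewrite !inE andbC.
have KU : a.1 |: W \subset U.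
  apply/subsetP => v; rewrite !inE => /orP[/eqP->//|vW].
  by have := subsetP WU (v, true); rewrite !inE; apply.
have := bd _ G _ sG; rewrite cardsD (setIidPr KU) cardsU1 aW W3 => /(_ erefl).
by move: cov d1 d2; lia_goal.
Qed.

Lemma big_even : 2 %| \sum_p nbig F p.
Proof.
pose g p q : nat := big F p q && (rk p < rk q).
have E : \sum_p \sum_q g p q = \sum_p \sum_q g q p by rewrite exchange_big.
apply/dvdnP; exists (\sum_p \sum_q g p q); rewrite muln2 -addnn {1}E -big_split.
apply: eq_bigr => p _; rewrite -big_split; apply: eq_bigr => q _ /=.
rewrite /g [big F q p]bigC; case B: (big F p q) => //=.
have : rk p != rk q by apply: contraTneq (big_vx B) => /rk_inj ->; rewrite eqxx.
by case: ltngtP.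
Qed.

Lemma codeg_card p q : big F p q -> codeg F p q <= #|U| - 2.
Proof.
move=> B; have pq := big_vx B.
have [pU qU] : p.1 \in U /\ q.1 \in U.
  by have [r [Fr _ _]] := big_page B p.1 p.1; have [] := supp_over Fr.
have -> : #|U| - 2 = #|U :\ p.1 :\ q.1|.
  have := cardsD1 p.1 U; have := cardsD1 q.1 (U :\ p.1).
  by rewrite !inE pU qU [q.1 == _]eq_sym pq /= => -> ->; lia_goal.
apply: codeg_le => r Fr; have [_ _ rU] := supp_over Fr; have [_ pr qr] := tri_vx3 Fr.
by rewrite !inE rU ![r.1 == _]eq_sym pr qr.
Qed.

Lemma twice_T02 : 2 * \sum_x T02 F x <= \sum_p nbig F p.
Proof. exact: leq_trans (sum_T02 F) (sum_numT nH). Qed.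

Hypothesis hC : forall a, high F a -> centre F (anti a).

Lemma highs_le : \sum_x high F x <= \sum_p nbig F p.
Proof.
rewrite -[leqRHS]sum_opp; apply: leq_sum => x _.
by case: (boolP (high F x)) => // /hC; rewrite centre_nbig.
Qed.

(* [p] and [q] avoid the triangle that carries the link of [a]. *)
Lemma far_codeg a p q : high F a -> big F p q -> a.1 != p.1 -> a.1 != q.1 ->
  codeg F p q <= #|U| - 6 + F p q (anti a).
Proof.
move=> ha B ap aq; have [W [W3 aW WU [touch _]]] := high_link sF ha.
have [pU qU] : p.1 \in U /\ q.1 \in U.
  by have [r [Fr _ _]] := big_page B p.1 p.1; have [] := supp_over Fr.
have notW : (p.1 \in W = false) * (q.1 \in W = false).
  (* If [s] were over [W], then [high_touch] would put [t] and two pages there too: four vertices in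
     a set of three. *)
  have aux s t : big F s t -> a.1 != s.1 -> a.1 != t.1 -> s.1 \in W -> False.
    move=> Bs as_ at_ sW.
    have sub r : F s t r -> r.1 != a.1 -> (t.1 \in W) && (r.1 \in W).
      by move=> Fr ra; apply: touch Fr sW at_ _; rewrite eq_sym.
    have [r [Fr ra _]] := big_page Bs a.1 a.1; have /andP[tW rW] := sub r Fr ra.
    have [r' [Fr' ra' rr]] := big_page Bs a.1 r.1; have /andP[_ rW'] := sub r' Fr' ra'.
    have [_ sr tr] := tri_vx3 Fr; have [st sr' tr'] := tri_vx3 Fr'.
    suff : #|[set s.1; t.1; r.1; r'.1]| <= #|W|.
      by rewrite W3 -!setUA !cardsU1 cards1 !inE !negb_or st sr sr' tr tr' eq_sym rr.
    by apply/subset_leq_card/subsetP => v; rewrite !inE -!orbA => /or4P[] /eqP->.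
  split; apply/negP; first exact: aux B ap aq.
  by have B' := B; rewrite bigC in B'; exact: aux B' aq ap.
have aU : a.1 \in U.
  by have [r [Fr _ _]] := big_page B p.1 p.1; have /existsP[s /big_page/(_ a.1 a.1)[u [/supp_over[]]]] := hC ha.
have card6 : #|U :\: (W :|: [set a.1; p.1; q.1])| = #|U| - 6.
  rewrite cardsD (setIidPr _); last first.
    apply/subsetP => v; rewrite !inE -!orbA => /or4P[vW|/eqP->|/eqP->|/eqP->] //.
    by have := subsetP WU (v, true); rewrite !inE; apply.
  rewrite cardsU W3 (_ : W :&: _ = set0) ?cards0.
    by rewrite -setUA !cardsU1 cards1 !inE !negb_or ap aq (big_vx B).
  apply/setP => v; rewrite !inE; apply/negP => /andP[vW /orP[/orP[]|] /eqP e].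
  - by rewrite e (negPf aW) in vW.
  - by rewrite e notW in vW.
  - by rewrite e notW in vW.
pose A := [set r | F p q r && (r.1 != a.1)].
have cA : #|A| <= #|U| - 6.
  rewrite -card6 -(@card_in_imset _ _ fst) => [|r s]; last first.
    by rewrite !inE => /andP[Fr _] /andP[Fs _]; exact: tri_inj Fr Fs.
  apply/subset_leq_card/subsetP => v /imsetP[r]; rewrite inE => /andP[Fr ra] ->.
  have [_ _ rU] := supp_over Fr; have [_ pr qr] := tri_vx3 Fr.
  rewrite !inE rU !negb_or ra ![r.1 == _]eq_sym pr qr !andbT /=; apply/negP => rW.
  have Fr' : F r p q by rewrite triCA.
  by have := touch _ _ _ Fr' rW ap aq; rewrite notW.
have nFa : F p q a = false.
  apply/negP => Fa; have Fa' : F a p q by rewrite triCA.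
  by case/and3P: ha => _ /eqP/bigpairs0/(_ Fa'); rewrite B.
apply: leq_trans (_ : #|A| + F p q (anti a) <= _); last by rewrite leq_add2r.
rewrite codegE; case Fo: (F p q (anti a)).
  have -> : [set r | F p q r] = anti a |: A.
    apply/setP => r; rewrite !inE eq_vx; have [->|_] := eqVneq r (anti a); first by rewrite Fo.
    by have [->|_] := eqVneq r a; rewrite ?nFa ?andbT.
  by rewrite cardsU1 addnC leq_add2l leq_b1.
rewrite addn0; apply/subset_leq_card/subsetP => r; rewrite !inE => Fr; rewrite Fr eq_vx /=.
by apply/norP; split; apply: contraTneq Fr => ->; rewrite ?nFa ?Fo.
Qed.

Lemma high_vx a b : high F a -> high F b -> a != b -> a.1 != b.1.
Proof.
move=> ha hb ab; rewrite eq_vx negb_or ab; apply: contraTneq (hC ha) => ->.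
by rewrite antiK; case/and3P: hb.
Qed.

Lemma high_big a p q : high F a -> big F p q -> p.1 = a.1 -> p = anti a.
Proof.
move=> ha B /vxP[e|//]; case/and3P: ha => /existsPn/(_ q).
by rewrite -e B.
Qed.

Lemma sum_bk_le (c : nat) (g : V * bool -> V * bool -> nat) :
  (forall p q, big F p q -> codeg F p q <= c + g p q) ->
  \sum_p bk F p <= c * \sum_p nbig F p + \sum_p \sum_q big F p q * g p q.
Proof.
move=> le; rewrite -sum_mull -big_split; apply: leq_sum => p _ /=.
rewrite /nbig -sum_mull -big_split; apply: leq_sum => q _ /=.
by case: (boolP (big F p q)) => [/le|]; rewrite ?mul1n ?muln1 ?mul0n.
Qed.

End TenEleven.

Section Ten.
Variables (V : finType) (F : fam V) (U : {set V}).
Implicit Types (p q r s t x y a b : V * bool).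
Hypotheses (nH : ~~ heavy F) (sF : supported F (over U)).
Hypothesis hC : forall a, high F a -> centre F (anti a).
Hypothesis U10 : #|U| = 10.

Let J := \sum_p nbig F p.
Let KK := \sum_p bk F p.
Let H := [set x | high F x].

Lemma highsE : \sum_x high F x = #|H|.
Proof. by rewrite -sum_mem; apply: eq_bigr => x _; rewrite inE. Qed.

Lemma far5 a p q : high F a -> big F p q -> a.1 != p.1 -> a.1 != q.1 -> codeg F p q <= 5.
Proof.
move=> ha B ap aq; have := far_codeg sF hC ha B ap aq; rewrite U10.
by case: (F p q _) => /=; lia_goal.
Qed.

Lemma bk0 : KK <= 8 * J.
Proof.
apply: leq_trans (@sum_bk_le _ F 8 (fun _ _ => 0) _) _ => [p q B|].
  by have := codeg_card sF B; rewrite U10 addn0.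
by rewrite [X in _ + X]big1 ?addn0 // => p _; rewrite big1 // => q _; rewrite muln0.
Qed.

Lemma nbig_le2 p : nbig F p <= 2.
Proof.
have [->//|] := posnP (nbig F p); rewrite -centre_nbig => /existsP[q B].
by rewrite (nbigE B); case: (big F p _).
Qed.

(** By [far5] a codegree above 5 needs a pair containing [anti a], and the excess is at most 3. As
    [anti a] has at most two big partners, this concerns at most four ordered pairs. *)
Lemma bk1 a : high F a -> KK <= 5 * J + 12.
Proof.
move=> ha; pose g p q : nat := 3 * (p == anti a) + 3 * (q == anti a).
apply: leq_trans (@sum_bk_le _ F 5 g _) _ => [p q B|].
  rewrite /g; have c8 : codeg F p q <= 8 by have := codeg_card sF B; rewrite U10.
  have [pa|pa] := eqVneq p (anti a); first by move: c8; lia_goal.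
  have [qa|qa] := eqVneq q (anti a); first by move: c8; lia_goal.
  apply: (far5 ha B); rewrite eq_sym.
    by apply: contra pa => /eqP/(high_big ha B) ->.
  by rewrite bigC in B; apply: contra qa => /eqP/(high_big ha B) ->.
rewrite leq_add2l /g; under eq_bigr do (under eq_bigr do rewrite mulnDr; rewrite big_split /=).
rewrite big_split /= [X in _ + X]exchange_big /=.
have E : \sum_p \sum_q big F p q * (3 * (p == anti a)) <= 6.
  rewrite (bigD1 (anti a)) //= [X in _ + X]big1 ?addn0 => [|p /negPf pa]; last first.
    by apply: big1 => q _; rewrite pa !muln0.
  rewrite eqxx /= -big_distrl /= -/(nbig F (anti a)).
  by have := nbig_le2 (anti a); lia_goal.
rewrite -[12]/(6 + 6) leq_add //.
by apply: leq_trans E; apply: leq_sum => q _; apply: leq_sum => p _; rewrite bigC.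
Qed.

(** Only the pair of [anti a] and [anti b], in its two orders, can have a codegree above 5. *)
Lemma bk2 a b : high F a -> high F b -> a != b -> KK <= 5 * J + 6.
Proof.
move=> ha hb ab; have av := high_vx hC ha hb ab.
pose g p q : nat := 3 * ((p == anti a) && (q == anti b)) + 3 * ((p == anti b) && (q == anti a)).
apply: leq_trans (@sum_bk_le _ F 5 g _) _ => [p q B|].
  rewrite /g; have c8 : codeg F p q <= 8 by have := codeg_card sF B; rewrite U10.
  have B' := B; rewrite bigC in B'.
  have near c : high F c -> [|| p == anti c, q == anti c | codeg F p q <= 5].
    move=> hc; apply: contraT; rewrite !negb_or => /and3P[pc qc /negP[]].
    apply: (far5 hc B); rewrite eq_sym.
      by apply: contra pc => /eqP/(high_big hc B) ->.
    by apply: contra qc => /eqP/(high_big hc B') ->.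
  have ne : (anti a == anti b) = false by apply: contraNF ab => /eqP/anti_inj ->.
  case/or3P: (near a ha) => [/eqP pa|/eqP qa|h]; last by move: h; lia_goal.
    case/or3P: (near b hb) => [/eqP pb|/eqP qb|h]; last by move: h; lia_goal.
      by move: ne; rewrite -pa -pb eqxx.
    by rewrite pa qb !eqxx /=; move: c8; rewrite -pa -qb; lia_goal.
  case/or3P: (near b hb) => [/eqP pb|/eqP qb|h]; last by move: h; lia_goal.
    by rewrite pb qa !eqxx /=; move: c8; rewrite -pb -qa; lia_goal.
  by move: ne; rewrite -qa -qb eqxx.
rewrite leq_add2l.
have E c d : \sum_p \sum_q big F p q * (3 * ((p == c) && (q == d))) <= 3.
  rewrite (bigD1 c) //= [X in _ + X]big1 ?addn0 => [|p /negPf pc]; last first.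
    by apply: big1 => q _; rewrite pc !muln0.
  rewrite (bigD1 d) //= big1 ?addn0 => [|q /negPf qd]; last by rewrite qd andbF !muln0.
  by rewrite !eqxx; case: (big F c d).
rewrite /g; under eq_bigr do (under eq_bigr do rewrite mulnDr; rewrite big_split /=).
by rewrite big_split /= -[6]/(3 + 3) leq_add.
Qed.

Lemma far_high p q : 2 < #|H| -> exists2 a, high F a & (a.1 != p.1) && (a.1 != q.1).
Proof.
case/card_gt2P=> a [b [c [[]]]]; rewrite !inE => ha hb hc [ab bc ca].
have av := high_vx hC ha hb ab; have bv := high_vx hC hb hc bc; have cv := high_vx hC hc ha ca.
have [pa|] := boolP ((a.1 != p.1) && (a.1 != q.1)); first by exists a.
have [pb|] := boolP ((b.1 != p.1) && (b.1 != q.1)); first by exists b.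
have [pc|] := boolP ((c.1 != p.1) && (c.1 != q.1)); first by exists c.
rewrite !negb_and !negbK => /orP[] /eqP ec /orP[] /eqP eb /orP[] /eqP ea;
  by move: av bv cv; rewrite ?ea ?eb ?ec ?eqxx.
Qed.

Lemma bk3 : 2 < #|H| -> KK <= 5 * J.
Proof.
move=> h3; apply: leq_trans (@sum_bk_le _ F 5 (fun _ _ => 0) _) _ => [p q B|].
  by have [a ha /andP[ap aq]] := far_high p q h3; rewrite addn0; exact: far5 ha B ap aq.
by rewrite [X in _ + X]big1 ?addn0 // => p _; rewrite big1 // => q _; rewrite muln0.
Qed.

(** A codegree of 5 makes the centre [anti a] a page of [p q], and [centre_page] shows that [anti p]
    or [anti q] is a centre. Two opposite centres are not opposite to high elements, so with the
    five or more opposites of high elements they are at least seven centres, against [J] at most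
    6. *)
Lemma bk5 : J <= 6 -> 4 < #|H| -> KK <= 4 * J.
Proof.
move=> J6 h5; have h3 : 2 < #|H| by apply: leq_trans h5.
have cB : #|[set p | centre F p]| <= J.
  rewrite -sum1_card big_mkcond; apply: leq_sum => p _.
  by rewrite inE; case: (boolP (centre F p)) => //; rewrite centre_nbig.
have both z : centre F z -> centre F (anti z) -> False.
  move=> cz cz'; have sub : [set anti a | a in H] \subset [set p | centre F p] :\ z :\ anti z.
    apply/subsetP => u /imsetP[a]; rewrite inE => ha ->; rewrite !inE (hC ha) andbT.
    have na : ~~ centre F a by case/and3P: ha.
    by apply/andP; split; apply: contraNneq na => e; [rewrite -[a]antiK e antiK|rewrite -[a]antiK e].
  have := subset_leq_card sub; rewrite card_imset; last exact: anti_inj.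
  have := cardsD1 z [set p | centre F p]; have := cardsD1 (anti z) ([set p | centre F p] :\ z).
  rewrite !inE cz cz' anti_neq /= => e1 e2 le; move: cB; rewrite e2 e1 => cB.
  have X4 := leq_trans cB J6; rewrite !add1n !ltnS in X4.
  by have := leq_trans h5 (leq_trans le X4).
apply: leq_trans (@sum_bk_le _ F 4 (fun _ _ => 0) _) _ => [p q B|].
  have [a ha /andP[ap aq]] := far_high p q h3; rewrite addn0.
  have := far_codeg sF hC ha B ap aq; rewrite U10; case Fo: (F p q (anti a)) => //.
  have Fo' : F (anti a) p q by rewrite triCA.
  have /existsP[y By] := hC ha; have B' := B; rewrite bigC in B'.
  case/orP: (center By Fo') => /eqP e.
    have [yE _ _ _] := centre_page By B Fo' e; subst y.
    by case: (both p (bigI B) (bigI' By)).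
  rewrite triA in Fo'; have [yE _ _ _] := centre_page By B' Fo' e; subst y.
  by case: (both q (bigI' B) (bigI' By)).
by rewrite [X in _ + X]big1 ?addn0 // => p _; rewrite big1 // => q _; rewrite muln0.
Qed.

Lemma ten_numeric : size3 F <= 192.
Proof.
rewrite leqNgt; apply/negP => lb.
have := size_bigs nH sF; have := size_highs nH sF; have := twice_T02 nH.
have := highs_le hC; have := big_even F; have /dvdnP[k kE] := size3_dvd F.
rewrite card_over U10 highsE -/J -/KK => /dvdnP[j jE] hJ hT hh hb.
(* By divisibility [size3] is at least 198, so 6 [J] is at most 240 - 198 = 42, and [J] is even. *)
have J6 : J <= 6 by move: hb lb jE; rewrite kE; lia_goal.
have h0 := bk0; have h3 := bk3; have h5 := bk5 J6.
have h1 : 0 < #|H| -> KK <= 5 * J + 12.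
  by rewrite card_gt0 => /set0Pn[a]; rewrite inE; exact: bk1.
have h2 : 1 < #|H| -> KK <= 5 * J + 6.
  by case/card_gt1P=> a [b []]; rewrite !inE; exact: bk2.
move: hb hh hT hJ h0 h1 h2 h3 h5 J6 lb kE jE.
move: (\sum_x T02 F x) #|H| KK J (size3 F) => T h K J' N; clear.
move=> hb hh hT hJ h0 h1 h2 h3 h5 J6 lb kE jE; subst N J'.
have [e|e] := posnP h; first by subst h; lia.
have {}h1 := h1 e; have [l2|l2] := ltnP 1 h; last by lia.
have {}h2 := h2 l2; have [l3|l3] := ltnP 2 h; last by lia.
have {}h3 := h3 l3; have [l5|l5] := ltnP 4 h; last by lia.
by have {}h5 := h5 l5; lia.
Qed.

End Ten.

Lemma noheavy_ten (V : finType) (F : fam V) (U : {set V}) : size_bound 6 16 ->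
  ~~ heavy F -> supported F (over U) -> #|U| = 10 -> size3 F <= 6 * 32.
Proof.
move=> bd nH sF U10; rewrite leqNgt; apply/negP => lb.
suff : size3 F <= 192 by rewrite leqNgt lb.
apply: (ten_numeric nH sF _ U10) => a; apply: (@high_centre _ _ _ sF 16) => //.
by rewrite U10.
Qed.

Lemma noheavy_eleven (V : finType) (F : fam V) (U : {set V}) : size_bound 7 20 ->
  ~~ heavy F -> supported F (over U) -> #|U| = 11 -> size3 F <= 6 * 38.
Proof.
move=> bd nH sF U11; rewrite leqNgt; apply/negP => lb.
have hC a : high F a -> centre F (anti a).
  apply: (@high_centre _ _ _ sF 20); first by rewrite U11.
  by apply: leq_ltn_trans lb.
have := size_bigs nH sF; have := size_highs nH sF; have := twice_T02 nH.
have := highs_le hC; have /dvdnP[k kE] := size3_dvd F.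
rewrite card_over U11.
have le9 p q : big F p q -> codeg F p q <= 9 + 0 by move/(codeg_card sF); rewrite U11.
have := @sum_bk_le _ F 9 (fun _ _ => 0) le9; rewrite [X in _ + X]big1 ?addn0.
  by move: lb kE; lia_goal.
by move=> p _; rewrite big1 // => q _; rewrite muln0.
Qed.

(** * Heavy triples of big pairs *)

Section Heavy.
Variable V : finType.
Implicit Types (F : fam V) (p q r s t x y a b : V * bool) (S : {set V * bool}).

Section Books.
Variables (F : fam V) (p q t : V * bool).
Hypotheses (Bpq : big F p q) (Bpt : big F (anti p) t) (Bqt : big F (anti q) (anti t)).

Let W := [set p.1; q.1; t.1].
Let books x := F p q x + F (anti p) t x + F (anti q) (anti t) x.
Let A := [set x | (x.1 \notin W) && (0 < books x)].

Lemma heavy_card : #|W| = 3.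
Proof.
have := big_vx Bpq; have := big_vx Bpt; have := big_vx Bqt => /= qt pt pq.
by rewrite /W -setUA !cardsU1 cards1 !inE negb_or pq pt qt.
Qed.

Let inW : [/\ p.1 \in W, q.1 \in W & t.1 \in W].
Proof. by rewrite !inE !eqxx ?orbT. Qed.

Let Bk := [:: (p, q); (q, p); (anti p, t); (t, anti p); (anti q, anti t); (anti t, anti q)].

(** All six elements over [W] are centres with partners over [W]. As [x] is off [W], [center] puts
    [u] over the partner of [s], and [center] applied at [u] excludes the wrong sign. *)
Lemma heavy_side s u x : s.1 \in W -> F s u x -> x.1 \notin W -> (s, u) \in Bk.
Proof.
have Bqp := Bpq; rewrite bigC in Bqp; have Btp := Bpt; rewrite bigC in Btp.
have Btq := Bqt; rewrite bigC in Btq.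
have c v w : big F v w -> F v u x -> x.1 \notin W -> w.1 \in W -> u = w \/ u = anti w.
  move=> B Fx xW wW; have := center B Fx => /orP[/eqP/vxP //|/eqP e].
  by rewrite e wW in xW.
have mem v : (v.1 \in W) = [|| v.1 == p.1, v.1 == q.1 | v.1 == t.1] by rewrite !inE orbA.
case: inW => pW qW tW sW Fs xW.
(* Both elements of the pair are centres, and their partners must agree. *)
have ctr v w z : big F v w -> F z v x -> x.1 \notin W -> w.1 \in W -> w.1 != z.1 -> False.
  move=> B Fz xW' wW wz; have Fv : F v z x by rewrite triC.
  have := center B Fv; rewrite eq_sym (negPf wz) /= => /eqP e.
  by rewrite e wW in xW'.
have /= pq := big_vx Bpq; have /= pt := big_vx Bpt; have /= qt := big_vx Bqt.
rewrite mem in sW; case/or3P: sW => /eqP e; move: Fs; case: (vxP e) => -> Fs.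
- case: (c _ _ Bpq Fs xW qW) => uE; rewrite uE in Fs *; first by rewrite !inE !eqxx ?orbT.
  by case: (ctr _ _ _ Bqt Fs xW tW); rewrite eq_sym.
- case: (c _ _ Bpt Fs xW tW) => uE; rewrite uE in Fs *; first by rewrite !inE !eqxx ?orbT.
  by case: (ctr _ _ _ Btq Fs xW qW); rewrite eq_sym.
- case: (c _ _ Bqp Fs xW pW) => uE; rewrite uE in Fs *; first by rewrite !inE !eqxx ?orbT.
  by case: (ctr _ _ _ Bpt Fs xW tW); rewrite eq_sym.
- case: (c _ _ Bqt Fs xW tW) => uE; rewrite uE ?antiK in Fs *; first by rewrite !inE !eqxx ?orbT.
  by case: (ctr _ _ _ Btp Fs xW pW).
- case: (c _ _ Btp Fs xW pW) => uE; rewrite uE ?antiK in Fs *; first by rewrite !inE !eqxx ?orbT.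
  by case: (ctr _ _ _ Bpq Fs xW qW).
- case: (c _ _ Btq Fs xW qW) => uE; rewrite uE ?antiK in Fs *; first by rewrite !inE !eqxx ?orbT.
  by case: (ctr _ _ _ Bqp Fs xW pW).
Qed.

Lemma book_vx s u : (s, u) \in Bk -> (s.1 \in W) && (u.1 \in W).
Proof.
case: inW => pW qW tW.
have /allP H : all (fun su => (su.1.1 \in W) && (su.2.1 \in W)) Bk by rewrite /= pW qW tW.
exact: H.
Qed.

Lemma book_page s u x : (s, u) \in Bk -> F s u x -> 0 < books x.
Proof.
have /allP H : all (fun su => F su.1 su.2 x ==> (0 < books x)) Bk.
  rewrite /= /books [F q p x]triC [F t (anti p) x]triC [F (anti t) (anti q) x]triC.
  by case: (F p q x); case: (F (anti p) t x); case: (F (anti q) (anti t) x).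
by move=> /H/implyP.
Qed.

(** Any triple through [x] meets the vertices of the book of which [x] is a page, so it has a
    further element over [W]. *)
Lemma heavy_attached x s u : x \in A -> F x s u -> (s, u) \in Bk.
Proof.
rewrite inE => /andP[xW bx]; case: inW => pW qW tW.
have touch v w : (v.1 \in W) && (w.1 \in W) -> F v w x -> F x s u -> (s.1 \in W) || (u.1 \in W).
  move=> /andP[vW wW]; rewrite -triCA => Fv Fs.
  by have := tri_meet Fv Fs => /or4P[] /eqP->; rewrite ?vW ?wW ?orbT.
move=> Fs; have : (s.1 \in W) || (u.1 \in W).
  move: bx; rewrite /books; case E1: (F p q x); first by rewrite (touch p q) ?pW.
  case E2: (F (anti p) t x); first by rewrite (touch (anti p) t) ?pW.
  case E3: (F (anti q) (anti t) x); first by rewrite (touch (anti q) (anti t)) //= qW.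
  by [].
have Fs' : F s u x by rewrite -triCA.
have Fu' : F u s x by rewrite triC.
case/orP=> sW; first exact: heavy_side sW Fs' xW.
have /allP H : all (fun su => (su.2, su.1) \in Bk) Bk by rewrite /= !inE !eqxx ?orbT.
exact: H (heavy_side sW Fu' xW).
Qed.

Lemma attached_deg x : x \in A -> deg2 F x <= 2 * books x.
Proof.
move=> xA; rewrite deg2E.
apply: leq_trans (_ : #|[seq st <- Bk | F x st.1 st.2]| <= _).
  apply/subset_leq_card/subsetP => -[s u]; rewrite inE mem_filter /= => Fs.
  by rewrite Fs (heavy_attached xA Fs).
apply: leq_trans (card_size _) _; rewrite size_filter /= addn0 /books.
have E s u : (F x s u = F s u x) * (F x u s = F s u x) by rewrite triCA triA triC triA triCA.
by rewrite !(E p q) !(E (anti p) t) !(E (anti q) (anti t)); lia_goal.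
Qed.

Lemma books_opp x : books x + books (anti x) <= 3.
Proof.
have one s u : F s u x + F s u (anti x) <= 1.
  by case E: (F s u x); rewrite ?leq_b1 // (negPf (tri_opp E)).
have := one p q; have := one (anti p) t; have := one (anti q) (anti t); rewrite /books.
lia_goal.
Qed.

Lemma heavy_cover : size3 F <= size3 (restrict F (~: (over W :|: A))) + 24 +
  3 * \sum_(x in A) deg2 F x.
Proof.
apply: leq_trans (@size3_cover _ F (~: (over W :|: A)) (over W) A _) _.
  move=> r s u Fr; have Fs : F s u r by rewrite -triCA.
  have Fu : F u r s by rewrite triCA.
  have part v w y : F v w y -> v.1 \in W -> y.1 \notin W -> (w.1 \in W) && (y \in A).
    move=> Fv vW yW; have k := heavy_side vW Fv yW; have /andP[_ ->] := book_vx k.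
    by rewrite inE yW (book_page k Fv).
  have part' v w y : F v w y -> v.1 \in W -> w.1 \notin W -> (y.1 \in W) && (w \in A).
    by rewrite triA; exact: part.
  have := part _ _ _ Fr; have := part _ _ _ Fs; have := part _ _ _ Fu.
  have := part' _ _ _ Fr; have := part' _ _ _ Fs; have := part' _ _ _ Fu.
  rewrite ![_ \in ~: _]inE ![_ \in over _ :|: _]inE ![_ \in over _]inE.
  case: (r \in A); rewrite ?orbT //; case: (s \in A); rewrite ?orbT //; case: (u \in A); rewrite ?orbT //.
  case: (r.1 \in W); case: (s.1 \in W); case: (u.1 \in W) => //= h1 h2 h3 h4 h5 h6;
    by [have := h1 isT isT | have := h2 isT isT | have := h3 isT isT |
        have := h4 isT isT | have := h5 isT isT | have := h6 isT isT].
by rewrite leq_add2r leq_add2l size3_vertices // heavy_card.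
Qed.

(** For each of the three big pairs at most one sign of a vertex is a page, so both signs together
    have degree at most 2 * 3. *)
Lemma attached_sum : \sum_(x in A) deg2 F x <= 6 * #|[set x.1 | x in A]|.
Proof.
apply: leq_trans (_ : \sum_(x in over [set x.1 | x in A]) 2 * books x <= _).
  rewrite big_mkcond [leqRHS]big_mkcond; apply: leq_sum => x _.
  case: (boolP (x \in A)) => // xA; rewrite inE imset_f //; exact: attached_deg.
have -> : \sum_(x in over [set x.1 | x in A]) 2 * books x =
    \sum_(v in [set x.1 | x in A]) \sum_(e : bool) 2 * books (v, e).
  by rewrite pair_big; apply: eq_big => -[v e] //=; rewrite inE andbT.
rewrite mulnC -sum_nat_const; apply: leq_sum => v _.
by rewrite big_bool /=; have := books_opp (v, true); rewrite /anti /=; lia_goal.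
Qed.

Lemma big_supp S v w : supported F S -> big F v w -> v \in S.
Proof.
move=> sF B; have [r [Fv _ _]] := big_page B v.1 v.1.
exact: sF Fv.
Qed.

Lemma heavy_sub S : supported F S -> over W :|: A \subset S.
Proof.
move=> sF; have Bqp := Bpq; rewrite bigC in Bqp; have Btp := Bpt; rewrite bigC in Btp.
have Btq := Bqt; rewrite bigC in Btq.
apply/subsetP => x; rewrite in_setU => /orP[|]; last first.
  rewrite inE => /andP[_]; rewrite /books.
  have mem s u : F s u x -> x \in S by rewrite -triCA => /sF.
  case E1: (F p q x); first by rewrite (mem _ _ E1).
  case E2: (F (anti p) t x); first by rewrite (mem _ _ E2).
  by case E3: (F (anti q) (anti t) x); rewrite // (mem _ _ E3).
rewrite !inE -!orbA => /or3P[] /eqP/vxP[] ->; apply: (@big_supp S _ _ sF);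
  [exact: Bpq|exact: Bpt|exact: Bqp|exact: Bqt|exact: Btp|exact: Btq].
Qed.

Lemma heavy_disjoint : over W :&: A = set0.
Proof.
apply/setP => x; rewrite in_setI in_set0; apply/andP => -[].
by rewrite [x \in over W]inE [x \in A]inE => ->.
Qed.

Lemma heavy_step S : supported F S ->
  exists2 D : {set V * bool}, #|S :&: D| + 6 + #|A| = #|S| &
    size3 F <= size3 (restrict F D) + 24 + 18 * #|A|.
Proof.
move=> sF; exists (~: (over W :|: A)).
  have := cardsID (over W :|: A) S; rewrite (setIidPr (heavy_sub sF)) setDE => <-.
  by rewrite cardsU heavy_disjoint cards0 card_over heavy_card subn0 [RHS]addnC -addnA.
apply: leq_trans heavy_cover _; rewrite leq_add2l -[18]/(3 * 6) -mulnA leq_mul2l /=.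
apply: leq_trans attached_sum _; rewrite leq_mul2l /=; exact: leq_imset_card.
Qed.

(* When both signs of a vertex are attached, only the positive one is kept. *)
Let A1 := [set x in A | ((x.1, true) \in A) ==> x.2].

Lemma attached_inj : {in A1 &, injective fst}.
Proof.
move=> [v e] [w e'] + + /= vw; rewrite -{w}vw !inE /= => /andP[a i] /andP[a' i'].
by case: e e' a i a' i' => [] [] //= a i a' i'; [rewrite a in i'|rewrite a' in i].
Qed.

Lemma attached_fst : [set x.1 | x in A1] = [set x.1 | x in A].
Proof.
apply/setP => v; apply/imsetP/imsetP => -[x xA ->].
  by exists x => //; move: xA; rewrite inE => /andP[].
have [tA|tA] := boolP ((x.1, true) \in A).
  by exists (x.1, true); rewrite // inE tA.
by exists x; rewrite // inE xA (negPf tA).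
Qed.

(** The cost 18 belongs to a vertex, not to a sign. Charging it to the one-sign set [A1] bounds the
    number of charges by the number of vertices off [W]. *)
Lemma heavy_split_aux (U : {set V}) : supported F (over U) ->
  [/\ W \subset U, A1 \subset over (U :\: W), {in A1 &, injective fst} &
   supported (restrict F (~: (over W :|: A))) (over (U :\: W) :\: A1) /\
   size3 F <= size3 (restrict F (~: (over W :|: A))) + 24 + 18 * #|A1|].
Proof.
move=> sF; have sub := heavy_sub sF; split; last split.
- apply/subsetP => v vW; have := subsetP sub (v, true).
  by rewrite in_setU [_ \in over W]inE vW [_ \in over U]inE; apply.
- apply/subsetP => x; rewrite inE => /andP[xA _]; have := subsetP sub x.
  move: (xA); rewrite inE => /andP[xW _].
  by rewrite in_setU xA orbT [_ \in over U]inE => /(_ isT) xU; rewrite inE in_setD xW.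
- exact: attached_inj.
- move=> r s u /(restrict_supp sF); rewrite in_setI in_setC in_setU negb_or.
  case/and3P; rewrite ![_ \in over _]inE => rU rW rA.
  rewrite in_setD [_ \in over _]inE in_setD rU rW !andbT.
  by apply: contra rA; rewrite inE => /andP[].
apply: leq_trans heavy_cover _; rewrite leq_add2l -[18]/(3 * 6) -mulnA leq_mul2l /=.
apply: leq_trans attached_sum _; rewrite leq_mul2l /= -attached_fst card_in_imset //.
exact: attached_inj.
Qed.

End Books.

(** The constant is 84 = 18 * 6 - 24, since the six elements over [W] cost only 24. In both cases
    the remainder stays within 18 per element. *)
Lemma size_max F S : supported F S ->
  size3 F <= 12 * #|S| /\ ~~ heavy F \/ size3 F + 84 <= 18 * #|S| /\ heavy F.
Proof.
elim: {S}_.+1 {-2}S (ltnSn #|S|) F => // m IH S; rewrite ltnS => Sm F sF.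
have [hF|nH] := boolP (heavy F); last by left; split=> //; exact: size_le nH sF.
right; split=> //; have := hF.
case/existsP=> p /existsP[q /existsP[t /and3P[B B' B'']]].
have [D cS le] := heavy_step B B' B'' sF.
have := IH (S :&: D) _ (restrict F D) (restrict_supp sF).
have -> : #|S :&: D| < m by move: cS Sm; lia_goal.
by case=> // -[h _]; move: le h cS; lia_goal.
Qed.

Lemma heavy_split F (U : {set V}) : heavy F -> supported F (over U) ->
  exists (W : {set V}) (A1 : {set V * bool}) (G : fam V),
  [/\ #|W| = 3 /\ W \subset U, A1 \subset over (U :\: W), {in A1 &, injective fst},
   supported G (over (U :\: W) :\: A1) & size3 F <= size3 G + 24 + 18 * #|A1|].
Proof.
case/existsP=> p /existsP[q /existsP[t /and3P[B B' B'']]] sF.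
have [WU AU Ai [sG le]] := heavy_split_aux B B' B'' sF.
do 3!eexists; split; [|exact: AU|exact: Ai|exact: sG|exact: le].
by split=> //; exact: heavy_card B B' B''.
Qed.

End Heavy.

(** * Designs on six and seven vertices *)

Definition block := (nat * nat * nat)%type.
Definition points (b : block) : seq nat := [:: b.1.1; b.1.2; b.2].
Definition meet (b b' : block) := [seq x <- points b | x \in points b'].

Fixpoint allbits k : seq bitseq :=
  if k is k'.+1 then map (cons true) (allbits k') ++ map (cons false) (allbits k') else [:: [::]].

(* [N] is a list of supports, [h] the points at which only one sign occurs. Two supports meeting exactly in [x] carry opposite constant signs at [x]. *)
Definition signable_at (h : bitseq) (N : seq block) (x : nat) :=
  let Nx := [seq b <- N | x \in points b] in
  if nth false h x then all (fun b => all (fun b' => meet b b' != [:: x]) Nx) Nx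
  else has (fun c => let z := zip Nx c in
    all (fun u => all (fun v => (meet u.1 v.1 == [:: x]) ==> (u.2 != v.2)) z) z) (allbits (size Nx)).

Definition fixed_at (h : bitseq) (N : seq block) (b : block) (x : nat) :=
  nth false h x || has (fun b' => meet b b' == [:: x]) N.

(* Two triples with the same support differ in at least two signs: at most 4, 2, 1 of them exist if 0, 1, at least 2 signs are fixed. *)
Definition capacity (k : nat) := if k is k'.+1 then (if k' is _.+1 then 1 else 2) else 4.

Definition cap (h : bitseq) (N : seq block) (b : block) :=
  capacity (count (fixed_at h N b) (points b)).

(** Each mask of [pl] is a candidate for the set of supports in use. *)
Definition check (h : bitseq) (n : nat) (pl : seq block) (c : nat) :=
  all (fun be => let N := mask be pl in
    if all (signable_at h N) (iota 0 n) then sumn (map (cap h N) N) <= c else true) (allbits (size pl)).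

Definition fano : seq block :=
  [:: (0,1,2); (0,3,4); (0,5,6); (1,3,5); (1,4,6); (2,3,6); (2,4,5)].
Definition rp2 : seq block :=
  [:: (0,1,2); (0,1,3); (0,2,4); (0,3,5); (0,4,5); (1,2,5); (1,3,4); (1,4,5); (2,3,4); (2,3,5)].

(** Fifteen even permutations. As 15 * 7 = 3 * 35, the copies can contain each support three
    times. *)
Definition fano_perms : seq (seq nat) :=
  [:: [:: 0;1;2;3;4;5;6]; [:: 0;1;2;3;5;6;4]; [:: 0;1;2;3;6;4;5]; [:: 0;1;3;2;4;6;5];
      [:: 0;1;3;2;5;4;6]; [:: 0;1;3;2;6;5;4]; [:: 0;1;4;2;3;5;6]; [:: 0;1;4;2;5;6;3];
      [:: 0;1;4;2;6;3;5]; [:: 0;1;5;2;3;6;4]; [:: 0;1;5;2;4;3;6]; [:: 0;1;5;2;6;4;3];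
      [:: 0;1;6;2;3;4;5]; [:: 0;1;6;2;4;5;3]; [:: 0;1;6;2;5;3;4]].
Definition rp2_perms : seq (seq nat) := [:: [:: 0;1;2;3;4;5]; [:: 0;1;4;5;3;2]].

Definition orders (b : block) : seq block := let: (i, j, k) := b in
  [:: (i,j,k); (i,k,j); (j,i,k); (j,k,i); (k,i,j); (k,j,i)].
Definition relabel (s : seq nat) (b : block) : block :=
  (nth 0 s b.1.1, nth 0 s b.1.2, nth 0 s b.2).
Definition triples n : seq block :=
  [seq b <- [seq (ij.1, ij.2, k) | ij <- [seq (i, j) | i <- iota 0 n, j <- iota 0 n], k <- iota 0 n] |
    uniq (points b)].
(** Blocks are ordered, so a block is expanded to its six orders before the multisets are
    compared. *)
Definition covers n (ps : seq (seq nat)) (pl : seq block) (l : nat) :=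
  perm_eq (flatten [seq flatten [seq orders (relabel s b) | b <- pl] | s <- ps])
          (flatten (nseq l (triples n))).

Lemma mem_allbits (c : bitseq) : c \in allbits (size c).
Proof.
elim: c => [|[] c IH] //=; rewrite mem_cat ?(map_f (cons true)) //.
by rewrite orbC (map_f (cons false)).
Qed.

Lemma fano_check : check (nseq 7 false) 7 fano 4. Proof. by vm_compute. Qed.
Lemma fano_check2 : all (fun h => check h 7 fano 2) [seq h <- allbits 7 | 5 <= count id h].
Proof. by vm_compute. Qed.
Lemma fano_check1 : check (nseq 7 true) 7 fano 1. Proof. by vm_compute. Qed.
Lemma rp2_check : check (nseq 6 false) 6 rp2 8. Proof. by vm_compute. Qed.
Lemma fano_covers : covers 7 fano_perms fano 3. Proof. by vm_compute. Qed.
Lemma rp2_covers : covers 6 rp2_perms rp2 1. Proof. by vm_compute. Qed.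

Section Design.
Variables (V : finType) (F : fam V) (n : nat) (h : bitseq).

Definition pat (e : nat -> V) (b : block) (s t u : bool) :=
  F (e b.1.1, s) (e b.1.2, t) (e b.2, u).
Definition mult (e : nat -> V) (b : block) : nat :=
  \sum_(s : bool) \sum_(t : bool) \sum_(u : bool) pat e b s t u.

Section Plane.
Variables (e : nat -> V).
Hypothesis e_inj : forall i j, i < n -> j < n -> e i = e j -> i = j.
Hypothesis eh : forall i, i < n -> nth false h i -> exists c, forall s p q, F (e i, s) p q -> s = c.

Definition inside (b : block) := all (fun i => i < n) (points b).

Definition sign_at (b : block) (x : nat) : bool -> bool -> bool -> bool := fun s t u =>
  if x == b.1.1 then s else if x == b.1.2 then t else u.

Lemma pat_sign b x s t u : x \in points b -> pat e b s t u ->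
  exists y z v w, [/\ y \in points b, z \in points b, y != x, z != x &
    F (e x, sign_at b x s t u) (e y, v) (e z, w)].
Proof.
case: b => [[i j] k]; rewrite /sign_at /pat !inE /= => xb Fb.
have [ij ik jk] := tri_vx3 Fb; rewrite /= in ij ik jk.
have nij : (i == j) = false by apply: contraNF ij => /eqP ->.
have nik : (i == k) = false by apply: contraNF ik => /eqP ->.
have njk : (j == k) = false by apply: contraNF jk => /eqP ->.
case/or3P: xb => /eqP ->; rewrite ?eqxx.
- by exists j, k, t, u; split; rewrite // ?inE ?eqxx ?orbT // eq_sym ?nij ?nik.
- rewrite [j == i]eq_sym nij; exists i, k, s, u.
  by split; rewrite 1?triC // ?inE ?eqxx ?orbT ?nij // eq_sym njk.
rewrite ![k == _]eq_sym nik njk; exists i, j, s, t.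
by split; rewrite ?inE ?eqxx ?orbT ?nik ?njk // triCA.
Qed.

Lemma meet_sign b b' x s t u s' t' u' : inside b -> inside b' -> meet b b' = [:: x] ->
  pat e b s t u -> pat e b' s' t' u' -> sign_at b x s t u != sign_at b' x s' t' u'.
Proof.
move=> ib ib' mx Fb Fb'; have : x \in meet b b' by rewrite mx inE.
rewrite mem_filter => /andP[xb' xb].
have [y [z [v [w [yb zb yx zx Fx]]]]] := pat_sign xb Fb.
have [y' [z' [v' [w' [yb' zb' _ _ Fx']]]]] := pat_sign xb' Fb'.
apply/eqP => E; rewrite E in Fx.
have no i j : i \in points b -> j \in points b' -> i != x -> e j == e i -> False.
  move=> ii jj ix /eqP eij; have ij := e_inj (allP ib' _ jj) (allP ib _ ii) eij; subst j.
  have : i \in meet b b' by rewrite mem_filter jj ii.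
  by rewrite mx inE (negPf ix).
have /= := tri_meet Fx Fx'.
by case/or4P; [exact: no yb yb' yx|exact: no zb yb' zx|exact: no yb zb' yx|exact: no zb zb' zx].
Qed.

Lemma sign_half b x : inside b -> x \in points b -> nth false h x ->
  exists c, forall s t u, pat e b s t u -> sign_at b x s t u = c.
Proof.
move=> ib xb hx; have xn : x < n := allP ib x xb.
have [c cP] := eh xn hx; exists c => s t u Fb.
by have [y [z [v [w [_ _ _ _ Fx]]]]] := pat_sign xb Fb; exact: cP Fx.
Qed.

Lemma mult_gt0 b : 0 < mult e b -> exists s t u, pat e b s t u.
Proof.
rewrite lt0n /mult sum_nat_eq0 negb_forall => /existsP[s]; rewrite sum_nat_eq0 negb_forall.
case/existsP=> t; rewrite sum_nat_eq0 negb_forall => /existsP[u]; rewrite eqb0 negbK.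
by exists s, t, u.
Qed.

(** The sign vectors of a support form a set without adjacent points in the 3-cube, and each fixed
    sign confines it to a face. *)
Lemma bits_bound (f : bool -> bool -> bool -> bool) (k1 k2 k3 : bool) :
  (forall s t u, f s t u -> [&& ~~ f (~~ s) t u, ~~ f s (~~ t) u & ~~ f s t (~~ u)]) ->
  (k1 -> exists c, forall s t u, f s t u -> s = c) ->
  (k2 -> exists c, forall s t u, f s t u -> t = c) ->
  (k3 -> exists c, forall s t u, f s t u -> u = c) ->
  \sum_(s : bool) \sum_(t : bool) \sum_(u : bool) f s t u <= capacity (k1 + k2 + k3).
Proof.
move=> adj h1 h2 h3; rewrite !big_bool /=.
have a s t u : f s t u ==> [&& ~~ f (~~ s) t u, ~~ f s (~~ t) u & ~~ f s t (~~ u)].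
  by apply/implyP; exact: adj.
have {}h1 : [exists c, k1 ==> [forall s, forall t, forall u, f s t u ==> (s == c)]].
  case: k1 h1 => [[//|c cP]|_]; last by apply/existsP; exists true.
  by apply/existsP; exists c; do 3![apply/forallP=> ?]; apply/implyP => /cP ->.
have {}h2 : [exists c, k2 ==> [forall s, forall t, forall u, f s t u ==> (t == c)]].
  case: k2 h2 => [[//|c cP]|_]; last by apply/existsP; exists true.
  by apply/existsP; exists c; do 3![apply/forallP=> ?]; apply/implyP => /cP ->.
have {}h3 : [exists c, k3 ==> [forall s, forall t, forall u, f s t u ==> (u == c)]].
  case: k3 h3 => [[//|c cP]|_]; last by apply/existsP; exists true.
  by apply/existsP; exists c; do 3![apply/forallP=> ?]; apply/implyP => /cP ->.
have ex (P : pred bool) : [exists c, P c] = P true || P false.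
  by apply/existsP/orP => [[[] ?]|[]]; [left|right|exists true|exists false].
have fa (P : pred bool) : [forall c, P c] = P true && P false.
  by apply/forallP/andP => [H|[? ?] []].
move: (a true true true) (a true true false) (a true false true) (a true false false).
move: (a false true true) (a false true false) (a false false true) (a false false false).
move: h1 h2 h3; rewrite !ex !fa /= => {a adj ex fa}.
case: (f true true true); case: (f true true false); case: (f true false true) => //=;
case: (f true false false); case: (f false true true); case: (f false true false) => //=;
case: (f false false true); case: (f false false false) => //=;
by case: k1; case: k2; case: k3.
Qed.

Lemma pat_uniq b s t u : pat e b s t u -> uniq (points b).
Proof.
case: b => [[i j] k]; rewrite /pat /= => /tri_vx3[/= ij ik jk].
have ne x y : e x != e y -> x != y by apply: contraNneq => ->.
by rewrite !inE negb_or !ne.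
Qed.

Section Supports.
Variable pl : seq block.
Hypothesis ipl : all inside pl.
Let N := [seq b <- pl | 0 < mult e b].

Lemma supports_pat b : b \in N -> inside b /\ exists s t u, pat e b s t u.
Proof. by rewrite mem_filter => /andP[/mult_gt0 p /(allP ipl)]. Qed.

Lemma supports_sign b b' x : b \in N -> b' \in N -> meet b b' = [:: x] ->
  exists c, forall s t u, pat e b s t u -> sign_at b x s t u = c.
Proof.
move=> /supports_pat[ib _] /supports_pat[ib' [s' [t' [u' Fb']]]] mx.
exists (~~ sign_at b' x s' t' u') => s t u Fb.
have := meet_sign ib ib' mx Fb Fb'.
by case: (sign_at b x s t u); case: (sign_at b' x s' t' u').
Qed.

Lemma mult_cap b : b \in N -> mult e b <= cap h N b.
Proof.
move=> bN; have [ib [s0 [t0 [u0 F0]]]] := supports_pat bN.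
have fx x : x \in points b -> fixed_at h N b x ->
    exists c, forall s t u, pat e b s t u -> sign_at b x s t u = c.
  move=> xb /orP[hx|/hasP[b' b'N /eqP mx]]; first exact: sign_half.
  exact: supports_sign bN b'N mx.
have := pat_uniq F0; rewrite /= !inE negb_or andbT => /andP[/andP[ij ik] jk].
rewrite /cap /= addn0 addnA; apply: bits_bound.
- move=> s t u; rewrite /pat => Fb; apply/and3P; split.
  + by move: Fb; rewrite !(triCA F (_, s)) !(triCA F (_, ~~ s)) => /tri_opp.
  + by rewrite triA; move: Fb; rewrite triA => /tri_opp.
  exact: (tri_opp Fb).
- move=> /fx[|c cP]; first by rewrite inE eqxx.
  by exists c => s t u /cP; rewrite /sign_at eqxx.
- move=> /fx[|c cP]; first by rewrite !inE eqxx orbT.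
  by exists c => s t u /cP; rewrite /sign_at eqxx eq_sym (negPf ij).
move=> /fx[|c cP]; first by rewrite !inE eqxx !orbT.
by exists c => s t u /cP; rewrite /sign_at ![b.2 == _]eq_sym (negPf ik) (negPf jk).
Qed.

Lemma supports_signable x : x < n -> signable_at h N x.
Proof.
move=> xn; rewrite /signable_at; set Nx := [seq b <- N | _].
have NxP b : b \in Nx -> b \in N /\ x \in points b by rewrite mem_filter => /andP[].
case: (boolP (nth false h x)) => hx.
  apply/allP => b /NxP[bN xb]; apply/allP => b' /NxP[b'N xb']; apply/eqP => mx.
  have [ib [s [t [u Fb]]]] := supports_pat bN; have [ib' [s' [t' [u' Fb']]]] := supports_pat b'N.
  have [c cP] := eh xn hx.
  have [y [z [v [w [_ _ _ _ Fx]]]]] := pat_sign xb Fb.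
  have [y' [z' [v' [w' [_ _ _ _ Fx']]]]] := pat_sign xb' Fb'.
  by have := meet_sign ib ib' mx Fb Fb'; rewrite (cP _ _ _ Fx) (cP _ _ _ Fx') eqxx.
(* For supports that meet another one only in [x] the sign at [x] is constant, so this choice is the
   right one; for the remaining supports any value would do. *)
pose sgn b := [exists s, exists t, exists u, pat e b s t u && sign_at b x s t u].
apply/hasP; exists (map sgn Nx); first by rewrite -(size_map sgn) mem_allbits.
have -> : zip Nx (map sgn Nx) = [seq (b, sgn b) | b <- Nx].
  by elim: Nx {NxP} => //= b l ->.
apply/allP => _ /mapP[b /NxP[bN xb] ->]; apply/allP => _ /mapP[b' /NxP[b'N xb'] ->] /=.
apply/implyP => /eqP mx; apply/eqP => E.
have [ib [s [t [u Fb]]]] := supports_pat bN; have [ib' [s' [t' [u' Fb']]]] := supports_pat b'N.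
have [/existsP[s1 /existsP[t1 /existsP[u1 /andP[F1 g1]]]]|no] := boolP (sgn b).
  have : sgn b' by rewrite -E; apply/existsP; exists s1; apply/existsP; exists t1;
    apply/existsP; exists u1; rewrite F1.
  case/existsP=> s2 /existsP[t2 /existsP[u2 /andP[F2 g2]]].
  by have := meet_sign ib ib' mx F1 F2; rewrite g1 g2.
have sgnI b1 s1 t1 u1 : ~~ sgn b1 -> pat e b1 s1 t1 u1 -> sign_at b1 x s1 t1 u1 = false.
  move=> ns F1; apply: contraNF ns => g1; apply/existsP; exists s1; apply/existsP; exists t1.
  by apply/existsP; exists u1; rewrite F1.
have no' : ~~ sgn b' by rewrite -E.
by have := meet_sign ib ib' mx Fb Fb'; rewrite (sgnI b) // (sgnI b').
Qed.

Lemma plane_bound c : check h n pl c -> \sum_(b <- pl) mult e b <= c.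
Proof.
have mb : map (fun b => 0 < mult e b) pl \in allbits (size pl).
  by rewrite -(size_map (fun b => 0 < mult e b) pl) mem_allbits.
move=> /allP/(_ _ mb); rewrite /= -filter_mask -/N.
have -> : all (signable_at h N) (iota 0 n).
  by apply/allP => x; rewrite mem_iota => /supports_signable.
apply: leq_trans; rewrite (bigID (fun b => 0 < mult e b)) /= [X in _ + X]big1 ?addn0.
  rewrite -big_filter -/N sumnE big_map; rewrite big_seq [leqRHS]big_seq.
  by apply: leq_sum => b; exact: mult_cap.
by move=> b; rewrite -eqn0Ngt => /eqP.
Qed.

End Supports.
End Plane.

Variable e : nat -> V.
Hypothesis e_inj : forall i j, i < n -> j < n -> e i = e j -> i = j.
Hypothesis eh : forall i, i < n -> nth false h i -> exists c, forall s p q, F (e i, s) p q -> s = c.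
Hypothesis eF : forall p q r, F p q r -> exists2 i, i < n & p.1 = e i.

Lemma sum_index (f : V -> nat) : (forall v, (forall i, i < n -> v <> e i) -> f v = 0) ->
  \sum_v f v = \sum_(i <- iota 0 n) f (e i).
Proof.
move=> f0; rewrite -(big_map e predT f) /= [RHS]big_uniq; last first.
  rewrite map_inj_in_uniq ?iota_uniq // => i j; rewrite !mem_iota /= => ? ?.
  exact: e_inj.
rewrite [LHS](bigID (mem [seq e i | i <- iota 0 n])) /= [X in _ + X]big1 ?addn0 // => v vn.
by apply: f0 => i i_n vE; case/mapP: vn; exists i; rewrite ?mem_iota.
Qed.

Lemma size3_index : size3 F = \sum_(b <- triples n) mult e b.
Proof.
have eF2 p q r : F p q r -> exists2 i, i < n & q.1 = e i by rewrite triC => /eF.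
have eF3 p q r : F p q r -> exists2 i, i < n & r.1 = e i by rewrite -triCA => /eF.
have split2 (f : V * bool -> nat) : \sum_p f p = \sum_v \sum_(s : bool) f (v, s).
  by rewrite pair_big; apply: eq_bigr => -[].
pose M v w x : nat := \sum_(s : bool) \sum_(t : bool) \sum_(u : bool) F (v, s) (w, t) (x, u).
have M0 v w x : (forall s t u, F (v, s) (w, t) (x, u) = false) -> M v w x = 0.
  by move=> f0; do 3![apply: big1 => ? _]; rewrite f0.
have -> : size3 F = \sum_v \sum_w \sum_x M v w x.
  rewrite size3E split2; apply: eq_bigr => v _.
  transitivity (\sum_(s : bool) \sum_w \sum_(t : bool) \sum_r F (v, s) (w, t) r).
    by apply: eq_bigr => s _; exact: split2.
  rewrite exchange_big; apply: eq_bigr => w _ /=.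
  transitivity (\sum_(s : bool) \sum_x \sum_(t : bool) \sum_(u : bool) F (v, s) (w, t) (x, u)).
    apply: eq_bigr => s _; rewrite [RHS]exchange_big.
    by apply: eq_bigr => t _; exact: split2.
  by rewrite exchange_big.
rewrite sum_index => [|v vn]; last first.
  by do 2![apply: big1 => ? _]; apply: M0 => s t u; apply/negP => /eF[i /vn].
rewrite /triples big_filter [RHS]big_mkcond big_allpairs_dep /= big_allpairs_dep /=.
apply: eq_bigr => i _; rewrite sum_index => [|v vn]; last first.
  by apply: big1 => ? _; apply: M0 => s t u; apply/negP => /eF2[j /vn].
apply: eq_bigr => j _; rewrite sum_index => [|v vn]; last first.
  by apply: M0 => s t u; apply/negP => /eF3[k /vn].
apply: eq_bigr => k _; case: ifP => // nu; apply: M0 => s t u; apply: contraFF nu => Fb.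
by have := @pat_uniq e (i, j, k) s t u; rewrite /pat /= => /(_ Fb).
Qed.

Lemma mult_orders (b b' : block) : b' \in orders b -> mult e b' = mult e b.
Proof.
have sw1 i j k : mult e (i, j, k) = mult e (j, i, k).
  by rewrite /mult exchange_big; do 3![apply: eq_bigr => ? _]; rewrite /pat /= triC.
have sw2 i j k : mult e (i, j, k) = mult e (i, k, j).
  rewrite /mult; apply: eq_bigr => s _; rewrite exchange_big.
  by do 2![apply: eq_bigr => ? _]; rewrite /pat /= triA.
case: b => [[i j] k]; rewrite !inE => /orP[/eqP-> //|/orP[/eqP->|/orP[/eqP->|/orP[/eqP->|/orP[]/eqP->]]]].
- exact: sw2.
- exact: sw1.
- by rewrite sw2 sw1.
- by rewrite sw1 sw2.
by rewrite sw2 sw1 sw2.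
Qed.

End Design.

(** [plane_bound] is summed over the copies. The check is made for each relabelling, because the
    points with one sign move relative to the plane. The factor 6 counts the orders of a block. *)
Lemma design_bound (V : finType) (F : fam V) (n : nat) (h : bitseq) (e : nat -> V)
    (ps : seq (seq nat)) (pl : seq block) (l c : nat) :
  (forall i j, i < n -> j < n -> e i = e j -> i = j) ->
  (forall i, i < n -> nth false h i -> exists c, forall s p q, F (e i, s) p q -> s = c) ->
  (forall p q r, F p q r -> exists2 i, i < n & p.1 = e i) ->
  all (inside n) pl -> all (perm_eq (iota 0 n)) ps ->
  all (fun s => check [seq nth false h i | i <- s] n pl c) ps -> covers n ps pl l ->
  l * size3 F <= 6 * (size ps * c).
Proof.
move=> e_inj eh eF ipl pps chk cov; rewrite (size3_index e_inj eF).
have -> : l * \sum_(b <- triples n) mult F e b = \sum_(b <- flatten (nseq l (triples n))) mult F e b.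
  elim: l {cov} => [|l IH]; first by rewrite big_nil.
  by rewrite mulSn IH /= big_cat.
rewrite -(perm_big _ cov) /= big_flatten big_map.
have six s : \sum_(b <- flatten [seq orders (relabel s b) | b <- pl]) mult F e b =
    6 * \sum_(b <- pl) mult F (fun i => e (nth 0 s i)) b.
  rewrite big_flatten big_map big_distrr; apply: eq_bigr => b _ /=.
  rewrite (eq_big_seq (fun=> mult F e (relabel s b))) => [|b' ib]; last exact: (@mult_orders _ F e (relabel s b) b' ib).
  by rewrite big_const_seq count_predT iter_addn_0 mulnC.
under eq_bigr do rewrite six; rewrite -big_distrr leq_mul2l /=.
apply: leq_trans (_ : \sum_(s <- ps) c <= _); last first.
  by rewrite big_const_seq count_predT iter_addn_0 mulnC.
rewrite big_seq [leqRHS]big_seq; apply: leq_sum => s sps.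
have ns := allP pps s sps; have ss : size s = n by rewrite -(perm_size ns) size_iota.
have sn i : i < n -> nth 0 s i < n.
  by move=> i_n; have := mem_nth 0 (_ : i < size s); rewrite ss -(perm_mem ns) mem_iota; apply.
have us : uniq s by rewrite -(perm_uniq ns) iota_uniq.
apply: (plane_bound _ _ ipl (allP chk s sps)).
- move=> i j i_n j_n /(e_inj _ _ (sn i i_n) (sn j j_n)) /eqP.
  by rewrite nth_uniq ?ss // => /eqP.
- move=> i i_n; rewrite (nth_map 0) ?ss // => hi.
  exact: eh (sn i i_n) hi.
Qed.

(** * Families on six to nine vertices *)

Section Small.
Variable V : finType.
Implicit Types (F : fam V) (U : {set V}) (S : {set V * bool}).

Lemma supp_vertex F U S p q r : supported F S -> S \subset over U -> F p q r -> p.1 \in U.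
Proof. by move=> sF SU /sF/(subsetP SU); rewrite inE. Qed.

Section Enum.
Variables (F : fam V) (U : {set V}) (S : {set V * bool}) (v0 : V).
Hypotheses (sF : supported F S) (SU : S \subset over U).

Lemma enum_inj i j : i < #|U| -> j < #|U| -> nth v0 (enum U) i = nth v0 (enum U) j -> i = j.
Proof.
rewrite cardE => i_n j_n /eqP; rewrite nth_uniq ?enum_uniq //.
by move/eqP.
Qed.

Lemma enum_supp p q r : F p q r -> exists2 i, i < #|U| & p.1 = nth v0 (enum U) i.
Proof.
move=> /(supp_vertex sF SU) pU; exists (index p.1 (enum U)).
  by rewrite cardE index_mem mem_enum.
by rewrite nth_index ?mem_enum.
Qed.

End Enum.

Lemma map_false n s : size s = n -> [seq nth false (nseq n false) i | i <- s] = nseq n false.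
Proof.
move=> sn; apply: (@eq_from_nth _ false); rewrite size_map ?size_nseq ?sn // => i i_n.
by rewrite (nth_map 0) ?sn // !nth_nseq i_n; case: ifP.
Qed.

End Small.

Lemma size3_empty (V : finType) (F : fam V) : (forall p q r, F p q r = false) -> size3 F = 0.
Proof. by move=> F0; rewrite size3E; do 3![apply: big1 => ? _]; rewrite F0. Qed.

Lemma design_size_bound (n l c m : nat) ps pl : 0 < n ->
  all (inside n) pl -> all (perm_eq (iota 0 n)) ps -> covers n ps pl l ->
  check (nseq n false) n pl c -> (forall N, l * N <= 6 * (size ps * c) -> N <= 6 * m) -> size_bound n m.
Proof.
move=> n0 ipl pps cov chk num V F U sF Un; apply: num.
have [v0 v0U] : exists v, v \in U by apply/set0Pn; rewrite -card_gt0 Un.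
apply: (@design_bound _ F n (nseq n false) (nth v0 (enum U)) ps pl l c _ _ _ ipl pps _ cov).
- by rewrite -Un; exact: enum_inj.
- by move=> i i_n; rewrite nth_nseq i_n.
- by rewrite -Un; move=> p q r; exact: enum_supp sF (subxx _) p q r.
apply/allP => s sps; rewrite map_false //.
by rewrite -(perm_size (allP pps s sps)) size_iota.
Qed.

Lemma bound6 : size_bound 6 16.
Proof.
apply: (@design_size_bound 6 1 8 16 rp2_perms rp2 isT _ _ rp2_covers rp2_check) => //= N.
by lia.
Qed.

Lemma bound7 : size_bound 7 20.
Proof.
apply: (@design_size_bound 7 3 4 20 fano_perms fano isT _ _ fano_covers fano_check) => //= N.
by lia.
Qed.

Section Halves.
Variable V : finType.
Implicit Types (F : fam V) (U : {set V}) (S : {set V * bool}).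

(** The filtered set collects the vertices with at most one sign in [S]. The factor is 30 = 6 * 15 /
    3 for fifteen planes and threefold covering. *)
Lemma half_bound F U S c : supported F S -> S \subset over U -> #|U| = 7 ->
  (forall h, size h = 7 -> count id h = #|[set v in U | ((v, true) \in S) ==> ((v, false) \notin S)]| ->
     check h 7 fano c) -> size3 F <= 30 * c.
Proof.
move=> sF SU U7 chk; set H := [set v in U | _] in chk.
have [v0 v0U] : exists v, v \in U by apply/set0Pn; rewrite -card_gt0 U7.
have szU : size (enum U) = 7 by rewrite -cardE.
pose h := [seq v \in H | v <- enum U].
have hH : count id h = #|H|.
  rewrite count_map -size_filter cardE; apply/perm_size/uniq_perm; [exact/filter_uniq/enum_uniq|exact: enum_uniq|].
  by move=> v; rewrite mem_filter !mem_enum /= andb_idr // inE => /andP[].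
have eh i : i < 7 -> nth false h i ->
    exists d, forall s p q, F (nth v0 (enum U) i, s) p q -> s = d.
  move=> i_n; rewrite (nth_map v0) ?szU // inE => /andP[_ hv].
  case: (boolP ((nth v0 (enum U) i, true) \in S)) hv => /= [_ f|t _].
    by exists true => -[] p q // /sF f'; rewrite f' in f.
  by exists false => -[] p q // /sF t'; rewrite t' in t.
have e_inj : forall i j, i < 7 -> j < 7 -> nth v0 (enum U) i = nth v0 (enum U) j -> i = j.
  by rewrite -U7; exact: enum_inj.
have eF p q r : F p q r -> exists2 i, i < 7 & p.1 = nth v0 (enum U) i.
  by rewrite -U7; exact: enum_supp sF SU p q r.
have chk' : all (fun s => check [seq nth false h i | i <- s] 7 fano c) fano_perms.
  apply/allP => s /(allP (isT : all (perm_eq (iota 0 7)) fano_perms)) ps.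
  apply: chk; first by rewrite size_map -(perm_size ps).
  have sh : size h = 7 by rewrite size_map szU.
  have pm : perm_eq [seq nth false h i | i <- iota 0 7] [seq nth false h i | i <- s].
    exact: perm_map.
  by rewrite -hH -(permP pm) -{1}sh map_nth_iota0 // take_size.
have := @design_bound _ F 7 h _ fano_perms fano 3 c e_inj eh eF isT isT chk' fano_covers.
rewrite (_ : 6 * _ = 3 * (30 * c)); last by rewrite (_ : size fano_perms = 15) //; lia.
by rewrite leq_mul2l.
Qed.

Lemma half5 F U (A : {set V * bool}) : supported F (over U :\: A) -> A \subset over U ->
  {in A &, injective fst} -> #|U| = 7 -> 5 <= #|A| -> size3 F <= 60.
Proof.
move=> sF AU Ai U7 A5; apply: (@half_bound F U _ 2 sF (subsetDl _ _) U7) => h h7 hc.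
have /allP := fano_check2; apply; rewrite mem_filter.
have -> : h \in allbits 7 by rewrite -h7 mem_allbits.
rewrite andbT hc.
apply: leq_trans A5 _; rewrite -(card_in_imset Ai); apply/subset_leq_card/subsetP => v.
case/imsetP=> -[w e] wA ->; have := subsetP AU _ wA; rewrite !inE /= => ->.
by case: e wA => ->; rewrite //= implybT.
Qed.

Lemma half7 F U S : supported F S -> S \subset over U -> #|U| = 7 -> {in S &, injective fst} ->
  size3 F <= 30.
Proof.
move=> sF SU U7 Si; have := @half_bound F U S 1 sF SU U7; rewrite muln1; apply=> h h7.
rewrite (_ : [set v in U | _] = U); last first.
  apply/setP => v; rewrite inE andb_idr // => _; apply/implyP => t; apply/negP => f.
  by have := Si _ _ t f erefl.
rewrite U7 -h7 => hc; have : all id h by rewrite all_count hc.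
rewrite (eq_all (a2 := pred1 true)) => [/all_pred1P ->|[]//].
by rewrite h7; exact: fano_check1.
Qed.

(** A triple survives the deletion of every vertex except its own three. *)
Lemma size3_average F U c : supported F (over U) ->
  (forall v, v \in U -> size3 (restrict F (~: over [set v])) <= c) ->
  (#|U| - 3) * size3 F <= #|U| * c.
Proof.
move=> sF le; apply: leq_trans (_ : \sum_(v in U) size3 (restrict F (~: over [set v])) <= _); last first.
  by rewrite -sum_nat_const; exact: leq_sum.
under [leqRHS]eq_bigr do rewrite size3E.
rewrite size3E [leqRHS]exchange_big big_distrr; apply: leq_sum => p _ /=.
rewrite [leqRHS]exchange_big big_distrr; apply: leq_sum => q _ /=.
rewrite [leqRHS]exchange_big big_distrr; apply: leq_sum => r _ /=.
case: (boolP (F p q r)) => Fp; last by rewrite muln0.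
have [pU qU rU] := supp_over sF Fp; have [pq pr qr] := tri_vx3 Fp.
apply: leq_trans (_ : \sum_(v in U :\: [set p.1; q.1; r.1]) 1 <= _).
  rewrite sum1_card muln1 cardsD (setIidPr _); last first.
    by apply/subsetP => v; rewrite !inE -orbA => /or3P[] /eqP ->.
  by rewrite -setUA !cardsU1 cards1 !inE negb_or pq pr qr.
rewrite [leqLHS]big_mkcond [leqRHS]big_mkcond; apply: leq_sum => v _.
rewrite !inE restrictE Fp !inE -!orbA !negb_or ![v == _]eq_sym.
by case: (p.1 == v); case: (q.1 == v); case: (r.1 == v); case: (v \in U).
Qed.

Lemma supp_minus F U v : supported F (over U) ->
  supported (restrict F (~: over [set v])) (over (U :\ v)).
Proof. by move=> sF p q r /(restrict_supp sF); rewrite !inE andbC. Qed.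

Lemma card_minus U v n : #|U| = n.+1 -> v \in U -> #|U :\ v| = n.
Proof. by move=> Un vU; have := cardsD1 v U; rewrite vU Un => -[]. Qed.

Lemma thin_step F U S n c d : supported F S -> S \subset over U -> #|U| = n.+1 ->
  {in S &, injective fst} ->
  (forall G U' S', supported G S' -> S' \subset over U' -> #|U'| = n -> {in S' &, injective fst} ->
     size3 G <= c) -> (forall N, (n.+1 - 3) * N <= n.+1 * c -> N <= d) -> size3 F <= d.
Proof.
move=> sF SU Un Si IH; apply; rewrite -Un; apply: size3_average => [p q r /sF/(subsetP SU)//|v vU].
apply: (IH _ (U :\ v) (S :&: ~: over [set v]) (restrict_supp sF)); last 2 first.
- exact: card_minus Un vU.
- by move=> x y; rewrite !inE => /andP[xS _] /andP[yS _]; exact: Si.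
apply/subsetP => x; rewrite !inE => /andP[/(subsetP SU)]; rewrite inE => -> ->.
by [].
Qed.

Lemma half8 F U S : supported F S -> S \subset over U -> #|U| = 8 -> {in S &, injective fst} ->
  size3 F <= 48.
Proof.
move=> sF SU U8 Si; apply: (thin_step (c := 30) sF SU U8 Si) => [|N]; last by lia.
exact: half7.
Qed.

Lemma half9 F U S : supported F S -> S \subset over U -> #|U| = 9 -> {in S &, injective fst} ->
  size3 F <= 72.
Proof.
move=> sF SU U9 Si; apply: (thin_step (c := 48) sF SU U9 Si) => [|N]; last by lia.
exact: half8.
Qed.

End Halves.

Lemma bound8 : size_bound 8 32.
Proof.
move=> V F U sF U8; have := @size3_average _ F U 120 sF; rewrite U8 => le.
suff /le : forall v, v \in U -> size3 (restrict F (~: over [set v])) <= 120 by lia.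
by move=> v vU; exact: bound7 (supp_minus sF) (card_minus U8 vU).
Qed.

(** * The upper bound *)

Section Complement.
Variables (V : finType) (F : fam V) (U : {set V}) (A : {set V * bool}).
Hypotheses (sF : supported F (over U :\: A)) (AU : A \subset over U) (Ai : {in A &, injective fst}).

Lemma card_inj : #|A| <= #|U|.
Proof.
rewrite -(card_in_imset Ai); apply/subset_leq_card/subsetP => _ /imsetP[x /(subsetP AU) + ->].
by rewrite inE.
Qed.

Lemma card_compl : #|over U :\: A| + #|A| = 2 * #|U|.
Proof. by rewrite cardsD (setIidPr AU) card_over subnK // -card_over subset_leq_card. Qed.

Lemma compl_opp x : x.1 \in [set y.1 | y in A] -> x \in over U :\: A -> anti x \notin over U :\: A.
Proof.
case/imsetP=> y yA /vxP[->|e] xS; first by rewrite inE yA in xS.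
by rewrite inE e antiK yA.
Qed.

Lemma thin_compl : #|A| = #|U| -> {in over U :\: A &, injective fst}.
Proof.
move=> eA; have UE : [set y.1 | y in A] = U.
  apply/eqP; rewrite eqEcard (card_in_imset Ai) eA leqnn andbT.
  by apply/subsetP => _ /imsetP[x /(subsetP AU) + ->]; rewrite inE.
move=> x y xS yS /vxP[//|e]; have xU : x.1 \in [set y.1 | y in A].
  by rewrite UE; move: xS; rewrite in_setD inE => /andP[].
by have := compl_opp xU xS; rewrite e antiK yS.
Qed.

Lemma size3_set0 : size3 (restrict F set0) = 0.
Proof. by apply: size3_empty => p q r; rewrite restrictE in_set0 andbF. Qed.

Hypotheses (U8 : #|U| = 8) (A7 : #|A| = 7).

(** Only one vertex [f] can have both signs in the support, and the triples off [f] give at most 30.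
    If the two signs of [f] have total degree at most 16, the sum is at most 30 + 3 * 16 = 78.
    Otherwise one of them has degree above 8, which forces every triple through [f], and 3 (12 + 12)
    = 72 is a bound. *)
Lemma one_full : size3 F <= 78.
Proof.
pose B := [set y.1 | y in A].
have B7 : #|B| = 7 by rewrite card_in_imset.
have BU : B \subset U by apply/subsetP => _ /imsetP[x /(subsetP AU) + ->]; rewrite inE.
have [f fE] : exists f, U :\: B = [set f].
  by apply/cards1P; rewrite cardsD (setIidPr BU) U8 B7.
have inB v : v \in U -> v != f -> v \in B.
  move=> vU vf; apply: contraT => vB; have : v \in U :\: B by rewrite inE vB vU.
  by rewrite fE inE (negPf vf).
have fUB : f \in U :\: B by rewrite fE inE.
have fU : f \in U by move: fUB; rewrite inE => /andP[].
have vU x : x \in over U :\: A -> x.1 \in U by rewrite !inE => /andP[].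
have anti_out x : x \in over U :\: A -> x.1 != f -> anti x \notin over U :\: A.
  by move=> xS xf; apply: compl_opp => //; apply: inB; rewrite ?vU.
have thin x y : x \in over U :\: A -> y \in over U :\: A -> x.1 != f -> x.1 = y.1 -> x = y.
  move=> xS yS xf /vxP[//|e]; have := anti_out x xS xf.
  by rewrite e antiK yS.
have sF2 p q r : F p q r -> q \in over U :\: A by rewrite triC => /sF.
have sF3 p q r : F p q r -> r \in over U :\: A by rewrite -triCA => /sF.
have sFU : supported F (over U) by move=> p q r /sF; rewrite inE => /andP[].
pose a : V * bool := (f, true).
have apex x : (x \in [set a; anti a]) = (x.1 == f) by rewrite -[f]/(a.1) eq_vx !inE.
have rest : size3 (restrict F (~: over [set f])) <= 30.
  apply: (half7 (restrict_supp sF)); last 2 first.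
  - exact: card_minus U8 fU.
  - move=> x y; rewrite !(inE, in_setI) => /andP[xS xf] /andP[yS _].
    by apply: thin; rewrite ?inE.
  apply/subsetP => x; rewrite in_setI => /andP[/vU xU]; rewrite !inE => ->.
  by rewrite xU.
have le12 x : x.1 = f -> deg2 F x <= 12.
  move=> xf; case: (boolP (centre F x)) => [/existsP[y Bx]|]; last exact: noncentre_deg.
  rewrite (centre_deg Bx); have c6 : codeg F x y <= 6 by have := codeg_card sFU Bx; rewrite U8.
  have [r [Fr _ _]] := big_page Bx f f.
  have yf : y.1 != f by have [+ _ _] := tri_vx3 Fr; rewrite xf eq_sym.
  have -> : codeg F x (anti y) = 0.
    by rewrite codegC; apply: supp_codeg sF _; exact: anti_out (sF2 _ _ _ Fr) yf.
  by move: c6; lia_goal.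
have all_f x : x.1 = f -> 8 < deg2 F x ->
    forall p q r, F p q r -> [|| p.1 == f, q.1 == f | r.1 == f].
  move=> xf d8; have xnf y z : F x y z -> y.1 != f.
    by move=> Fx; have [+ _ _] := tri_vx3 Fx; rewrite xf eq_sym.
  have znf y z : F x y z -> z.1 != f by rewrite triA; exact: xnf.
  have mem z : 0 < codeg F x z -> z \in over U :\: A /\ z.1 != f.
    by rewrite codegE card_gt0 => /set0Pn[r]; rewrite inE => Fx; split; [exact: sF2 Fx|exact: xnf Fx].
  (* A triangle has at most three elements available, of codegree at most 2 each, so the link is a
     star; only one sign of its centre is in the support. *)
  have [y c5] : exists y, 4 < codeg F x y.
    have [[y /link_star dE]|[W [W3 xW linkW]]] := link_cases F x.
      have [y0|y0] := posnP (codeg F x y).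
        by exists (anti y); move: d8; rewrite dE y0; lia_goal.
      have [yS yf] := mem y y0; exists y; move: d8; rewrite dE.
      by rewrite [codeg F x (anti y)]codegC (supp_codeg x sF (anti_out y yS yf)); lia_goal.
    have : deg2 F x <= \sum_(z in [set z in over U :\: A | z.1 \in W]) 2.
      rewrite /deg2 [leqRHS]big_mkcond; apply: leq_sum => z _; rewrite inE.
      have [z0|z0] := posnP (codeg F x z); first by rewrite z0.
      have [zS zf] := mem z z0; rewrite zS /=.
      have zW : z.1 \in W.
        by move: z0; rewrite codegE card_gt0 => /set0Pn[r]; rewrite inE => /linkW/andP[].
      have W2 : #|W :\ z.1| = 2 by exact: card_minus W3 zW.
      rewrite zW -W2; apply: codeg_le => r Fx; have /andP[_ rW] := linkW _ _ Fx.
      by have [_ _ zr] := tri_vx3 Fx; rewrite !inE rW eq_sym zr.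
    rewrite sum_nat_const => le; suff : #|[set z in over U :\: A | z.1 \in W]| <= 3.
      by move: le d8; lia_goal.
    rewrite -W3 -(@card_in_imset _ _ fst) => [|z z'].
      by apply/subset_leq_card/subsetP => _ /imsetP[z + ->]; rewrite inE => /andP[].
    rewrite !in_set => /andP[zS zW] /andP[zS' _] e.
    by apply: thin; rewrite ?in_setD ?in_set // -xf; apply: contraNneq xW => <-.
  have Bx : big F x y by apply: ltn_trans c5.
  have [yS yf] := mem y (ltn_trans (isT : 0 < 4) c5).
  have page r s u : F r s u -> r.1 != f -> s.1 != f -> u.1 != f -> ~~ F x y r.
    move=> Fr rf sf uf; apply/negP => Fxr; have Fr' : F r x y by rewrite triCA.
    have := page_link Bx Fr' Fr.
    have no (z w : V * bool) : z.1 != f -> w.1 = f -> (z == w) = false.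
      by move=> zf wf; apply: contraNF zf => /eqP ->; rewrite wf.
    rewrite !(no s x) // !(no u x) // !(no s (anti x)) // !(no u (anti x)) // andbF /=.
    by case/orP=> /eqP e; [move: (sF2 _ _ _ Fr)|move: (sF3 _ _ _ Fr)];
      rewrite e (negPf (anti_out y yS yf)).
  have page_vx r s u : F r s u -> r.1 != f -> s.1 != f -> u.1 != f ->
      r.1 \notin [set z.1 | z in [set z | F x y z]].
    move=> Fr rf sf uf; apply/imsetP => -[z]; rewrite inE => Fz e.
    have rz : r = z by apply: thin (sF Fr) (sF3 _ _ _ Fz) rf e.
    by have := page r s u Fr rf sf uf; rewrite rz Fz.
  move=> p q r Fp; apply: contraT; rewrite !negb_or => /and3P[pf qf rf].
  have Fq : F q p r by rewrite triC.
  have Fr : F r p q by rewrite triCA.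
  have [pq pr qr] := tri_vx3 Fp.
  set P := [set z.1 | z in [set z | F x y z]] in page_vx.
  have P5 : 4 < #|P|.
    rewrite card_in_imset -?codegE // => z z'; rewrite !inE; exact: tri_inj.
  (* The vertices of five pages and of a triple off [f] would be eight, with only seven
     available. *)
  have : #|P :|: [set p.1; q.1; r.1]| <= #|U :\ f|.
    apply/subset_leq_card/subsetP => v; rewrite !inE -!orbA.
    case/or4P=> [/imsetP[z]|/eqP->|/eqP->|/eqP->].
    - by rewrite inE => Fz ->; rewrite (znf _ _ Fz) vU // (sF3 _ _ _ Fz).
    - by rewrite pf vU // (sF Fp).
    - by rewrite qf vU // (sF Fq).
    - by rewrite rf vU // (sF Fr).
  rewrite (card_minus U8 fU) cardsU (_ : P :&: _ = set0) ?cards0; last first.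
    apply/setP => v; rewrite in_setI in_set0; apply/negP => /andP[vP]; rewrite !inE -!orbA.
    case/or3P=> /eqP e; move: vP; rewrite e.
    - by rewrite (negPf (page_vx _ _ _ Fp pf qf rf)).
    - by rewrite (negPf (page_vx _ _ _ Fq qf pf rf)).
    - by rewrite (negPf (page_vx _ _ _ Fr rf pf qf)).
  rewrite subn0 -setUA !cardsU1 cards1 !inE negb_or pq pr qr.
  by move=> le; have := leq_trans (leq_add P5 (leqnn 3)) le.
have cover (D : {set V * bool}) : (forall p q r, F p q r -> [|| [&& p \in D, q \in D & r \in D],
    p.1 == f, q.1 == f | r.1 == f]) ->
    size3 F <= size3 (restrict F D) + 3 * (deg2 F a + deg2 F (anti a)).
  move=> cov; apply: leq_trans (@size3_cover _ F D set0 [set a; anti a] _) _.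
    move=> p q r /cov; rewrite !apex => /orP[->//|->]; by rewrite !orbT.
  rewrite size3_set0 addn0 leq_add2l big_setU1 ?big_set1 //.
  by rewrite inE eq_sym anti_neq.
have da := le12 a erefl; have doa := le12 (anti a) erefl.
have [d8|d8] := leqP (deg2 F a + deg2 F (anti a)) 16.
  have := cover (~: over [set f]); move: rest d8.
  have : forall p q r, F p q r -> [|| [&& p \in ~: over [set f], q \in ~: over [set f]
    & r \in ~: over [set f]], p.1 == f, q.1 == f | r.1 == f].
    by move=> p q r _; rewrite !inE; case: (p.1 == f); case: (q.1 == f); case: (r.1 == f).
  by move=> c rest d8 /(_ c); move: rest d8; lia_goal.
have no_rest : forall p q r, F p q r -> [|| p.1 == f, q.1 == f | r.1 == f].
  have [d9|d9] := ltnP 8 (deg2 F a); first exact: all_f d9.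
  apply: (all_f (anti a)) => //; by move: d8 d9; lia_goal.
have := cover set0; rewrite size3_set0 => /(_ _) le.
have {}le : size3 F <= 0 + 3 * (deg2 F a + deg2 F (anti a)).
  by apply: le => p q r /no_rest ->; rewrite orbT.
by move: le da doa; lia_goal.
Qed.

End Complement.

Lemma size3_restrict_id (V : finType) (F : fam V) (D : {set V * bool}) :
  (forall p q r, F p q r -> p \in D) -> size3 (restrict F D) = size3 F.
Proof.
move=> FD; rewrite !size3E; do 3![apply: eq_bigr => ? _]; rewrite restrictE.
case: (boolP (F _ _ _)) => //= Fp; have := Fp; rewrite triC => Fq.
by have := Fp; rewrite -triCA => Fr; rewrite (FD _ _ _ Fp) (FD _ _ _ Fq) (FD _ _ _ Fr).
Qed.

Lemma bound3 : size_bound 3 4.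
Proof.
move=> V F U sF U3; rewrite -(size3_restrict_id sF).
exact: size3_vertices.
Qed.

Lemma bound4 : size_bound 4 16.
Proof.
move=> V F U sF U4; have nH : ~~ heavy F.
  apply/existsP => -[p /existsP[q /existsP[t /and3P[B _ _]]]].
  by have := codeg_card sF B; move: B; rewrite U4 /big; lia_goal.
by have := size_le nH sF; rewrite card_over U4; lia_goal.
Qed.

(** Here [k] counts the attached elements, [s] the elements left and [N] the remainder. The last
    list holds the cases in which the general bounds on [N] are too weak. *)
Lemma heavy_numeric n (V : finType) (F : fam V) (U : {set V}) :
  supported F (over U) -> #|U| = n -> heavy F ->
  exists k s N : nat, [/\ k <= n - 3, s + k = 2 * (n - 3), size3 F <= N + 24 + 18 * k,
    N <= 12 * s /\ (2 <= s %% 8 -> N + 24 <= 12 * s) \/ N + 84 <= 18 * s &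
    [/\ n = 10 -> 5 <= k -> N <= 60, n = 10 -> k = 7 -> N <= 30, n = 11 -> k = 7 -> N <= 78,
        n = 11 -> k = 8 -> N <= 48 & n = 12 -> k = 9 -> N <= 72]].
Proof.
move=> sF Un hF; have [W [A [G [[W3 WU] AU Ai sG le]]]] := heavy_split hF sF.
have cU : #|U :\: W| = n - 3 by rewrite cardsD (setIidPr WU) Un W3.
exists #|A|, #|over (U :\: W) :\: A|, (size3 G); split=> //.
- by rewrite -cU; exact: card_inj.
- by rewrite -cU; exact: card_compl.
- have [[? nH]|[? _]] := size_max sG; [left|by right]; split=> //.
  exact: slack nH sG.
have sub : over (U :\: W) :\: A \subset over (U :\: W) by exact: subsetDl.
split=> [e k5|e k7|e k7|e k8|e k9]; rewrite e /= in cU.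
- exact: half5 sG AU Ai cU k5.
- exact: (half7 sG sub cU (thin_compl AU Ai (etrans k7 (esym cU)))).
- exact: one_full sG AU Ai cU k7.
- exact: (half8 sG sub cU (thin_compl AU Ai (etrans k8 (esym cU)))).
exact: (half9 sG sub cU (thin_compl AU Ai (etrans k9 (esym cU)))).
Qed.

Definition alpha n :=
  maxn (6 * n - 28) (4 * n - 4 * (match n %% 4 with 0 => 0 | 1 => 1 | _ => 2 end)).

Theorem alpha_bound n : 3 <= n -> size_bound n (alpha n).
Proof.
move=> n3; have [n8|n9] := leqP n 8.
  have : [|| n == 3, n == 4, n == 5, n == 6, n == 7 | n == 8] by lia.
  case/or4P=> [/eqP->|/eqP->|/eqP->|/or3P[]/eqP->].
  - exact: bound3.
  - exact: bound4.
  - move=> V F U sF U5; rewrite (_ : alpha 5 = 16) //.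
    have [hF|nH] := boolP (heavy F); last first.
      by have := slack nH sF; rewrite card_over U5 => /(_ isT); lia_goal.
    have [k [s [N [k2 sk leN [[N12 _]|N84] _]]]] := heavy_numeric sF U5 hF.
      by move: k2 sk leN N12; lia_goal.
    by move: k2 sk leN N84; lia_goal.
  - exact: bound6.
  - exact: bound7.
  exact: bound8.
move=> V F U sF Un; have [hF|nH] := boolP (heavy F); last first.
  have [n16|n17] := leqP n 16; last first.
    have := size_le nH sF; rewrite card_over Un; have : 6 * n - 28 <= alpha n by exact: leq_maxl.
    by move: n17; lia_goal.
  have : [|| n == 9, n == 10, n == 11, n == 12 | [|| n == 13, n == 14, n == 15 | n == 16]] by lia.
  case/or4P=> [/eqP e|/eqP e|/eqP e|/orP[/eqP e|/or4P[]/eqP e]]; rewrite e in Un *.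
  - by have := slack nH sF; rewrite card_over Un => /(_ isT); rewrite (_ : alpha 9 = 32) //; lia_goal.
  - exact: noheavy_ten bound6 nH sF Un.
  - exact: noheavy_eleven bound7 nH sF Un.
  - by have := size_le nH sF; rewrite card_over Un (_ : alpha 12 = 48) //; lia_goal.
  - by have := slack nH sF; rewrite card_over Un => /(_ isT); rewrite (_ : alpha 13 = 50) //; lia_goal.
  - by have := size_le nH sF; rewrite card_over Un (_ : alpha 14 = 56) //; lia_goal.
  - by have := size_le nH sF; rewrite card_over Un (_ : alpha 15 = 62) //; lia_goal.
  by have := size_le nH sF; rewrite card_over Un (_ : alpha 16 = 68) //; lia_goal.
have [k [s [N [k2 sk leN alt [h1 h2 h3 h4 h5]]]]] := heavy_numeric sF Un hF.
have a6 : 6 * n - 28 <= alpha n by exact: leq_maxl.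
case: alt => [[N12 N8]|N84]; last by move: a6 k2 sk leN N84 n9; lia_goal.
have [n16|n17] := leqP n 16; last by move: a6 k2 sk leN N12 n17; lia_goal.
have hn : [|| n == 9, n == 10, n == 11, n == 12 | [|| n == 13, n == 14, n == 15 | n == 16]] by lia.
have ka : s = 2 * (n - 3) - k by move: sk; lia_goal.
move: k2 leN N12 N8 h1 h2 h3 h4 h5; rewrite {}ka; move: (size3 F) hn => M hn; clear -hn.
case/or4P: hn => [/eqP->|/eqP->|/eqP->|/orP[/eqP->|/or4P[]/eqP->]]; rewrite /alpha /maxn /=.
(* Here [k] is at most 16 - 3 = 13, so all values of [k] are enumerated. *)
all: by do 14?[case: k => [|k]] => //=; lia.
Qed.

Require Import Defs.
From mathcomp Require Import all_boot all_order all_algebra finmap.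
From mathcomp Require Import all_classical all_reals all_analysis.
From mathcomp Require Import zify ring lra.

Import Order.TTheory GRing.Theory Num.Theory.
Local Open Scope ring_scope.

(** * Vectors and signed triples *)

Section Vectors.
Variables (R : realType) (n : nat).
Implicit Types (p q r : nat * bool) (u v : 'rV[R]_n).

Definition sg (b : bool) : int := if b then 1 else -1.

Definition ev p : 'rV[R]_n := \row_i ((sg p.2)%:~R *+ (i == p.1 :> nat)).

Definition triple := ((nat * bool) * (nat * bool) * (nat * bool))%type.
Definition vec (t : triple) : 'rV[R]_n := ev t.1.1 + ev t.1.2 + ev t.2.

Definition idot1 p q : int := sg p.2 * sg q.2 *+ (p.1 == q.1).
(** An inner product that computes, so that concrete configurations can be checked by evaluation. *)
Definition idot (t t' : triple) : int :=
  idot1 t.1.1 t'.1.1 + idot1 t.1.1 t'.1.2 + idot1 t.1.1 t'.2 +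
  (idot1 t.1.2 t'.1.1 + idot1 t.1.2 t'.1.2 + idot1 t.1.2 t'.2) +
  (idot1 t.2 t'.1.1 + idot1 t.2 t'.1.2 + idot1 t.2 t'.2).

Lemma dotDl u u' v : dot (u + u') v = dot u v + dot u' v.
Proof. by rewrite /dot -big_split; apply: eq_bigr => i _; rewrite mxE mulrDl. Qed.

Lemma dotDr u v v' : dot u (v + v') = dot u v + dot u v'.
Proof. by rewrite ![dot u _]dotC dotDl. Qed.

Lemma dot_evr v p (pn : (p.1 < n)%N) : dot v (ev p) = v 0 (Ordinal pn) * (sg p.2)%:~R.
Proof.
rewrite /dot (bigD1 (Ordinal pn)) //= big1 ?addr0 => [|i ip].
  by rewrite mxE eqxx mulr1n.
rewrite mxE; suff /negPf -> : i != p.1 :> nat by rewrite mulr0n mulr0.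
by apply: contra ip => /eqP e; apply/eqP/val_inj.
Qed.

Lemma dot_ev p q : (q.1 < n)%N -> dot (ev p) (ev q) = (idot1 p q)%:~R.
Proof.
move=> qn; rewrite (dot_evr _ qn) mxE /idot1 /= [p.1 == _]eq_sym.
by case: (q.1 == p.1); rewrite ?mulr1n ?mulr0n ?mul0r ?rmorphM.
Qed.

Definition below (t : triple) := [&& t.1.1.1 < n, t.1.2.1 < n & t.2.1 < n]%N.
Definition distinct (t : triple) :=
  [&& t.1.1.1 != t.1.2.1, t.1.1.1 != t.2.1 & t.1.2.1 != t.2.1].

Lemma dot_vec t t' : below t' -> dot (vec t) (vec t') = (idot t t')%:~R.
Proof.
case/and3P=> h1 h2 h3; rewrite /vec !(dotDl, dotDr) !dot_ev // /idot !rmorphD /=.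
ring.
Qed.

Lemma idot_self t : distinct t -> idot t t = 3.
Proof.
case/and3P=> h1 h2 h3; rewrite /idot /idot1 !eqxx.
rewrite ![t.1.2.1 == t.1.1.1]eq_sym ![t.2.1 == t.1.1.1]eq_sym ![t.2.1 == t.1.2.1]eq_sym.
by rewrite (negPf h1) (negPf h2) (negPf h3); case: t.1.1.2; case: t.1.2.2; case: t.2.2.
Qed.

Lemma norm_Vn v : Vn R n v -> dot v v = 3.
Proof.
case=> _; rewrite /euclidean_norm => /eqP; rewrite eqr_sqrt //; first by move/eqP.
by apply: sumr_ge0 => i _; rewrite -expr2 sqr_ge0.
Qed.

Lemma vec_Vn t : below t -> distinct t -> Vn R n (vec t).
Proof.
move=> tn td; split; last by rewrite /euclidean_norm dot_vec // idot_self.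
move=> i; rewrite !mxE; case/and3P: td => h1 h2 h3.
have no x y : x != y -> (i == x :> nat) && (i == y :> nat) = false.
  by move=> xy; apply: contraNF xy => /andP[/eqP <- /eqP <-].
move: (no _ _ h1) (no _ _ h2) (no _ _ h3); rewrite !inE.
case: (i == t.1.1.1 :> nat); case: (i == t.1.2.1 :> nat); case: (i == t.2.1 :> nat) => //= _ _ _;
  rewrite ?mulr0n ?mulr1n ?addr0 ?add0r ?eqxx ?orbT //.
- by case: t.1.1.2 => /=; rewrite ?rmorphN ?rmorph1 eqxx ?orbT.
- by case: t.1.2.2 => /=; rewrite ?rmorphN ?rmorph1 eqxx ?orbT.
- by case: t.2.2 => /=; rewrite ?rmorphN ?rmorph1 eqxx ?orbT.
Qed.

Lemma Vn_vec v : Vn R n v -> exists t, [/\ below t, distinct t & v = vec t].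
Proof.
move=> vV; have v3 := norm_Vn vV; case: vV => v01 _.
pose I := [set i : 'I_n | v 0 i != 0].
have I3 : #|I| = 3%N.
  apply/eqP; rewrite -(eqr_nat R) -v3 /dot -sum1_card natr_sum big_mkcond /=; apply/eqP.
  apply: eq_bigr => i _; rewrite inE; have := v01 i; rewrite !inE.
  by case/or3P=> /eqP->; rewrite ?eqxx ?oppr_eq0 ?oner_eq0 ?mulrNN ?mulr1 ?mulr0.
have [i [j [k [[iI jI kI] [ij jk ki]]]]] : exists i j k : 'I_n,
    [/\ i \in I, j \in I & k \in I] /\ [/\ i != j, j != k & k != i].
  by have /card_gt2P : (2 < #|I|)%N by rewrite I3.
have IE : I = [set i; j; k].
  apply/eqP; rewrite eq_sym eqEcard I3; apply/andP; split; last first.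
    by rewrite -finset.setUA !cardsU1 cards1 !inE negb_or ij jk eq_sym ki.
  by apply/fintype.subsetP => x; rewrite !finset.inE -orbA => /or3P[]/eqP->; move: iI jI kI; rewrite !finset.inE.
pose s x : nat * bool := (val x, v 0 x == 1).
exists (s i, s j, s k); split.
- by rewrite /below /= !ltn_ord.
- by rewrite /distinct /= ij jk eq_sym ki.
apply/rowP => x; rewrite !mxE /=.
have sgE y : y \in I -> (sg (v 0 y == 1))%:~R = v 0 y.
  have n11 : (-1 == 1 :> R) = false by apply/eqP => e; move: e; lra.
  by rewrite finset.inE; have := v01 y; rewrite !inE => /or3P[]/eqP->; rewrite ?eqxx ?n11 ?rmorphN ?rmorph1.
rewrite !sgE //; have [xI|xI] := boolP (x \in I); last first.
  have v0 : v 0 x = 0 by apply/eqP; rewrite inE negbK in xI.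
  have ne y : y \in I -> (x == y :> nat) = false.
    by move=> yI; apply: contraNF xI => /eqP/val_inj ->.
  by rewrite !ne // v0 !mulr0n !addr0.
move: xI; rewrite IE !inE -orbA => /or3P[]/eqP->.
- by rewrite eqxx val_eqE (negPf ij) val_eqE eq_sym (negPf ki) mulr1n !mulr0n !addr0.
- by rewrite eqxx val_eqE eq_sym (negPf ij) val_eqE (negPf jk) mulr1n !mulr0n !addr0 add0r.
by rewrite eqxx val_eqE (negPf ki) val_eqE eq_sym (negPf jk) mulr1n !mulr0n !add0r.
Qed.

End Vectors.

(** * Vertices counted by ordered triples *)

Section Counting.
Variables (R : realType) (n : nat).
Implicit Types (p q r : 'I_n * bool) (x : 'I_n * bool * ('I_n * bool) * ('I_n * bool)).
Implicit Types (S : {fset 'rV[R]_n}) (v : 'rV[R]_n).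
Local Notation point := ('I_n * bool)%type.

Definition pt p : nat * bool := (val p.1, p.2).
Definition tr x : triple := (pt x.1.1, pt x.1.2, pt x.2).

Lemma tr_below x : below n (tr x).
Proof. by rewrite /below !ltn_ord. Qed.

Lemma below_tr t : below n t -> exists x, t = tr x.
Proof.
case: t => [[[i b] [j c]] [k d]] /and3P[/= hi hj hk].
by exists (Ordinal hi, b, (Ordinal hj, c), (Ordinal hk, d)).
Qed.

(** This reads the three elements off the inner products of the vector with signed basis vectors. *)
Lemma idot1_sum x p : distinct (tr x) ->
  (idot1 (tr x).1.1 (pt p) + idot1 (tr x).1.2 (pt p) + idot1 (tr x).2 (pt p) == 1) =
  (p \in [:: x.1.1; x.1.2; x.2]).
Proof.
case: x p => [[[i b] [j c]] [k d]] [l e] /and3P[/= h1 h2 h3].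
rewrite !inE /idot1 /= !xpair_eqE ![l == _]eq_sym -!(inj_eq val_inj) /=.
move: (val i) (val j) (val k) (val l) h1 h2 h3 => {}i {}j {}k {}l.
have [il|_] := eqVneq i l; have [jl|_] := eqVneq j l; have [kl|_] := eqVneq k l => h1 h2 h3.
all: by subst; rewrite ?eqxx // in h1 h2 h3; move: b c d e => [] [] [] [].
Qed.

Lemma vec_mem x y : distinct (tr x) -> distinct (tr y) -> vec R n (tr x) = vec R n (tr y) ->
  [:: x.1.1; x.1.2; x.2] =i [:: y.1.1; y.1.2; y.2].
Proof.
move=> dx dy e p; rewrite -!idot1_sum //; move: (congr1 (fun v => dot v (ev R n (pt p))) e).
by rewrite /vec !dotDl !dot_ev ?ltn_ord // -!rmorphD /= => /intr_inj ->.
Qed.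

Lemma card_vec v : Vn R n v ->
  (\sum_x (distinct (tr x) && (vec R n (tr x) == v)) = 6)%N.
Proof.
move=> /Vn_vec[t [/below_tr[y ->] dy ->]]; case: y dy => [[a b] c] dy.
pose s := [:: (a, b, c); (a, c, b); (b, a, c); (b, c, a); (c, a, b); (c, b, a)].
have [ab ac bc] : [/\ a != b, a != c & b != c].
  by case/and3P: dy => /= h1 h2 h3; split; [move: h1|move: h2|move: h3]; apply: contraNneq => ->.
transitivity #|s|; last first.
  have [ba ca cb] : [/\ b != a, c != a & c != b] by split; rewrite eq_sym.
  apply: (card_uniqP (_ : uniq s)); rewrite /= !inE !xpair_eqE.
  by rewrite !eqxx !(negPf ab, negPf ac, negPf bc, negPf ba, negPf ca, negPf cb).
rewrite -sum1_card [RHS]big_mkcond /=; apply: eq_bigr => -[[p q] r] _.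
rewrite -[RHS]/(nat_of_bool _); congr nat_of_bool; apply/andP/idP => [[dx /eqP/(vec_mem dx dy) m]|].
  have [pq pr qr] : [/\ p != q, p != r & q != r].
    by case/and3P: dx => /= h1 h2 h3; split; [move: h1|move: h2|move: h3]; apply: contraNneq => ->.
  move: (m p) (m q) (m r); rewrite !inE !eqxx !orbT /= => mp mq mr.
  move: (esym mp) (esym mq) (esym mr) pq pr qr.
  by do 3![case/or3P=> /eqP->]; rewrite ?eqxx ?orbT.
rewrite !inE => sx; suff: distinct (tr (p, q, r)) /\ vec R n (tr (p, q, r)) = vec R n (tr (a, b, c)).
  by case=> -> ->.
have [ba ca cb] : [/\ b.1 != a.1, c.1 != a.1 & c.1 != b.1].
  by case/and3P: dy => /= h1 h2 h3; split; rewrite eq_sym.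
move: dy; rewrite /vec /distinct => /and3P[/= h1 h2 h3].
by move: sx; do !case/orP; move=> /eqP[-> -> ->] /=;
  rewrite ?ba ?ca ?cb ?h1 ?h2 ?h3; split=> //; apply/rowP => z; rewrite !mxE /=; ring.
Qed.

Lemma sum_mem_vec S : {subset S <= Vn R n} ->
  (\sum_x (distinct (tr x) && (vec R n (tr x) \in S)) = 6 * #|` S|)%N.
Proof.
move=> SV; transitivity (\sum_(v <- S) \sum_x (distinct (tr x) && (vec R n (tr x) == v)))%N.
  rewrite exchange_big; apply: eq_bigr => x _; case: distinct => /=; last by rewrite big1.
  rewrite -[_ \in S]/(_ \in enum_fset S) -(count_uniq_mem _ (fset_uniq S)) -sum1_count big_mkcond.
    by apply: eq_bigr => v _ /=; rewrite eq_sym; case: (_ == v).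
rewrite (eq_big_seq (fun=> 6%N)) => [|v vS]; last by apply: card_vec; exact/set_mem/SV.
by rewrite big_const_seq count_predT iter_addn_0.
Qed.

Lemma sum_distinct : (\sum_x distinct (tr x) = 2 * n * (2 * n.-1) * (2 * n.-2))%N.
Proof.
have card_off (A : {set 'I_n}) : (\sum_(p : point) (p.1 \notin A) = 2 * (n - #|A|))%N.
  have -> : (n - #|A| = #|~: A|)%N by rewrite -[X in (X - _)%N](card_ord n) -(cardsC A) addKn.
  rewrite mulnC -card_bool -(cardsT bool) -cardsX -sum1_card [RHS]big_mkcond /=.
  by apply: eq_bigr => p _; rewrite !finset.inE andbT; case: (_ \in A).
rewrite -(pair_bigA _ (fun pq r => nat_of_bool (distinct (tr (pq, r))))) /=.
rewrite -(pair_bigA _ (fun p q => \sum_r (distinct (tr (p, q, r)) : nat)%N)) /=.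
rewrite (eq_bigr (fun=> 2 * n.-1 * (2 * n.-2))%N) => [|p _].
  by rewrite sum_nat_const card_prod card_ord card_bool; lia.
transitivity (\sum_(q : point) (q.1 \notin [set p.1]%SET) * (2 * n.-2))%N; last first.
  by rewrite -big_distrl /= card_off cards1 subn1.
apply: eq_bigr => q _; rewrite finset.inE /distinct /=.
have [qp|qp] := eqVneq q.1 p.1; first by rewrite qp eqxx big1.
rewrite mul1n (_ : n.-2 = n - #|[set p.1; q.1]%SET|)%N; last by rewrite cards2 eq_sym qp subn2.
rewrite -card_off; apply: eq_bigr => r _; rewrite !finset.inE negb_or.
by rewrite !(inj_eq val_inj) ![_ == r.1]eq_sym eq_sym qp.
Qed.

Lemma num_vertices_Gn : num_vertices (Gn R n) = (8 * 'C(n, 3))%N.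
Proof.
have sV : {subset fset_set (Vn R n) <= Vn R n}.
  by move=> v; rewrite in_fset_set //; exact: finite_Vn.
apply/eqP; rewrite -(eqn_pmul2l (isT : 0 < 6)%N) /num_vertices /= -(sum_mem_vec sV).
have -> : (\sum_x (distinct (tr x) && (vec R n (tr x) \in fset_set (Vn R n))) = \sum_x distinct (tr x))%N.
  apply: eq_bigr => x _; have [dx|//] := boolP (distinct _).
  by rewrite in_fset_set ?mem_set //; [apply: vec_Vn (tr_below x) dx|exact: finite_Vn].
have : ('C(n, 3) * 6 = n * (n.-1 * n.-2))%N by rewrite (bin_ffact n 3) !ffactnS ffactn0 muln1.
rewrite sum_distinct => e; apply/eqP; transitivity (8 * (n * (n.-1 * n.-2)))%N; first by ring.
by rewrite -e; ring.
Qed.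

End Counting.

(** * Independent sets as families *)

Section Upper.
Variables (R : realType) (n : nat) (S : {fset 'rV[R]_n}).
Hypotheses (SV : {subset S <= Vn R n}) (SI : independent (Gn R n) S).
Local Notation point := ('I_n * bool)%type.
Implicit Types p q r s t : point.

Definition fset_tri p q r :=
  distinct (tr (p, q, r)) && (vec R n (tr (p, q, r)) \in S).

Lemma fset_triC p q r : fset_tri p q r = fset_tri q p r.
Proof.
rewrite /fset_tri /distinct /vec /= [(ev R n (pt q) + _)%R]addrC [val q.1 == val p.1]eq_sym; congr andb.
by case: (_ == _) (_ == _) (_ == _) => [] [] [].
Qed.

Lemma fset_triA p q r : fset_tri p q r = fset_tri p r q.
Proof.
rewrite /fset_tri /distinct /vec /= addrAC [val r.1 == _]eq_sym; congr andb.
by case: (_ == _) (_ == _) (_ == _) => [] [] [].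
Qed.

Lemma fset_tri_vx p q r : fset_tri p q r -> p.1 != q.1.
Proof. by case/andP => /and3P[/= h _ _] _; apply: contraNneq h => ->. Qed.

Lemma fset_tri_idot p q r x : fset_tri p q r -> fset_tri x.1.1 x.1.2 x.2 ->
  idot (tr (p, q, r)) (tr x) != 1.
Proof.
case: x => [[s t] u] /andP[_ h1] /andP[_ h2]; apply/eqP => e; case: (SI h1 h2).
by rewrite /= /Gn_adjacent dot_vec ?tr_below // e.
Qed.

(** Otherwise [p] alone contributes to the inner product, which is then 1. *)
Lemma fset_tri_meet p q r s t : fset_tri p q r -> fset_tri p s t ->
  [|| s.1 == q.1, s.1 == r.1, t.1 == q.1 | t.1 == r.1].
Proof.
move=> h1 h2; have := fset_tri_idot (x := (p, s, t)) h1 h2.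
apply: contraNT; rewrite !negb_or => /and4P[sq sr tq tr'].
case/andP: h1 => /and3P[/= pq pr _] _; case/andP: h2 => /and3P[/= ps pt' _] _.
have ne (a b : point) : a.1 != b.1 -> ((val a.1 == val b.1) = false) * ((val b.1 == val a.1) = false).
  by move=> ab; split; apply: contraNF ab => /eqP/val_inj ->.
rewrite /idot /idot1 /= eqxx !(ne _ _ sq, ne _ _ sr, ne _ _ tq, ne _ _ tr').
rewrite [val q.1 == _]eq_sym [val r.1 == _]eq_sym (negPf pq) (negPf pr) (negPf ps) (negPf pt').
by case: p.2.
Qed.

(** The inner product would be 1 + 1 - 1. *)
Lemma fset_tri_opp p q r : fset_tri p q r -> ~~ fset_tri p q (anti r).
Proof.
move=> h1; apply/negP => h2; have /eqP := fset_tri_idot (x := (p, q, anti r)) h1 h2.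
case/andP: h1 => /and3P[/= pq pr qr] _; apply.
rewrite /idot /idot1 /= !eqxx ![val q.1 == val p.1]eq_sym ![val r.1 == _]eq_sym.
by rewrite (negPf pq) (negPf pr) (negPf qr); case: p.2 q.2 r.2 => [] [] [].
Qed.

Definition fset_fam : fam 'I_n :=
  Fam fset_triC fset_triA fset_tri_vx fset_tri_meet fset_tri_opp.

Lemma size3_fset : size3 fset_fam = (6 * #|` S|)%N.
Proof.
rewrite -(sum_mem_vec SV) /size3 /deg2 /codeg pair_bigA /= pair_bigA /=.
by apply: eq_bigr => -[[p q] r].
Qed.

End Upper.

Lemma independence_le (R : realType) n : (3 <= n)%N ->
  (independence_number (Gn R n) <= alpha n)%N.
Proof.
move=> n3; apply/bigmax_leqP_seq => S; rewrite fpowersetE => /fsubsetP sub /asboolP SI.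
have SV : {subset S <= Vn R n}.
  by move=> v /sub; rewrite in_fset_set //; exact: finite_Vn.
have := @alpha_bound n n3 'I_n (fset_fam SI) [set: 'I_n]%SET.
rewrite finset.cardsT card_ord size3_fset // leq_pmul2l //; apply=> // p q r _.
by rewrite !finset.inE.
Qed.

(** * Large independent sets *)

(** Excluding 3 as well makes the vectors of a packing distinct. *)
Definition remote (t t' : triple) := idot t t' \notin [:: 1; 3].

Definition packing n (L : seq triple) :=
  [&& all (below n) L, all distinct L & pairwise remote L].

Lemma independence_ge (R : realType) n L : packing n L ->
  (size L <= independence_number (Gn R n))%N.
Proof.
case/and3P=> /allP Ln /allP Ld LI.
have uL : uniq (map (vec R n) L).
  rewrite uniq_pairwise pairwise_map; apply: (sub_in_pairwise (P := mem L)) (allss L) LI => t t' tL t'L; apply: contraNneq => e.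
  suff : idot t t' = 3 by move->.
  apply: (@intr_inj R); rewrite -(dot_vec R (n := n)) ?Ln //= e.
  by rewrite dot_vec ?Ln // idot_self // Ld.
have t0 : triple := ((0, true), (0, true), (0, true))%N.
have /pairwiseP -/(_ t0) LI' := LI.
have {}LI' i j : (i < size L)%N -> (j < size L)%N -> (i < j)%N -> dot (vec R n (nth t0 L i)) (vec R n (nth t0 L j)) != 1.
  move=> iL jL /(LI' _ _ iL jL); apply: contraNneq; rewrite dot_vec ?Ln ?mem_nth // => e.
  by have -> : idot (nth t0 L i) (nth t0 L j) = 1 by apply: (@intr_inj R).
pose S := [fset v in map (vec R n) L]%fset.
have -> : size L = #|` S|.
  by rewrite card_fseq undup_id // size_map.
have SV : (S `<=` fset_set (Vn R n))%fset.
  apply/fsubsetP => v; rewrite inE => /mapP[t tL ->].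
  by rewrite in_fset_set ?mem_set //; [apply: vec_Vn; [exact: Ln|exact: Ld]|exact: finite_Vn].
apply: leq_bigmax_seq; first by rewrite fpowersetE.
apply/asboolP => u v; rewrite !inE => /mapP[t tL ->] /mapP[t' t'L ->] /=; rewrite /Gn_adjacent.
have it : (index t L < size L)%N by rewrite index_mem.
have it' : (index t' L < size L)%N by rewrite index_mem.
rewrite -(nth_index t0 tL) -(nth_index t0 t'L).
have [lt|gt|->] := ltngtP (index t L) (index t' L).
- exact/eqP/LI'.
- by rewrite dotC; exact/eqP/LI'.
rewrite dot_vec ?Ln ?mem_nth // idot_self ?Ld ?mem_nth // => /eqP.
by rewrite (eqr_nat R 3 1).
Qed.

(** An even number of minus signs: two of them differ in two signs and have inner product -1.
    Different supports within four vertices share two vertices, which makes the inner product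
    even. *)
Definition even_triples (a b c : nat) : seq triple :=
  [:: ((a, true), (b, true), (c, true)); ((a, true), (b, false), (c, false));
      ((a, false), (b, true), (c, false)); ((a, false), (b, false), (c, true))].

Definition tetra : seq triple :=
  even_triples 0 1 2 ++ even_triples 0 1 3 ++ even_triples 0 2 3 ++ even_triples 1 2 3.

Definition shift b (t : triple) : triple :=
  ((b + t.1.1.1, t.1.1.2), (b + t.1.2.1, t.1.2.2), (b + t.2.1, t.2.2))%N.

Lemma packing_shift b n B L : packing b L -> packing n B ->
  packing (b + n) (map (shift b) B ++ L).
Proof.
case/and3P=> /allP Lb Ld LI /and3P[/allP Bn Bd BI].
rewrite /packing !all_cat Ld pairwise_cat LI !andbT pairwise_map; apply/and3P; split.
- apply/andP; split; last by apply/allP => t /Lb/and3P[h1 h2 h3]; rewrite /below; lia.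
  by apply/allP => _ /mapP[t /Bn/and3P[h1 h2 h3] ->]; rewrite /below /= !ltn_add2l h1 h2.
- by apply/allP => _ /mapP[t /(allP Bd) h ->]; rewrite /distinct /= !eqn_add2l.
apply/andP; split.
  apply/allrelP => _ t' /mapP[t _ ->] /Lb/and3P[h1 h2 h3]; rewrite /remote /idot /idot1 /=.
  have ne x y : (y < b)%N -> (b + x == y)%N = false by move=> yb; apply/eqP; lia.
  by rewrite !ne.
apply: sub_pairwise BI => t t'; rewrite /remote /idot /idot1 /=.
by rewrite !eqn_add2l.
Qed.

Lemma packing_tetra : packing 4 tetra.
Proof. by vm_compute. Qed.

Fixpoint tetras m := if m is m'.+1 then map (shift (4 * m')) tetra ++ tetras m' else [::].

Lemma packing_tetras m : packing (4 * m) (tetras m).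
Proof.
by elim: m => //= m IH; rewrite mulnS addnC; apply: packing_shift IH packing_tetra.
Qed.

Lemma size_tetras m : size (tetras m) = (16 * m)%N.
Proof. by elim: m => //= m ->; rewrite mulnS. Qed.

Lemma packing_widen m n L : (m <= n)%N -> packing m L -> packing n L.
Proof.
move=> mn /and3P[/allP Lm Ld LI]; apply/and3P; split=> //; apply/allP => t /Lm/and3P[h1 h2 h3].
by rewrite /below; lia.
Qed.

Lemma tetras_ge (R : realType) n : (4 * n - 4 * cn n <= independence_number (Gn R n))%N.
Proof.
have p1 := packing_tetras (n %/ 4).
(* Three vertices left over by the tetrahedra still carry four triples on one support. *)
have p2 : packing 3 (even_triples 0 1 2) by [].
have e := divn_eq n 4; have [n3|n3] := eqVneq (n %% 4)%N 3.
  have le : (4 * (n %/ 4) + 3 <= n)%N by lia.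
  apply: leq_trans (independence_ge R (packing_widen le (packing_shift p1 p2))).
  by rewrite size_cat size_map size_tetras /cn n3 /=; lia.
apply: leq_trans (independence_ge R (packing_widen _ p1)); last by lia.
rewrite size_tetras /cn; move: (ltn_pmod n (isT : 0 < 4)%N) n3 e.
by case: (n %% 4)%N => [|[|[|[|]]]] // _ _; lia.
Qed.

(** The pairs over 0, 1, 2 have the shape [p q], [anti p t], [anti q (anti t)] of a heavy
    configuration, and so have those over 3, 4, 5 for the opposite sign. The hub [x] comes after
    these six vertices. *)
Definition spokes (k : nat) : seq triple := let x := k.+4.+2 in
  [:: ((x, true), (0, true), (1, true)); ((x, true), (0, false), (2, true));
      ((x, true), (1, false), (2, false)); ((x, false), (3, true), (4, true));
      ((x, false), (3, false), (5, true)); ((x, false), (4, false), (5, false))]%N.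

Fixpoint wheel m : seq triple := if m is k.+1 then spokes k ++ wheel k
  else even_triples 0 1 2 ++ even_triples 3 4 5.

Lemma spokes_remote k k' : k != k' -> allrel remote (spokes k) (spokes k').
Proof.
by move=> kk'; rewrite /spokes /allrel /= /remote /idot /idot1 /= !eqSS (negPf kk').
Qed.

Lemma packing_wheel m : packing (m + 6) (wheel m).
Proof.
elim: m => [|k IH]; first by vm_compute.
case/and3P: (packing_widen (leqnSn _) IH) => h1 h2 h3.
rewrite /packing !all_cat -/wheel h1 h2 pairwise_cat h3 !andbT; apply/and3P; split.
- by rewrite /= /below /= !addnS; lia.
- by [].
apply/andP; split; last by rewrite /spokes /= /remote /idot /idot1 /= !eqxx.
suff cross j : (j <= k)%N -> allrel remote (spokes k) (wheel j) by exact: cross.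
elim: j => [|j {}IH] jk.
  by rewrite /spokes /allrel /= /remote /idot /idot1 /=.
by rewrite allrel_catr IH ?andbT 1?ltnW //; apply: spokes_remote; rewrite neq_ltn jk orbT.
Qed.

Lemma size_wheel m : size (wheel m) = (6 * m + 8)%N.
Proof. by elim: m => //= m ->; lia. Qed.

Lemma wheel_ge (R : realType) n : (6 * n - 28 <= independence_number (Gn R n))%N.
Proof.
have [n6|n6] := leqP 6 n; last first.
  apply: leq_trans (tetras_ge R n); move: n6; do 6?[case: n => [|n]] => //.
have := independence_ge R (packing_wheel (n - 6)); rewrite subnK // size_wheel; lia.
Qed.

Lemma independence_numberE (R : realType) n : (3 <= n)%N ->
  independence_number (Gn R n) = alpha n.
Proof.
by move=> n3; apply/eqP; rewrite eqn_leq independence_le // geq_max wheel_ge tetras_ge.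
Qed.

(** * Chromatic numbers and the ratio bound *)

Lemma chromatic_number_le (R : realType) (T T' : Type) (G : graph T) (G' : graph T') :
  (forall k, colorable G k -> colorable G' k) ->
  (chromatic_number R G' <= chromatic_number R G)%E.
Proof.
move=> h; apply: le_ereal_inf_tmp => _ [k Gk <-]; apply: ereal_inf_lbound.
by exists k => //; exact: h.
Qed.

Lemma colorable_sub (R : realType) n (A B : set 'rV[R]_n) k : (A `<=` B)%classic ->
  colorable (unit_distance_graph B) k -> colorable (unit_distance_graph A) k.
Proof.
by move=> AB [f [fk fN]]; exists f; split=> [x /AB|x y /AB ? /AB ?]; [exact: fk|exact: fN].
Qed.

(* Halving maps adjacent vertices of [Gn] to points at distance [sqrt ((3 + 3 - 2) / 4) = 1]. *)
Lemma colorable_half (R : realType) n k :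
  colorable (unit_distance_graph (rational_points R n)) k -> colorable (Gn R n) k.
Proof.
case=> f [fk fN]; have half v : Vn R n v -> rational_points R n (2^-1 *: v).
  move=> [v01 _] i; have := v01 i; rewrite !inE mxE.
  case/or3P=> /eqP->; apply/rationalP; [exists (-1), 2 | exists 0, 1 | exists 1, 2].
  - by rewrite mulrC rmorphN rmorph1.
  - by rewrite mulr0 mul0r.
  by rewrite mulrC rmorph1.
have dotZ c (u v : 'rV[R]_n) : dot (c *: u) v = c * dot u v.
  by rewrite /dot mulr_sumr; apply: eq_bigr => i _; rewrite mxE mulrA.
exists (fun v => f (2^-1 *: v)); split=> [v /half|u v uV vV uv]; first exact: fk.
apply: fN; [exact: half|exact: half|]; rewrite /= /unit_distance /euclidean_norm -scalerBr.
have -> : dot (2^-1 *: (u - v)) (2^-1 *: (u - v)) = 1; last exact: sqrtr1.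
rewrite dotZ dotC dotZ -scaleN1r !(dotDl, dotDr) !dotZ !(dotC _ (-1 *: v)) !dotZ.
by rewrite (dotC v u) !norm_Vn // (uv : dot u v = 1); field.
Qed.


Lemma num_vertices_le (R : realType) n k : colorable (Gn R n) k ->
  (num_vertices (Gn R n) <= k * independence_number (Gn R n))%N.
Proof.
case=> f [fk fN]; pose V := fset_set (Vn R n).
have VE v : (v \in V) = (v \in Vn R n) by rewrite in_fset_set //; exact: finite_Vn.
pose C i := [fset v in [seq v <- V | f v == i]]%fset.
have Ci i : (#|` C i| <= independence_number (Gn R n))%N.
  apply: leq_bigmax_seq; first by rewrite fpowersetE; apply/fsubsetP => v; rewrite !inE mem_filter => /andP[].
  apply/asboolP => u v; rewrite !inE !mem_filter /= => /andP[/eqP uc uV] /andP[/eqP vc vV] uv.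
  by apply: (fN u v) => //; [move: uV|move: vV|rewrite uc vc]; rewrite ?VE ?inE.
have -> : num_vertices (Gn R n) = (\sum_(i < k) #|` C i|)%N.
  rewrite /num_vertices /= -/V.
  transitivity (\sum_(v <- V) \sum_(i < k) (f v == i))%N.
    rewrite -sum1_size; apply: eq_big_seq => v vV.
    have vk : (f v < k)%N by apply: fk; move: vV; rewrite VE inE.
    rewrite (bigD1 (Ordinal vk)) //= eqxx big1 // => i /eqP iv.
    by apply/eqP; rewrite eqb0; apply: contra_notN iv => /eqP e; apply/val_inj.
  rewrite exchange_big; apply: eq_bigr => i _.
  rewrite card_fseq undup_id ?filter_uniq ?fset_uniq // size_filter -sum1_count [RHS]big_mkcond.
  by apply: eq_bigr => v _; case: (_ == _).
rewrite -[k in (k * _)%N]card_ord -sum_nat_const; apply: leq_sum => i _; exact: Ci.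
Qed.

Lemma alpha_gt0 n : (3 <= n)%N -> (0 < alpha n)%N.
Proof.
move=> n3; rewrite leq_max -/(cn n); apply/orP; right.
have : (cn n <= 2)%N by rewrite /cn; case: (n %% 4)%N => [|[|]].
by move: (cn n) n3; lia.
Qed.

Lemma alphaE (R : realType) n : (3 <= n)%N ->
  (alpha n)%:R = Num.max (6 * n%:R - 28) (4 * n%:R - 4 * (cn n)%:R) :> R.
Proof.
move=> n3; have c2 : (cn n <= 2)%N by rewrite /cn; case: (n %% 4)%N => [|[|]].
change (alpha n) with (maxn (6 * n - 28) (4 * n - 4 * cn n)).
have -> : 4 * n%:R - 4 * (cn n)%:R = (4 * n - 4 * cn n)%:R :> R.
  by rewrite natrB ?natrM //; lia.
have [n5|n4] := leqP 5 n.
  have -> : 6 * n%:R - 28 = (6 * n - 28)%:R :> R by rewrite natrB ?natrM //; lia.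
  by rewrite /Num.max ltr_nat /maxn; case: ifP.
(* For [n] at most 4 the natural difference is 0 and the real one is negative; both maxima are the
   other, nonnegative term. *)
rewrite (_ : 6 * n - 28 = 0)%N ?max0n; last by lia.
rewrite max_r // (@le_trans _ _ 0) // subr_le0 -natrM ler_nat; lia.
Qed.

Unset Implicit Arguments.
Local Open Scope classical_set_scope.
Local Open Scope ring_scope.

Theorem theorem2 (R : realType) (n : nat) (hn : (3 <= n)%N) :
  [/\ (chromatic_number R (unit_distance_graph [set: 'rV[R]_n]) >=
       chromatic_number R (unit_distance_graph (rational_points R n)))%E,
      (chromatic_number R (unit_distance_graph (rational_points R n)) >=
       chromatic_number R (Gn R n))%E,
      (chromatic_number R (Gn R n) >=
       ((num_vertices (Gn R n))%:R / (independence_number (Gn R n))%:R)%:E)%E &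
      (num_vertices (Gn R n))%:R / (independence_number (Gn R n))%:R =
      8 * 'C(n, 3)%:R /
        Num.max (6 * n%:R - 28) (4 * n%:R - 4 * (cn n)%:R) :> R].
Proof.
split.
- by apply: chromatic_number_le => k; exact: colorable_sub.
- by apply: chromatic_number_le => k; exact: colorable_half.
- apply: le_ereal_inf_tmp => _ [k Gk <-]; rewrite lee_fin.
  rewrite ler_pdivrMr ?ltr0n; last by rewrite independence_numberE // alpha_gt0.
  by rewrite -natrM ler_nat; exact: num_vertices_le.
rewrite num_vertices_Gn independence_numberE // natrM; congr (_ / _).
exact: alphaE.
Qed.
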